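(* For every prime number $p>0$ and every integer $d>0$, $$\mathcal{T}_{d,p} \cap \mathbb{Z}_{(p)} \subseteq \mathcal{T}_{d,p}^{\circ}.$$
   Context: A ring $A$ of characteristic $p>0$ is $F$-finite if the Frobenius map $F: A\to A$ is a finite ring homomorphism. $F^e_*A$ denotes $A$ viewed as an $A$-module via the $e$-th iterate $F^e$ of Frobenius. For an $F$-finite regular local ring $A$ of characteristic $p$ and a non-zero principal ideal $(f)\subsetneq A$, the $F$-pure threshold $\mathrm{fpt}(A;(f))$ is the supremum of all real $s\ge 0$ for which there exist an integer $e>0$ and $\phi\in \mathrm{Hom}_A(F^e_*A,A)$ with $\phi(F^e_*(f^{\lceil s(p^e-1)\rceil}A))=A$. By convention $\mathrm{fpt}(A;(0))=0$. For an integer $d>0$, $\mathcal{T}_{d,p}\subseteq\mathbb{R}$ is the set of all values $\mathrm{fpt}(A;(f))$, where $A$ runs through all $F$-finite $d$-dimensional regular local rings of characteristic $p$ and $(f)\subsetneq A$ runs through all proper principal ideals of $A$. Let $\overline{\mathbb{F}}_p$ be an algebraic closure of $\mathbb{F}_p$. $\mathcal{T}_{d,p}^{\circ}$ is the set of all values $\mathrm{fpt}(A;(f))$, where $A=(\overline{\mathbb{F}}_p[x_1,\dots,x_d])_{(x_1,\dots,x_d)}$ is the localization of the polynomial ring at the origin and $(f)\subsetneq A$ runs through all proper principal ideals. $\mathbb{Z}_{(p)}\subseteq\mathbb{Q}$ is the set of rational numbers whose denominator in lowest terms is not divisible by $p$. *)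

(* Defs.v *)
From HB Require Import structures.
From mathcomp Require Import all_boot all_order all_algebra.
From mathcomp Require Import mpoly.
From mathcomp Require Import boolp classical_sets reals.

Set Implicit Arguments.
Unset Strict Implicit.
Unset Printing Implicit Defensive.

Import Order.TTheory GRing.Theory Num.Theory.

Local Open Scope ring_scope.
Local Open Scope classical_set_scope.

Section Ideals.
Variable A : comNzRingType.
Implicit Types (I P M : set A) (f : A).

(* Ideals are classical sets and may be improper, unlike those of
   [idealr_closed]. *)
Definition ideal I :=
  [/\ I 0, forall x y, I x -> I y -> I (x + y) & forall a x, I x -> I (a * x)].

Definition ideal_gen n (g : 'I_n -> A) : set A :=
  [set x | exists c : 'I_n -> A, x = \sum_(i < n) c i * g i].

Definition principal f : set A := [set a * f | a in [set: A]].

Definition prime_ideal P :=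
  [/\ ideal P, ~ P 1 & forall x y, P (x * y) -> P x \/ P y].

Definition maximal_ideal M :=
  [/\ ideal M, M `<` [set: A] &
    forall I, ideal I -> M `<=` I -> I `<` [set: A] -> I = M].

Definition noetherian :=
  forall I, ideal I -> exists n (g : 'I_n -> A), I = ideal_gen g.

Definition prime_chain n :=
  exists P : 'I_n.+1 -> set A,
    (forall i, prime_ideal (P i)) /\ (forall i j : 'I_n.+1, (i < j)%N -> P i `<` P j).

Definition krull_dim d :=
  prime_chain d /\ (forall n, prime_chain n -> (n <= d)%N).

Definition regular_local_ring d :=
  [/\ noetherian, krull_dim d &
    exists M, [/\ maximal_ideal M, forall N, maximal_ideal N -> N = M &
      exists g : 'I_d -> A, M = ideal_gen g]].

End Ideals.

(* F^e_*A: the additive group of [A], on which [a : A] acts as multiplication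
   by [frob charA e a]. *)
Definition frob_push (p : nat) (A : comNzRingType) (charA : p \in [pchar A])
  (e : nat) : Type := A.

Section Frobenius.
Variables (p : nat) (A : comNzRingType) (charA : p \in [pchar A]) (e : nat).

Local Notation frob_pushA := (frob_push charA e).

Definition frob (a : A) : A := iter e (pFrobenius_aut charA) a.

Lemma frobE a : frob a = a ^+ (p ^ e).
Proof.
rewrite /frob; elim: e => [|n IHn] //=.
by rewrite IHn pFrobenius_autE -exprM expnSr.
Qed.

Lemma frob_is_zmod_morphism : zmod_morphism frob.
Proof.
move=> a b; rewrite /frob; elim: e => [|n IHn] //=.
by rewrite IHn pFrobenius_autB_comm //; apply: mulrC.
Qed.

Lemma frob_is_monoid_morphism : monoid_morphism frob.
Proof. by split=> [|a b]; rewrite !frobE ?expr1n ?exprMn. Qed.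

HB.instance Definition _ := GRing.Zmodule.copy frob_pushA A.

Definition frob_scale (a : A) (x : frob_pushA) : frob_pushA := frob a * (x : A).

Lemma frob_scaleA a b x :
  frob_scale a (frob_scale b x) = frob_scale (a * b) x.
Proof. by rewrite /frob_scale mulrA (frob_is_monoid_morphism).2. Qed.

Lemma frob_scale1 : left_id 1 frob_scale.
Proof. by move=> x; rewrite /frob_scale (frob_is_monoid_morphism).1 mul1r. Qed.

Lemma frob_scaleDr : right_distributive frob_scale +%R.
Proof. by move=> a x y; rewrite /frob_scale mulrDr. Qed.

Lemma frob_scaleDl x : {morph frob_scale^~ x : a b / a + b}.
Proof.
by move=> a b; rewrite /frob_scale frobE exprDn_pchar -?frobE ?mulrDl //;
  rewrite pnatX pnatE ?charA ?(pcharf_prime charA).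
Qed.

HB.instance Definition _ := GRing.Zmodule_isLmodule.Build A frob_pushA
  frob_scaleA frob_scale1 frob_scaleDr frob_scaleDl.

End Frobenius.

Definition finite_module (A : comNzRingType) (M : lmodType A) :=
  exists n (g : 'I_n -> M),
    forall x, exists c : 'I_n -> A, x = \sum_(i < n) c i *: g i.

Definition F_finite (p : nat) (A : comNzRingType) (charA : p \in [pchar A]) :=
  finite_module (frob_push charA 1).

Section Fpt.
Variables (R : realType) (p : nat) (A : comNzRingType).
Variable charA : p \in [pchar A].

(* An integer ceiling is converted to [nat] by its absolute value, which is
   harmless as [0 <= s]. *)
Definition fpt_exponents (f : A) : set R :=
  [set s : R | 0 <= s /\ exists e : nat, (0 < e)%N /\
    exists phi : {linear frob_push charA e -> A^o},
      phi @` principal (f ^+ `|Num.ceil (s * (p ^ e - 1)%:R)|%N) = [set: A]].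

(* fpt(A;(f)), which depends on [f] only through the ideal it generates.  The
   set of exponents contains 0 and is bounded by 1 when [A] is an F-finite
   regular local ring and [f] a non-unit, so [sup] is a true supremum. *)
Definition fpt (f : A) : R := if f == 0 then 0 else sup (fpt_exponents f).

Definition fpt_values : set R :=
  [set fpt f | f in [set f : A | principal f `<` [set: A]]].

End Fpt.

Arguments fpt_values R {p A} charA.

Definition fpt_set (R : realType) (d p : nat) : set R :=
  [set t : R | exists (A : comNzRingType) (charA : p \in [pchar A]),
    [/\ F_finite charA, regular_local_ring A d & fpt_values R charA t]].

(* The localization of a domain at a prime ideal, as a subring of its field of
   fractions.  The proof of primality is a parameter because the ring structure
   depends on it. *)
Definition in_localization (D : idomainType) (P : set D)
    (primeP : prime_ideal P) : {pred {fraction D}} :=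
  fun x => `[< exists a b : D, ~ P b /\ x = tofrac a / tofrac b >].

Definition localization (D : idomainType) (P : set D)
    (primeP : prime_ideal P) : Type :=
  {x : {fraction D} | in_localization primeP x}.

Section Localization.
Variables (D : idomainType) (P : set D) (primeP : prime_ideal P).

Local Notation "x %:F" := (@tofrac D x).

Fact not_prime_neq0 b : ~ P b -> b%:F != 0.
Proof.
by move=> Pb; rewrite tofrac_eq0; apply/eqP => b0; apply: Pb; rewrite b0;
  case: primeP => -[].
Qed.

Fact not_primeM a b : ~ P a -> ~ P b -> ~ P (a * b).
Proof. by case: primeP => _ _ PM Pa Pb /PM[]. Qed.

Fact in_localization_subring : subring_closed (in_localization primeP).
Proof.
split.
- apply/asboolP; exists 1, 1; rewrite tofrac1 divr1; split=> //.
  by case: primeP.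
- move=> _ _ /asboolP[a [b [Pb ->]]] /asboolP[c [d [Pd ->]]].
  apply/asboolP; exists (a * d - c * b), (b * d); split; first exact: not_primeM.
  by rewrite tofracB !tofracM -mulNr addf_div ?not_prime_neq0 // mulNr.
- move=> _ _ /asboolP[a [b [Pb ->]]] /asboolP[c [d [Pd ->]]].
  apply/asboolP; exists (a * c), (b * d); split; first exact: not_primeM.
  by rewrite !tofracM mulf_div.
Qed.

HB.instance Definition _ := GRing.isSubringClosed.Build {fraction D}
  (in_localization primeP) in_localization_subring.

HB.instance Definition _ := [isSub of localization primeP for @sval _ _].
HB.instance Definition _ := [Choice of localization primeP by <:].
HB.instance Definition _ :=
  [SubChoice_isSubComNzRing of localization primeP by <:].

Lemma pchar_localization p :
  p \in [pchar D] -> p \in [pchar localization primeP].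
Proof.
rewrite !inE => /andP[-> /eqP p0] /=; apply/eqP/val_inj.
rewrite (rmorph_nat (\val : localization primeP -> {fraction D})) rmorph0.
by rewrite -(rmorph_nat (@tofrac D)) p0 rmorph0.
Qed.

End Localization.

Section Origin.
Variables (K : fieldType) (d : nat).

Definition origin_ideal : set {mpoly K[d]} := ideal_gen (fun i : 'I_d => 'X_i).

Lemma origin_idealE (f : {mpoly K[d]}) : origin_ideal f <-> f@_0%MM = 0.
Proof.
have gen_ideal : ideal origin_ideal.
  split.
  - by exists (fun=> 0); rewrite big1 // => i _; rewrite mul0r.
  - move=> _ _ [c ->] [c' ->]; exists (fun i => c i + c' i).
    by rewrite -big_split; apply: eq_bigr => i _; rewrite mulrDl.
  - move=> a _ [c ->]; exists (fun i => a * c i).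
    by rewrite mulr_sumr; apply: eq_bigr => i _; rewrite mulrA.
case: gen_ideal => g0 gD gM; split=> [[c ->]|f0].
  rewrite raddf_sum big1 // => i _ /=.
  by rewrite rmorphM /= mcoeffX mnm1_eq0 mulr0.
rewrite (mpolyE f) big_seq; elim/big_ind: _ => // m mf.
have m_neq0 : m != 0%MM.
  by apply: contraTneq mf => ->; rewrite mcoeff_msupp f0 eqxx.
have [i mi] : exists i, m i != 0%N.
  apply/existsP; apply: contraR m_neq0; rewrite negb_exists => /forallP m0.
  by apply/eqP/mnmP => i; rewrite mnm0E; apply/eqP; rewrite -[_ == _]negbK.
have lm : (U_(i) <= m)%MM by rewrite lep1mP.
rewrite -{2}(submK lm) mpolyXD scalerAl; apply: gM.
exists (fun j => (j == i)%:R); rewrite (bigD1 i) //= eqxx mul1r big1 ?addr0 //.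
by move=> j /negPf ->; rewrite mul0r.
Qed.

Lemma origin_ideal_prime : prime_ideal origin_ideal.
Proof.
split; first split.
- by apply/origin_idealE; rewrite mcoeff0.
- move=> x y /origin_idealE x0 /origin_idealE y0; apply/origin_idealE.
  by rewrite mcoeffD x0 y0 addr0.
- move=> a x /origin_idealE x0; apply/origin_idealE.
  by rewrite rmorphM /= x0 mulr0.
- by move=> /origin_idealE/eqP; rewrite mcoeff1 eqxx oner_eq0.
- move=> x y /origin_idealE/eqP; rewrite rmorphM mulf_eq0 /=.
  by move=> /orP[]/eqP ?; [left|right]; apply/origin_idealE.
Qed.

Definition origin_local_ring : comNzRingType := localization origin_ideal_prime.

Lemma pchar_origin_local_ring p :
  p \in [pchar K] -> p \in [pchar origin_local_ring].
Proof.
move=> charK; apply: pchar_localization.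
exact: (rmorph_pchar (@mpolyC d K) charK).
Qed.

End Origin.

(* As [fpt_set], with [A] restricted to the local ring of K^d at the origin. *)
Definition fpt_set_origin (R : realType) (d p : nat) (K : fieldType)
    (charK : p \in [pchar K]) : set R :=
  fpt_values R (pchar_origin_local_ring d charK).

Definition localized_int (R : realType) (p : nat) : set R :=
  [set ratr q | q in [set q : rat | ~~ (p%:Z %| denq q)%Z]].

Definition algebraic_closure_Fp (p : nat) (K : closedFieldType)
    (iota : {rmorphism 'F_p -> K}) :=
  forall x : K, algebraicOver iota x.

Arguments fpt_set R d p : clear implicits.
Arguments fpt_set_origin R d {p K} charK.
Arguments localized_int R p : clear implicits.

Lemma pchar_over_Fp (p : nat) (p_pr : prime p) (K : fieldType)
  (iota : {rmorphism 'F_p -> K}) : p \in [pchar K].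
Proof. exact: (rmorph_pchar iota (pchar_Fp p_pr)). Qed.

(* Main.v *)
(* Write t = n / (q - 1) with q = p ^ e > 1, and let m be the maximal ideal of A.
   As A is regular and F-finite, A is free over its subring of q-th powers, and
   t = fpt(f) means that f^n is not in m^[q] while f^(n_k + 1) is in m^[q^k] for
   all k, where n_k = n (q^k - 1) / (q - 1).  The elements a with f^n_k a in
   m^[q^k] for all k form a prime ideal P that contains f and satisfies
   f^n P <= P^[q], the center of F-purity.  Let y_1, ..., y_c be minimal
   generators of the maximal ideal of A_P; choosing a coefficient field of
   A_P / P^[q] turns f into a polynomial G in c <= d variables over the residue
   field, with G(0) = 0 and G^n = u (y_1 ... y_c)^(q - 1) modulo (y_1^q, ..., y_c^q),
   u != 0.  These are finitely many polynomial equations over F_p, so by the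
   Nullstellensatz they have a solution over any algebraically closed field of
   characteristic p.  Conversely, for such a G over K the trace-like map dual to
   (y_1 ... y_c)^(q - 1) splits G^n, and J = (y_1, ..., y_c) satisfies G in J and
   G^n J <= J^[q], so that fpt(G) = n / (q - 1).

   Regularity is used only through lengths: along a chain of primes of length d
   the length of A / m^[q] grows at least like q^d, and being submultiplicative
   and at most q^d it equals q^d, which makes the parameters independent.  At P,
   independence comes from the freeness of Frobenius and Lech's lemma, and the
   same growth argument from P to m gives c <= d. *)
Require Import Defs.
From HB Require Import structures.
From mathcomp Require Import all_boot all_order all_algebra.
From mathcomp Require Import cyclic mpoly.
From mathcomp Require Import boolp classical_sets reals.
From mathcomp Require Import ring zify.

Set Implicit Arguments.
Unset Strict Implicit.
Unset Printing Implicit Defensive.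

Import Order.TTheory GRing.Theory Num.Theory.

Local Open Scope ring_scope.
Local Open Scope classical_set_scope.

(** * Ideals and localization at a prime *)

(** The hypothesis on [t] is what lets finitely many equations suffice. A denominator prime to [p]
    divides some p^e - 1, and then n_(k+1) = n + q n_k, so one condition at level [q], f^n P <=
    P^[q], propagates to every level q^k. Hence only A_P / P^[q] matters, and a coefficient field of
    that quotient takes the place of completion and Cohen's structure theorem. The passage from M to
    P is forced: f^n need not multiply M into M^[q], while it does multiply P into P^[q], and this
    is what concentrates G^n in the single corner monomial. The value t = 0, which admits no
    positive [n], comes from f = 0.

    Neither A_P nor a length function is constructed. Statements about A_P are phrased in [A]
    through [satur], with denominators carried along explicitly. Length is replaced by two
    predicates, [chain] for lower bounds and [comp_series] for upper bounds, and [chain_comp_series]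
    compares them. *)

Section IdealTheory.
Variable A : comNzRingType.
Implicit Types (I J L M P Q S : set A) (a b f g h r s x y z : A).

Lemma idealB I x y : ideal I -> I x -> I y -> I (x - y).
Proof. by case=> _ ID IM Ix Iy; apply: ID => //; rewrite -mulN1r; apply: IM. Qed.

Lemma ideal_bigsum I (T : Type) (r : seq T) (Q : pred T) (F : T -> A) :
  ideal I -> (forall i, Q i -> I (F i)) -> I (\sum_(i <- r | Q i) F i).
Proof. by case=> I0 ID _ IF; elim/big_ind: _ => //; apply: ID. Qed.

Lemma ideal_sum I n (F : 'I_n -> A) :
  ideal I -> (forall i, I (F i)) -> I (\sum_i F i).
Proof. by move=> idI IF; apply: ideal_bigsum. Qed.

Lemma ideal_mulr I a x : ideal I -> I x -> I (x * a).
Proof. by case=> _ _ IM Ix; rewrite mulrC; apply: IM. Qed.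

Lemma ideal_subr I x y : ideal I -> I y -> I (x - y) -> I x.
Proof. by case=> _ ID _ Iy Ixy; rewrite -(subrK y x); apply: ID. Qed.

Lemma idealT I : ideal I -> I 1 -> I = [set: A].
Proof.
case=> _ _ IM I1; apply/seteqP; split=> // x _.
by rewrite -(mulr1 x); apply: IM.
Qed.

Lemma ideal_gen_ideal n (g : 'I_n -> A) : ideal (ideal_gen g).
Proof.
split.
- by exists (fun=> 0); rewrite big1 // => i _; rewrite mul0r.
- move=> _ _ [c ->] [c' ->]; exists (fun i => c i + c' i).
  by rewrite -big_split; apply: eq_bigr => i _; rewrite mulrDl.
- move=> a _ [c ->]; exists (fun i => a * c i).
  by rewrite mulr_sumr; apply: eq_bigr => i _; rewrite mulrA.
Qed.

Lemma ideal_gen_mem n (g : 'I_n -> A) i : ideal_gen g (g i).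
Proof.
exists (fun j => (j == i)%:R); rewrite (bigD1 i) //= eqxx mul1r big1 ?addr0 //.
by move=> j /negPf->; rewrite mul0r.
Qed.

Lemma ideal_gen_sub n (g : 'I_n -> A) J :
  ideal J -> (forall i, J (g i)) -> ideal_gen g `<=` J.
Proof.
move=> idJ Jg _ [c ->]; apply: ideal_sum => // i.
by case: idJ => _ _; apply.
Qed.

Definition ideal_add I a : set A := [set x | exists i r, I i /\ x = i + r * a].

Lemma ideal_add_ideal I a : ideal I -> ideal (ideal_add I a).
Proof.
move=> [I0 ID IM]; split.
- by exists 0, 0; rewrite mul0r addr0.
- move=> _ _ [i [r [Ii ->]]] [j [s [Ij ->]]]; exists (i + j), (r + s).
  by split; [apply: ID | rewrite mulrDl addrACA].
- move=> b _ [i [r [Ii ->]]]; exists (b * i), (b * r).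
  by split; [apply: IM | rewrite mulrDr mulrA].
Qed.

Lemma sub_ideal_add I a : I `<=` ideal_add I a.
Proof. by move=> x Ix; exists x, 0; rewrite mul0r addr0. Qed.

Lemma mem_ideal_add I a : ideal I -> ideal_add I a a.
Proof. by case=> I0 _ _; exists 0, 1; rewrite mul1r add0r. Qed.

Lemma ideal_add_sub I a J : ideal J -> I `<=` J -> J a -> ideal_add I a `<=` J.
Proof.
move=> [_ JD JM] IJ Ja _ [i [r [Ii ->]]].
by apply: JD; [apply: IJ | apply: JM].
Qed.

Lemma ideal_add_id I a : ideal I -> I a -> ideal_add I a = I.
Proof.
move=> idI Ia; apply/seteqP; split; last exact: sub_ideal_add.
exact: ideal_add_sub.
Qed.

Lemma ideal_addS I J a : I `<=` J -> ideal_add I a `<=` ideal_add J a.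
Proof. by move=> IJ _ [i [r [Ii ->]]]; exists i, r; split=> //; apply: IJ. Qed.

Lemma ideal_addAC I a b :
  ideal_add (ideal_add I a) b = ideal_add (ideal_add I b) a.
Proof.
suff sub c d : ideal_add (ideal_add I c) d `<=` ideal_add (ideal_add I d) c.
  by apply/seteqP; split; apply: sub.
move=> _ [_ [s [[i [r [Ii ->]]] ->]]]; exists (i + s * d), r.
by split; [exists i, s | rewrite addrAC].
Qed.

Definition ideal_span S : set A :=
  [set a | forall J, ideal J -> S `<=` J -> J a].

Lemma ideal_span_ideal S : ideal (ideal_span S).
Proof.
split=> [J [] //|x y Sx Sy J idJ SJ|a x Sx J idJ SJ].
  by have [_ JD _] := idJ; apply: JD; [apply: Sx | apply: Sy].
by have [_ _ JM] := idJ; apply: JM; apply: Sx.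
Qed.

Lemma sub_ideal_span S : S `<=` ideal_span S.
Proof. by move=> a Sa J _; apply. Qed.

Lemma ideal_span_sub S J : ideal J -> S `<=` J -> ideal_span S `<=` J.
Proof. by move=> idJ SJ a; apply. Qed.

(** For an ideal [I] this is the kernel of A -> A_P / I A_P: an equality in A_P becomes membership
    up to a multiplier outside [P]. *)
Definition satur P I : set A := [set a | exists s, ~ P s /\ I (s * a)].

Section Prime.
Variable P : set A.
Hypothesis primeP : prime_ideal P.

Let idP : ideal P. Proof. by case: primeP. Qed.
Let P1 : ~ P 1. Proof. by case: primeP. Qed.

Lemma prime_neqM s t : ~ P s -> ~ P t -> ~ P (s * t).
Proof. by case: primeP => _ _ PM Ps Pt /PM[]. Qed.

Lemma prime_expr s n : P (s ^+ n) -> P s.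
Proof.
elim: n => [|n IH]; first by rewrite expr0 => /P1.
by rewrite exprS; case: primeP => _ _ PM /PM[].
Qed.

Lemma prime_neqX s n : ~ P s -> ~ P (s ^+ n).
Proof. by move=> Ps /prime_expr. Qed.

Lemma satur_ideal I : ideal I -> ideal (satur P I).
Proof.
move=> [I0 ID IM]; split.
- by exists 1; rewrite mulr0.
- move=> x y [s [Ps Isx]] [t [Pt Ity]]; exists (s * t).
  split; first exact: prime_neqM.
  have -> : s * t * (x + y) = t * (s * x) + s * (t * y) by ring.
  by apply: ID; apply: IM.
- by move=> a x [s [Ps Isx]]; exists s; split=> //; rewrite mulrCA; apply: IM.
Qed.

Lemma sub_satur I : I `<=` satur P I.
Proof. by move=> x Ix; exists 1; rewrite mul1r. Qed.

Lemma saturS I J : I `<=` J -> satur P I `<=` satur P J.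
Proof. by move=> IJ x [s [Ps /IJ]]; exists s. Qed.

Lemma satur_idem I : satur P (satur P I) = satur P I.
Proof.
apply/seteqP; split; last exact: sub_satur.
move=> x [s [Ps [t [Pt Itsx]]]]; exists (t * s); rewrite -mulrA; split=> //.
exact: prime_neqM.
Qed.

Lemma saturP I s a : ~ P s -> satur P I (s * a) -> satur P I a.
Proof. by move=> Ps Isa; rewrite -satur_idem; exists s. Qed.

Lemma satur_prime : satur P P = P.
Proof.
apply/seteqP; split; last exact: sub_satur.
by move=> x [s [Ps Psx]]; case: primeP => _ _ /(_ _ _ Psx)[].
Qed.

End Prime.

Lemma satur_sub P Q I : P `<=` Q -> satur Q I `<=` satur P I.
Proof. by move=> PQ x [s [Qs Isx]]; exists s; split=> // /PQ. Qed.

Section Noetherian.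
Hypothesis noethA : noetherian A.

(** [Zorn_bigcup] also treats the empty chain, hence the extra member [set0]. The union of a
    nonempty chain is finitely generated, and one member contains all the generators. *)
Lemma noetherian_max (F : set (set A)) I0 :
  F `<=` @ideal A -> F I0 ->
  exists I, F I /\ forall J, F J -> I `<=` J -> J = I.
Proof.
move=> Fid FI0.
have [|M [FM Mmax]] := @Zorn_bigcup A [set X | X = set0 \/ F X].
  move=> C CF Ctot; have [C0|] := pselect (C `<=` [set set0]).
    left; apply/seteqP; split=> // x [X /C0 -> //].
  move=> /existsNP[X0 /not_implyP[CX0 X00]].
  have chain_mem : forall X, C X -> X !=set0 -> F X.
    by move=> X CX Xn; case: (CF X CX) => // X_0; case: Xn => x; rewrite X_0.
  have X0n : X0 !=set0 by apply/set0P/eqP.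
  have idU : ideal (\bigcup_(X in C) X).
    split.
    - exists X0 => //; have := chain_mem _ CX0 X0n.
      by case/Fid.
    - move=> x y [X CX Xx] [Y CY Yy].
      case: (Ctot X Y CX CY) => XY; [exists Y | exists X] => //.
        have [|_ YD _] := Fid Y _; first by apply: chain_mem => //; exists y.
        by apply: YD => //; apply: XY.
      by have [|_ YD _] := Fid X _; [apply: chain_mem => //; exists x | apply: YD => //; apply: XY].
    - move=> a x [X CX Xx]; exists X => //.
      by have [|_ _ XM] := Fid X _; [apply: chain_mem => //; exists x | apply: XM].
  have [n [g Ug]] := noethA idU.
  have Ugi i : (\bigcup_(X in C) X) (g i) by rewrite Ug; apply: ideal_gen_mem.
  have [X [CX Xn Xg]] : exists X, [/\ C X, X !=set0 & forall i, X (g i)].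
    clear Ug; elim: n g Ugi => [|n IH] g Ugi.
      by exists X0; split=> // -[].
    have [|X [CX Xn Xg]] := IH (fun i => g (lift ord0 i)); first by move=> i; apply: Ugi.
    have [Y CY Yg] := Ugi ord0.
    case: (Ctot X Y CX CY) => XY; [exists Y | exists X]; split=> //.
    - by exists (g ord0).
    - by move=> i; case: (unliftP ord0 i) => [j ->|-> //]; apply: XY.
    - by move=> i; case: (unliftP ord0 i) => [j -> //|->]; apply: XY.
  right; suff -> : \bigcup_(X in C) X = X by apply: chain_mem.
  apply/seteqP; split; last by move=> x Xx; exists X.
  by rewrite Ug; apply: ideal_gen_sub => //; apply/Fid/chain_mem.
have nM0 : M <> set0.
  move=> M0; apply: (Mmax I0); last by right.
  rewrite M0; split=> // I00.
  by have [I0_0 _ _] := Fid _ FI0; have /= := I00 0 I0_0.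
case: FM => // FM; exists M; split=> // J FJ MJ.
apply/seteqP; split=> //; apply: contrapT => JM.
by apply: (Mmax J); [split | right].
Qed.

(* The complement of a maximal multiplicative set avoiding [I] and containing
   the complement of [Q0] is a minimal prime of [I]; maximality yields directly
   the nilpotency property that is used. *)
Lemma minimal_prime_over I Q0 : ideal I -> prime_ideal Q0 -> I `<=` Q0 ->
  exists Q, [/\ prime_ideal Q, I `<=` Q, Q `<=` Q0 &
    forall a, Q a -> exists n, satur Q I (a ^+ n)].
Proof.
move=> idI pQ0 IQ0; have [I0 ID IM] := idI.
pose mult S := [/\ forall s, ~ Q0 s -> S s, forall s t, S s -> S t -> S (s * t) &
  forall s, S s -> ~ I s].
have [|S [SP Smax]] := @Zorn_bigcup A [set X | X = set0 \/ mult X].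
  move=> C CF Ctot; have [C0|] := pselect (C `<=` [set set0]).
    by left; apply/seteqP; split=> // x [X /C0 -> //].
  move=> /existsNP[X0 /not_implyP[CX0 X00]].
  have CM X x : C X -> X x -> mult X.
    by move=> CX Xx; case: (CF X CX) => // X_0; rewrite X_0 in Xx.
  right; split.
  - have [x Xx] : X0 !=set0 by apply/set0P/eqP.
    by move=> s Qs; exists X0 => //; have [+ _ _] := CM _ _ CX0 Xx; apply.
  - move=> s t [X CX Xs] [Y CY Yt].
    case: (Ctot X Y CX CY) => XY; [exists Y | exists X] => //.
      by have [_ + _] := CM _ _ CY Yt; apply=> //; apply: XY.
    by have [_ + _] := CM _ _ CX Xs; apply=> //; apply: XY.
  - by move=> s [X CX Xs]; have [_ _] := CM _ _ CX Xs; apply.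
have [_ Q01 Q0M] := pQ0.
have multC : mult (~` Q0).
  by split=> // [s t Qs Qt /Q0M[] //|s Qs /IQ0].
have {SP}[S0 SM SI] : mult S.
  case: SP => // S0; exfalso; apply: (Smax (~` Q0)); last by right.
  by rewrite S0; split=> // C0; apply: (C0 1).
have S1 : S 1 by apply: S0.
have SX s n : S s -> S (s ^+ n).
  by move=> Ss; elim: n => [|n IH]; rewrite ?expr0 // exprS; apply: SM.
have Smax' a : ~ S a -> exists s n, S s /\ I (s * a ^+ n).
  move=> Sa; apply: contrapT => noI.
  apply: (Smax [set x | exists s n, S s /\ x = s * a ^+ n]).
    split; first by move=> s Ss; exists s, 0%N; rewrite expr0 mulr1.
    by move=> /(_ a) aS; apply/Sa/aS; exists 1, 1%N; rewrite mul1r expr1.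
  right; split.
  - by move=> s Qs; exists s, 0%N; rewrite expr0 mulr1; split=> //; apply: S0.
  - move=> _ _ [s [n [Ss ->]]] [t [m [St ->]]]; exists (s * t), (n + m)%N.
    by split; [apply: SM | rewrite exprD mulrACA].
  - by move=> _ [s [n [Ss ->]]] Isn; apply: noI; exists s, n.
exists (~` S); split.
- split; first split.
  + by move=> /SI /(_ I0).
  + move=> x y /Smax'[s [n [Ss Ix]]] /Smax'[t [m [St Iy]]] Sxy.
    apply: (SI (s * t * (x + y) ^+ (n + m))); first by apply: (SM) => //; [apply: SM | apply: SX].
    rewrite exprDn mulr_sumr; apply: ideal_sum => // i.
    rewrite mulrnAr -mulr_natl; apply: (IM).
    have [im|mi] := leqP i m.
      rewrite -addnBA // exprD.
      have -> : s * t * (x ^+ n * x ^+ (m - i) * y ^+ i) =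
        (t * x ^+ (m - i) * y ^+ i) * (s * x ^+ n) by ring.
      exact: IM.
    rewrite -(subnK (ltnW mi)) [y ^+ _]exprD.
    have -> : s * t * (x ^+ (n + m - (i - m + m)) * (y ^+ (i - m) * y ^+ m)) =
      (s * x ^+ (n + m - (i - m + m)) * y ^+ (i - m)) * (t * y ^+ m) by ring.
    exact: IM.
  + move=> a x /Smax'[s [n [Ss Ix]]] Sax; apply: (SI (s * (a * x) ^+ n)).
      by apply: SM => //; apply: SX.
    by rewrite exprMn mulrCA; apply: IM.
  + by apply.
  + move=> x y Sxy; apply: contrapT => /not_orP[/contrapT Sx /contrapT Sy].
    by apply: Sxy; apply: SM.
- by move=> x Ix /SI.
- by move=> x; apply: contra_notP => /S0.
- by move=> a /Smax'[s [n [Ss Isa]]]; exists n, s; split=> // /(_ Ss).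
Qed.

(** Nakayama's lemma in A_Q: I <= L + x I forces I <= L. For a maximal saturated [L'] above [L] not
    containing [I], and [g] in [I] outside [L'], the ideal L' + g A contains [I] locally, so [g]
    times an element outside [Q] lies in [L']. *)
Lemma Nakayama_satur Q I L x : prime_ideal Q -> ideal I -> ideal L ->
  satur Q L = L -> Q x ->
  (forall i, I i -> exists s j, [/\ ~ Q s, I j & L (s * i - x * j)]) ->
  I `<=` L.
Proof.
move=> pQ idI idL satL Qx INAK; apply: contrapT => nIL.
have [idQ _ QM] := pQ; have [_ _ QMl] := idQ.
have [||L' [[idL' satL' LL' nIL'] L'max]] := @noetherian_max
  [set J | [/\ ideal J, satur Q J = J, L `<=` J & ~ I `<=` J]] L.
- by move=> J [].
- by split.
apply: nIL' => g Ig; apply: contrapT => L'g.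
have idI' := ideal_add_ideal g idL'.
have IsubL' : I `<=` satur Q (ideal_add L' g).
  apply: contrapT => nI; apply: L'g.
  rewrite -[X in X g](L'max (satur Q (ideal_add L' g))).
  - exact/sub_satur/mem_ideal_add.
  - split=> //; [exact: satur_ideal | by rewrite satur_idem |].
    move=> y /LL' L'y; apply: (sub_satur pQ); exact: sub_ideal_add.
  - by move=> y L'y; apply: (sub_satur pQ); apply: sub_ideal_add.
have [s [j [Qs Ij Lsgj]]] := INAK g Ig.
have [t [Qt [l [r [L'l tjE]]]]] := IsubL' j Ij.
apply: L'g; rewrite -satL'; exists (t * s - x * r); split.
  move=> Qtsxr; apply: (prime_neqM pQ Qt Qs).
  by apply: (ideal_subr idQ _ Qtsxr); apply: ideal_mulr.
have -> : (t * s - x * r) * g = t * (s * g - x * j) + x * l.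
  by rewrite -(addrK (r * g) l) -tjE; ring.
by have [_ L'D L'M] := idL'; apply: L'D; apply: L'M => //; apply: LL'.
Qed.

End Noetherian.
End IdealTheory.

(** * Frobenius powers and lengths *)

Section FrobeniusPower.
Variables (A : comNzRingType) (p : nat).
Hypothesis charA : p \in [pchar A].
Implicit Types (I J L M P Q S : set A) (a b f g h r s x y z : A).

Lemma pexp_gt0 e : (0 < p ^ e)%N.
Proof. by rewrite expn_gt0 prime_gt0 ?(pcharf_prime charA). Qed.

Lemma pexprD e x y : (x + y) ^+ (p ^ e) = x ^+ (p ^ e) + y ^+ (p ^ e).
Proof.
by rewrite exprDn_pchar // pnatX pnatE ?(pcharf_prime charA) // charA.
Qed.

Lemma pexprB e x y : (x - y) ^+ (p ^ e) = x ^+ (p ^ e) - y ^+ (p ^ e).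
Proof. by rewrite -!(frobE charA) (frob_is_zmod_morphism charA). Qed.

Lemma pexpr_sum e n (F : 'I_n -> A) :
  (\sum_i F i) ^+ (p ^ e) = \sum_i F i ^+ (p ^ e).
Proof.
by apply: (big_morph (fun x => x ^+ (p ^ e)) (pexprD e)); rewrite expr0n gtn_eqF ?pexp_gt0.
Qed.

Definition frob_power I n := ideal_span [set z ^+ n | z in I].

Lemma frob_power_ideal I n : ideal (frob_power I n).
Proof. exact: ideal_span_ideal. Qed.

Lemma frob_powerX I n z : I z -> frob_power I n (z ^+ n).
Proof. by move=> Iz; apply: sub_ideal_span; exists z. Qed.

Lemma frob_power_sub I n J :
  ideal J -> (forall z, I z -> J (z ^+ n)) -> frob_power I n `<=` J.
Proof. by move=> idJ IJ; apply: ideal_span_sub => // _ [z Iz <-]; apply: IJ. Qed.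

Lemma frob_powerS I J n : I `<=` J -> frob_power I n `<=` frob_power J n.
Proof.
move=> IJ; apply: frob_power_sub; first exact: frob_power_ideal.
by move=> z /IJ; apply: frob_powerX.
Qed.

Lemma frob_power1 I : ideal I -> frob_power I 1 = I.
Proof.
move=> idI; apply/seteqP; split; first by apply: frob_power_sub => // z; rewrite expr1.
by move=> z Iz; rewrite -[z]expr1; apply: frob_powerX.
Qed.

Lemma frob_power_subid I n : ideal I -> (0 < n)%N -> frob_power I n `<=` I.
Proof.
move=> idI n0; apply: frob_power_sub => // z Iz.
by rewrite -(prednK n0) exprS; apply: ideal_mulr.
Qed.

Lemma preim_pexp_ideal J e : ideal J -> ideal [set z | J (z ^+ (p ^ e))].
Proof.
move=> [J0 JD JM]; split=> [|x y Jx Jy|a x Jx] /=.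
- by rewrite expr0n gtn_eqF ?pexp_gt0.
- by rewrite pexprD; apply: JD.
- by rewrite exprMn; apply: JM.
Qed.

Lemma frob_power_pexp I n e z :
  frob_power I n z -> frob_power I (n * p ^ e) (z ^+ (p ^ e)).
Proof.
apply: (@frob_power_sub I n [set y | frob_power I (n * p ^ e) (y ^+ (p ^ e))]).
  exact/preim_pexp_ideal/frob_power_ideal.
by move=> y Iy /=; rewrite -exprM; apply: frob_powerX.
Qed.

Lemma frob_powerM I n e :
  frob_power (frob_power I n) (p ^ e) = frob_power I (n * p ^ e).
Proof.
apply/seteqP; split; apply: frob_power_sub; try exact: frob_power_ideal.
- exact: frob_power_pexp.
- by move=> z Iz; rewrite exprM; do 2!apply: frob_powerX.
Qed.

Lemma frob_power_gen n (g : 'I_n -> A) e :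
  frob_power (ideal_gen g) (p ^ e) = ideal_gen (fun i => g i ^+ (p ^ e)).
Proof.
have idg := ideal_gen_ideal (fun i => g i ^+ (p ^ e)).
apply/seteqP; split.
  apply: frob_power_sub => // _ [c ->]; rewrite pexpr_sum.
  by exists (fun i => c i ^+ (p ^ e)); apply: eq_bigr => i _; rewrite exprMn.
apply: ideal_gen_sub; first exact: frob_power_ideal.
by move=> i; apply: frob_powerX; apply: ideal_gen_mem.
Qed.

Lemma frob_power_add I a e :
  frob_power (ideal_add I a) (p ^ e) `<=` ideal_add (frob_power I (p ^ e)) (a ^+ (p ^ e)).
Proof.
apply: frob_power_sub; first exact/ideal_add_ideal/frob_power_ideal.
move=> _ [i [r [Ii ->]]]; exists (i ^+ (p ^ e)), (r ^+ (p ^ e)).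
by split; [apply: frob_powerX | rewrite pexprD exprMn].
Qed.

Lemma frob_power_mulr I J n h a : (forall i, I i -> J (i * h)) ->
  frob_power I n a -> frob_power J n (a * h ^+ n).
Proof.
have [J0 JD JM] := frob_power_ideal J n.
move=> IJ; apply: (@frob_power_sub I n [set y | frob_power J n (y * h ^+ n)]).
  split=> /= [|x y Jx Jy|b x Jx].
  - by rewrite mul0r.
  - by rewrite mulrDl; apply: JD.
  - by rewrite -mulrA; apply: JM.
by move=> z Iz /=; rewrite -exprMn; apply: frob_powerX; apply: IJ.
Qed.

Lemma satur_pexp P I e x : prime_ideal P ->
  satur P I x -> satur P (frob_power I (p ^ e)) (x ^+ (p ^ e)).
Proof.
move=> pP [s [Ps Isx]]; exists (s ^+ (p ^ e)); split; first exact: prime_neqX.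
by rewrite -exprMn; apply: frob_powerX.
Qed.

End FrobeniusPower.

Section Length.
Variable A : comNzRingType.
Implicit Types (I J L M P Q S : set A) (a b f g h r s x y z : A).

(* [chain P I n]: the localization at [P] of [A / I] has a strictly increasing
   chain of submodules of length [n], so it has length at least [n]. *)
Fixpoint chain P I n : Prop :=
  if n is n'.+1 then exists a, ~ satur P I a /\ chain P (ideal_add I a) n'
  else True.

(* [comp_series M I n]: [A / I] has a filtration with [n] factors, each of which
   is a quotient of [A / M]. *)
Fixpoint comp_series M I n : Prop :=
  if n is n'.+1 then
    exists g, (forall x, M x -> I (x * g)) /\ comp_series M (ideal_add I g) n'
  else I 1.

Lemma chainS P I J n : I `<=` J -> chain P J n -> chain P I n.
Proof.
elim: n I J => [//|n IH] I J IJ /= [a [Ja cJ]]; exists a; split.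
  by move=> /(saturS IJ).
by apply: IH cJ; apply: ideal_addS.
Qed.

Lemma chain_leq P I m n : (m <= n)%N -> chain P I n -> chain P I m.
Proof.
elim: n m I => [|n IH] [|m] I //= mn [a [Ia cI]]; exists a; split=> //.
exact: IH cI.
Qed.

Lemma chain_satur P I n : prime_ideal P -> ideal I ->
  chain P I n -> chain P (satur P I) n.
Proof.
move=> pP; elim: n I => [//|n IH] I idI /= [a [Ia cI]]; exists a.
rewrite satur_idem //; split=> //.
apply: chainS (IH _ (ideal_add_ideal a idI) cI).
apply: ideal_add_sub; first exact/satur_ideal/ideal_add_ideal.
- exact/saturS/sub_ideal_add.
- exact/sub_satur/mem_ideal_add.
Qed.

(* Additivity of length along [0 -> A / J -> A / I -> A / (I + h A) -> 0], the
   first map being multiplication by [h]. *)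
Lemma chain_cat P I J h m n : prime_ideal P -> ideal I -> ideal J ->
  (forall z, satur P I (z * h) -> satur P J z) ->
  chain P J m -> chain P (ideal_add I h) n -> chain P I (m + n).
Proof.
move=> pP; elim: m I J => [|m IH] I J idI idJ col /=.
  by move=> _; apply: chainS; apply: sub_ideal_add.
move=> [a [Ja cJ]] cI; exists (a * h); split; first by move=> /col.
have idIa := ideal_add_ideal (a * h) idI.
apply: (IH _ (ideal_add J a)) => //; first exact: ideal_add_ideal.
  move=> z [s [Ps [i [r [Ii zhE]]]]].
  have [|t [Pt Jt]] := col (s * z - r * a).
    apply: sub_satur => //.
    by rewrite mulrBl -!mulrA zhE addrK.
  exists (t * s); split; first exact: prime_neqM.
  by exists (t * (s * z - r * a)), (t * r); split=> //; ring.
apply: chainS cI; apply: ideal_add_sub => //; first exact: ideal_add_ideal.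
  apply: ideal_add_sub; first exact: ideal_add_ideal.
    exact: sub_ideal_add.
  by have [_ _ IM] := ideal_add_ideal h idI; apply/IM/mem_ideal_add.
exact: mem_ideal_add.
Qed.

Lemma comp_seriesS M I J n : I `<=` J -> comp_series M I n -> comp_series M J n.
Proof.
elim: n I J => [|n IH] I J IJ /=; first exact: IJ.
move=> [g [Mg cI]]; exists g; split; first by move=> x /Mg/IJ.
by apply: IH cI; apply: ideal_addS.
Qed.

(** The upper-bound counterpart of [chain_cat]: multiplication by [h] need only be well defined from
    A / J to A / I, not injective. *)
Lemma comp_series_cat M I J h m n : ideal I -> ideal J ->
  (forall z, J z -> I (z * h)) -> comp_series M J m ->
  comp_series M (ideal_add I h) n -> comp_series M I (m + n).
Proof.
move=> idI idJ; elim: m I J idI idJ => [|m IH] I J idI idJ JI /=.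
  by move=> /JI; rewrite mul1r => Ih; rewrite ideal_add_id.
move=> [g [Mg cJ]] cI; exists (g * h); split.
  by move=> x Mx; rewrite mulrA; apply/JI/Mg.
apply: (IH _ (ideal_add J g)) => //; try exact: ideal_add_ideal.
  move=> _ [j [r [Jj ->]]]; exists (j * h), r.
  by rewrite mulrDl mulrA; split=> //; apply: JI.
by apply: comp_seriesS cI; apply/ideal_addS/sub_ideal_add.
Qed.

End Length.

Section LocalLength.
Variables (A : comNzRingType) (M : set A).
Implicit Types (I J L P Q S : set A) (a b f g h r s x y z : A).
Hypothesis primeM : prime_ideal M.
Hypothesis unitM : forall a, ~ M a -> exists b, b * a = 1.

Lemma satur_local I : ideal I -> satur M I = I.
Proof.
move=> [_ _ IM]; apply/seteqP; split; last exact: sub_satur.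
move=> x [s [/unitM[t ts1] Isx]].
by rewrite -(mul1r x) -ts1 -mulrA; apply: IM.
Qed.

(* [(I + g A) / I] is a simple module. *)
Lemma simple_ext I g a : ideal I -> (forall x, M x -> I (x * g)) ->
  ~ I a -> ideal_add I g a -> ideal_add I a = ideal_add I g.
Proof.
move=> idI Mg nIa [i [c [Ii aE]]].
have [I0 ID IM] := idI.
have [|d dc1] := @unitM c.
  by move=> /Mg Icg; apply: nIa; rewrite aE; apply: ID.
apply/seteqP; split; apply: ideal_add_sub; try exact: ideal_add_ideal;
  try exact: sub_ideal_add.
  by exists i, c.
exists (- d * i), d; split; first exact: IM.
by rewrite aE mulrDr [d * (c * g)]mulrA dc1; ring.
Qed.

(** Killing a simple submodule shortens a chain by at most one. The step lost is the first at which
    the chain meets [g]; there the two ideals agree by [simple_ext]. *)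
Lemma chain_ideal_add I g n : ideal I -> (forall x, M x -> I (x * g)) ->
  chain M I n.+1 -> chain M (ideal_add I g) n.
Proof.
elim: n I => [//|n IH] I idI Mg [a [+ cIa]].
have [Iga|nIga] := pselect (ideal_add I g a).
  by rewrite satur_local // => nIa; rewrite -(simple_ext idI Mg nIa Iga).
move=> _; exists a; rewrite satur_local; last exact: ideal_add_ideal.
split=> //; rewrite ideal_addAC; apply: IH => //; first exact: ideal_add_ideal.
by move=> x /Mg; apply: sub_ideal_add.
Qed.

(** Takes the place of the Jordan-Hoelder theorem: every lower bound for the length is at most every
    upper bound. *)
Lemma chain_comp_series I m n : ideal I ->
  chain M I m -> comp_series M I n -> (m <= n)%N.
Proof.
elim: n I m => [|n IH] I [//|m] idI.
  move=> [a [+ _]] I1; rewrite satur_local // => -[].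
  by rewrite (idealT idI I1).
move=> cI [g [Mg cIg]]; rewrite ltnS; apply: IH cIg; first exact: ideal_add_ideal.
exact: chain_ideal_add.
Qed.

Lemma comp_series_lt I z n : ideal I -> ~ I z -> comp_series M I n ->
  exists2 m, (m < n)%N & comp_series M (ideal_add I z) m.
Proof.
elim: n I => [|n IH] I idI nIz; first by move=> /(idealT idI) IT; case: nIz; rewrite IT.
move=> [g [Mg cIg]]; have [Igz|nIgz] := pselect (ideal_add I g z).
  by exists n => //; rewrite (simple_ext idI Mg nIz Igz).
have [|m mn cm] := IH _ _ nIgz cIg; first exact: ideal_add_ideal.
exists m.+1 => //; exists g; rewrite ideal_addAC; split=> // x /Mg.
exact: sub_ideal_add.
Qed.

Variable p : nat.
Hypothesis charA : p \in [pchar A].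

(** Frobenius applied to a filtration of A / I turns each quotient of A / M into a quotient of A /
    M^[q]. *)
Lemma comp_series_frob_power I m n e : ideal I ->
  comp_series M I m -> comp_series M (frob_power M (p ^ e)) n ->
  comp_series M (frob_power I (p ^ e)) (m * n).
Proof.
elim: m I => [|m IH] I idI /=.
  by move=> /(@frob_powerX _ _ (p ^ e)); rewrite expr1n.
move=> [g [Mg cIg]] cM; rewrite mulSn.
apply: (@comp_series_cat _ _ _ (frob_power M (p ^ e)) (g ^+ (p ^ e))) => //;
  try exact: frob_power_ideal.
  by move=> z; apply: frob_power_mulr.
apply: (comp_seriesS (@frob_power_add _ _ charA I g e)).
by apply: IH => //; apply: ideal_add_ideal.
Qed.

End LocalLength.

(** * Growth of lengths along chains of primes *)

Section Growth.
Variables (A : comNzRingType) (p : nat).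
Hypothesis charA : p \in [pchar A].
Hypothesis noethA : noetherian A.
Implicit Types (I J L M P Q S : set A) (a b f g h r s x y z : A).

(** Once x^q is killed, the generic factor I1 / I0 contributes at least [q] to the length at [Q]. By
    Nakayama some [c] in [I1] is not locally in I0 + x I1, and its multiples c x^j give the [q]
    steps. *)
Lemma chain_step P Q x I0 I1 q n :
  prime_ideal P -> prime_ideal Q -> P `<=` Q -> Q x -> ~ P x ->
  ideal I0 -> ideal I1 -> satur P I0 = I0 -> satur P I1 = I1 ->
  I0 `<=` I1 -> ~ I1 `<=` I0 -> chain Q (ideal_add I1 (x ^+ q)) n ->
  chain Q (ideal_add I0 (x ^+ q)) (q + n).
Proof.
move=> pP pQ PQ Qx Px idI0 idI1 sI0 sI1 I01 I10 cI1.
have [I0_0 I0D I0M] := idI0; have [I1_0 I1D I1M] := idI1.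
have [c [I1c cNAK]] : exists c, I1 c /\
    forall s j, ~ Q s -> I1 j -> ~ I0 (s * c - x * j).
  apply: contrapT => noc; apply: I10.
  apply: (@Nakayama_satur _ noethA Q _ _ x) => //.
    apply/seteqP; split; last exact: sub_satur.
    by rewrite -{2}sI0; apply: satur_sub.
  move=> i I1i; apply: contrapT => noi; apply: noc; exists i; split=> // s j Qs I1j I0s.
  by apply: noi; exists s, j.
(* A descending filtration from I1 + (x^q) at j = 0 to I0 + (x^q) at j = q; c x^j lies in [B j] but,
   locally at [Q], not in [B j.+1]. *)
pose B j := [set y | exists i k r, [/\ I0 i, I1 k & y = i + x ^+ j * k + x ^+ q * r]].
have idB j : ideal (B j).
  split.
  - by exists 0, 0, 0; rewrite !mulr0 !addr0.
  - move=> _ _ [i [k [r [I0i I1k ->]]]] [i' [k' [r' [I0i' I1k' ->]]]].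
    by exists (i + i'), (k + k'), (r + r'); split; [exact: I0D|exact: I1D|ring].
  - move=> u _ [i [k [r [I0i I1k ->]]]].
    by exists (u * i), (u * k), (u * r); split; [exact: I0M|exact: I1M|ring].
have cB j : (j <= q)%N -> chain Q (B j) (j + n).
  elim: j => [_|j IH jq].
    apply: chainS cI1 => _ [i [k [r [I0i I1k ->]]]]; exists (i + k), r.
    by rewrite expr0 mul1r [r * _]mulrC; split=> //; apply: I1D => //; apply: I01.
  rewrite addSn /=; exists (c * x ^+ j); split.
    move=> [s [Qs [i [k [r [I0i I1k sE]]]]]].
    have xjP : ~ P (x ^+ j) by apply: prime_neqX.
    have qE : (q = j + (q - j.+1).+1)%N by lia.
    (* As [I0] is saturated at [P] and [x] is outside [P], the factor x^j cancels modulo [I0]. *)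
    have I0d : I0 (s * c - x * k - x ^+ (q - j.+1).+1 * r).
      rewrite -sI0; exists (x ^+ j); split=> //.
      suff -> : x ^+ j * (s * c - x * k - x ^+ (q - j.+1).+1 * r) = i by [].
      rewrite !mulrBr [X in _ - X]mulrA -exprD -qE.
      have -> : x ^+ j * (s * c) = s * (c * x ^+ j) by ring.
      by rewrite sE exprS; ring.
    have I1r : I1 r.
      rewrite -sI1; exists (x ^+ (q - j.+1).+1); split; first exact: prime_neqX.
      have -> : x ^+ (q - j.+1).+1 * r = s * c - x * k -
        (s * c - x * k - x ^+ (q - j.+1).+1 * r) by ring.
      apply: idealB => //; last exact: I01.
      by apply: idealB => //; apply: I1M.
    apply: (cNAK s (k + x ^+ (q - j.+1) * r)) => //.
      by apply: I1D => //; apply: I1M.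
    by move: I0d; rewrite exprS mulrDr opprD addrA mulrA.
  apply: chainS (IH (ltnW jq)) => _ [_ [t [[i [k [r [I0i I1k ->]]]] ->]]].
  exists i, (x * k + t * c), r; split=> //; first by apply: I1D; apply: I1M.
  by rewrite exprSr; ring.
apply: chainS (cB q (leqnn q)); apply: ideal_add_sub => //.
- by move=> i I0i; exists i, 0, 0; rewrite !mulr0 !addr0.
- by exists 0, 0, 1; rewrite mulr0 mulr1 !add0r.
Qed.

(* As [x] is a nonzerodivisor modulo [P], killing [x ^+ q] turns each generic
   composition factor [A / P] into a module of length at least [q]. *)
Lemma chain_generization P Q x I q n :
  prime_ideal P -> prime_ideal Q -> P `<=` Q -> Q x -> ~ P x -> ideal I ->
  chain P I n -> chain Q (ideal_add I (x ^+ q)) (q * n).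
Proof.
move=> pP pQ PQ Qx Px; elim: n I => [|n IH] I idI; first by rewrite muln0.
move=> [a [Ia cIa]]; rewrite mulnS.
have idIa := ideal_add_ideal a idI.
have {}IH := IH _ (satur_ideal pP idIa) (chain_satur pP idIa cIa).
apply: (@chainS _ _ _ (ideal_add (satur P I) (x ^+ q))).
  exact/ideal_addS/sub_satur.
apply: (@chain_step P Q) IH => //; rewrite ?satur_idem //; try exact: satur_ideal.
  by apply: saturS; apply: sub_ideal_add.
by move=> sI; apply/Ia/sI/sub_satur/mem_ideal_add.
Qed.

(* A lower bound for the Hilbert-Kunz function of the localization at [P], used
   in place of [n <= height P]. *)
Definition growth P n := exists e0, forall e,
  chain P (frob_power P (p ^ (e0 + e))) ((p ^ e) ^ n).

Lemma growth_leq P m n : (m <= n)%N -> growth P n -> growth P m.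
Proof.
move=> mn [e0 gP]; exists e0 => e; apply: chain_leq (gP e).
by rewrite leq_pexp2l // (pexp_gt0 charA).
Qed.

Lemma growth0 P : prime_ideal P -> growth P 0.
Proof.
move=> pP; have [idP P1 _] := pP; exists 0%N => e /=; exists 1; split=> //.
move=> Ps; apply: P1; rewrite -(satur_prime pP); apply: saturS Ps.
by apply: frob_power_subid => //; apply: (pexp_gt0 charA).
Qed.

(** Locally at [Q] some Q^[p^e1] lies in P + x A, hence Q^[p^(e1 + k)] in P^[p^k] + (x^(p^k)). The
    power of [x] supplies the additional factor p^k through [chain_generization]. *)
Lemma growth_minimal P Q x n : prime_ideal P -> prime_ideal Q -> P `<=` Q ->
  Q x -> ~ P x ->
  (forall a, Q a -> exists m, satur Q (ideal_add P x) (a ^+ m)) ->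
  growth P n -> growth Q n.+1.
Proof.
move=> pP pQ PQ Qx Px nilQ [e0 gP].
have [idP _ _] := pP; have [idQ _ _] := pQ.
have idPx := ideal_add_ideal x idP; have idsPx := satur_ideal pQ idPx.
have [k [g Qg]] := noethA idQ.
have [e1 Qe1] : exists e1, forall i, satur Q (ideal_add P x) (g i ^+ (p ^ e1)).
  have {nilQ} : forall i, exists m, satur Q (ideal_add P x) (g i ^+ m).
    by move=> i; apply: nilQ; rewrite Qg; apply: ideal_gen_mem.
  move=> /choice[m Hm]; exists (\sum_i m i)%N => i.
  have le : (m i <= p ^ (\sum_i m i))%N.
    apply: leq_trans (ltnW (ltn_expl _ _)); last exact/prime_gt1/(pcharf_prime charA).
    by rewrite (bigD1 i) //= leq_addr.
  by rewrite -(subnK le) exprD; have [_ _ HM] := idsPx; apply: HM.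
exists (e0 + e1)%N => e.
have le : ((p ^ e) ^ n.+1 <= p ^ (e0 + e) * (p ^ e) ^ n)%N.
  rewrite expnS leq_mul2r; apply/orP; right.
  by rewrite leq_pexp2l ?leq_addl ?prime_gt0 ?(pcharf_prime charA).
apply: chain_leq le _.
have idFx := ideal_add_ideal (x ^+ (p ^ (e0 + e))) (frob_power_ideal P (p ^ (e0 + e))).
apply: chainS (chain_satur pQ idFx (chain_generization _ pP pQ PQ Qx Px _ (gP e)));
  last exact: frob_power_ideal.
have -> : (e0 + e1 + e = e1 + (e0 + e))%N by lia.
rewrite expnD -(frob_powerM charA); apply: frob_power_sub; first exact: satur_ideal.
move=> z; rewrite {1}Qg frob_power_gen // => /(ideal_gen_sub idsPx Qe1) sz.
apply: (saturS (@frob_power_add _ _ charA P x (e0 + e))).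
exact: satur_pexp.
Qed.

(** Take a largest counterexample [P'] strictly below [Q], and a prime [Q'] inside [Q] minimal over
    P' + x A. Then [growth_minimal] raises the growth at [Q']: either Q' = Q, or [Q'] is a larger
    counterexample. *)
Lemma growth_lt P Q n : prime_ideal P -> prime_ideal Q -> P `<` Q ->
  growth P n -> growth Q n.+1.
Proof.
move=> pP pQ PQ gP; apply: contrapT => ngQ.
have [||P' [[pP' PQ' [m [gP' ngQ']]] P'max]] := @noetherian_max _ noethA
  [set P' | [/\ prime_ideal P', P' `<` Q & exists m, growth P' m /\ ~ growth Q m.+1]] P.
- by move=> J [[]].
- by split=> //; exists n.
case: PQ' => P'Q QP'.
have [x [Qx P'x]] : exists x, Q x /\ ~ P' x.
  apply: contrapT => nox; apply: QP' => x Qx.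
  by apply: contrapT => P'x; apply: nox; exists x.
have [idP' _ _] := pP'; have [idQ _ _] := pQ.
have [|Q' [pQ' IQ' Q'Q nilQ']] :=
    minimal_prime_over (ideal_add_ideal x idP') pQ.
  exact: ideal_add_sub.
have P'Q' : P' `<=` Q' by apply: subset_trans IQ'; apply: sub_ideal_add.
have Q'x : Q' x by apply/IQ'/mem_ideal_add.
have gQ' : growth Q' m.+1 by apply: (@growth_minimal P' Q' x).
have [QQ'|QQ'] := pselect (Q `<=` Q').
  by apply: ngQ'; have <- : Q' = Q by apply/seteqP.
apply: P'x; rewrite -(P'max Q') //; split=> //.
exists m.+1; split=> //; apply: contra_not ngQ'.
exact: growth_leq.
Qed.

Lemma growth_prime_chain n (P : 'I_n.+1 -> set A) (i : 'I_n.+1) :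
  (forall i, prime_ideal (P i)) ->
  (forall i j : 'I_n.+1, (i < j)%N -> P i `<` P j) -> growth (P i) i.
Proof.
move=> pP ltP; case: i; elim=> [|i IH] ltin; first exact: growth0.
apply: (@growth_lt (P (Ordinal (ltnW ltin)))) => //.
exact: ltP.
Qed.

End Growth.

(** * Monomial ideals in a regular local ring *)

Section MonomialIdeals.
Variables (A : comNzRingType) (n : nat) (y : 'I_n -> A).
Implicit Types (a b c : 'I_n -> nat) (i j : 'I_n).

Definition upd a j k : 'I_n -> nat := fun i => if i == j then k else a i.

Lemma upd_eq a j k : upd a j k j = k. Proof. by rewrite /upd eqxx. Qed.

Lemma upd_neq a j k i : i != j -> upd a j k i = a i.
Proof. by rewrite /upd => /negPf->. Qed.

Lemma upd_id a j : upd a j (a j) = a.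
Proof. by apply/funext => i; rewrite /upd; case: eqP => // ->. Qed.

Lemma prod_upd a j k : \prod_i upd a j k i = (k * \prod_(i | i != j) a i)%N.
Proof.
rewrite (bigD1 j) //= upd_eq; congr (_ * _)%N; apply: eq_bigr => i /negPf ij.
by rewrite /upd ij.
Qed.

(** Coordinates move from [a] to [b] one at a time, so the coordinate [j] being changed still has
    its initial value. Taking for [T] the failure of a property gives a descending induction. *)
Lemma exponent_ind (T : ('I_n -> nat) -> Prop) a b :
  (forall i, a i <= b i)%N -> T a ->
  (forall c j, (forall i, a i <= c i)%N -> c j = a j -> T c -> T (upd c j (b j))) ->
  T b.
Proof.
move=> ab Ta Tstep; pose c k : 'I_n -> nat := fun i => if (i < k)%N then b i else a i.
suff Tc k : (k <= n)%N -> T (c k).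
  by have -> : b = c n; [apply/funext => i; rewrite /c ltn_ord | apply: Tc].
elim: k => [_|k IH kn]; first by have -> : c 0%N = a by apply/funext.
have -> : c k.+1 = upd (c k) (Ordinal kn) (b (Ordinal kn)).
  apply/funext => i; rewrite /c /upd -val_eqE /= ltnS leq_eqVlt.
  by case: eqP => // ik; congr b; apply: val_inj.
apply: Tstep (IH (ltnW kn)); last by rewrite /c ltnn.
by move=> i; rewrite /c; case: ifP.
Qed.

Definition mon_ideal a : set A := ideal_gen (fun i => y i ^+ a i).

Lemma mon_ideal_ideal a : ideal (mon_ideal a).
Proof. exact: ideal_gen_ideal. Qed.

Lemma mon_ideal_mem a i : mon_ideal a (y i ^+ a i).
Proof. exact: (ideal_gen_mem (fun i => y i ^+ a i)). Qed.

Lemma mon_idealX a i k : (a i <= k)%N -> mon_ideal a (y i ^+ k).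
Proof.
move=> ak; rewrite -(subnK ak) exprD.
by have [_ _ IM] := mon_ideal_ideal a; apply/IM/mon_ideal_mem.
Qed.

Lemma mon_idealS a b : (forall i, a i <= b i)%N -> mon_ideal b `<=` mon_ideal a.
Proof.
move=> ab; apply: ideal_gen_sub; first exact: mon_ideal_ideal.
by move=> i; apply: mon_idealX.
Qed.

Lemma mon_ideal_mulr a j k l z :
  mon_ideal (upd a j k) z -> mon_ideal (upd a j (l + k)) (z * y j ^+ l).
Proof.
have [_ _ IM] := mon_ideal_ideal (upd a j (l + k)).
move=> [c ->]; rewrite mulr_suml; apply: ideal_sum => [|i]; first exact: mon_ideal_ideal.
rewrite -mulrA; apply: IM; have [->|ij] := eqVneq i j.
  by rewrite upd_eq -exprD addnC; apply: mon_idealX; rewrite upd_eq.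
apply: ideal_mulr; first exact: mon_ideal_ideal.
by apply: mon_idealX; rewrite !upd_neq.
Qed.

Lemma mon_ideal_upd_add a j k l :
  mon_ideal (upd a j l) `<=` ideal_add (mon_ideal (upd a j (l + k))) (y j ^+ l).
Proof.
have idI := mon_ideal_ideal (upd a j (l + k)).
apply: ideal_gen_sub; first exact: ideal_add_ideal.
move=> i; have [->|ij] := eqVneq i j; first by rewrite upd_eq; apply: mem_ideal_add.
by apply: sub_ideal_add; apply: mon_idealX; rewrite !upd_neq.
Qed.

Lemma mon_ideal1 : mon_ideal (fun=> 1%N) = ideal_gen y.
Proof. by rewrite /mon_ideal; congr ideal_gen; apply/funext => i; rewrite expr1. Qed.

Lemma mon_ideal0 a j : a j = 0%N -> mon_ideal a 1.
Proof. by move=> aj; rewrite -(expr0 (y j)) -aj; apply: mon_ideal_mem. Qed.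

Lemma mon_ideal_frob p e : p \in [pchar A] ->
  mon_ideal (fun=> (p ^ e)%N) = frob_power (ideal_gen y) (p ^ e).
Proof. by move=> charA; rewrite frob_power_gen. Qed.

Lemma comp_series_upd M a j k l r s :
  comp_series M (mon_ideal (upd a j k)) r -> comp_series M (mon_ideal (upd a j l)) s ->
  comp_series M (mon_ideal (upd a j (l + k))) (r + s).
Proof.
move=> ck cl; apply: (@comp_series_cat _ _ _ (mon_ideal (upd a j k)) (y j ^+ l)) => //;
  try exact: mon_ideal_ideal.
- by move=> z; apply: mon_ideal_mulr.
- by apply: comp_seriesS cl; apply: mon_ideal_upd_add.
Qed.

Lemma comp_series_updM M a j k r :
  comp_series M (mon_ideal (upd a j 1)) r ->
  comp_series M (mon_ideal (upd a j k)) (k * r).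
Proof.
move=> c1; elim: k => [|k IH]; first by apply: (@mon_ideal0 _ j); rewrite upd_eq.
by rewrite mulSn -addn1; apply: comp_series_upd.
Qed.

Lemma comp_series_mon_ideal a : (forall i, 0 < a i)%N ->
  comp_series (ideal_gen y) (mon_ideal a) (\prod_i a i).
Proof.
move=> a0; apply: (@exponent_ind
  (fun a => comp_series (ideal_gen y) (mon_ideal a) (\prod_i a i)) (fun=> 1%N)) => //.
  rewrite big1 //= mon_ideal1; exists 1; split; first by move=> x; rewrite mulr1.
  exact/mem_ideal_add/ideal_gen_ideal.
move=> c j _ /= cj cc; rewrite prod_upd; apply: comp_series_updM.
have -> : (\prod_(i | i != j) c i = \prod_i c i)%N by rewrite -{2}(upd_id c j) prod_upd cj mul1n.
by have := upd_id c j; rewrite cj => ->.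
Qed.

End MonomialIdeals.

(** Bernoulli's inequality (1 + 1/r)^j >= 1 + j/r with denominators cleared; it makes (r + 1)^j
    outgrow any constant multiple of r^j. *)
Lemma bernoulli_nat r j : (r ^ j * (r + j) <= r * r.+1 ^ j)%N.
Proof.
elim: j => [|j IH]; first by rewrite !expn0 addn0 mul1n muln1.
rewrite [(r.+1 ^ _)%N]expnSr mulnA; apply: leq_trans (leq_mul IH (leqnn r.+1)).
by rewrite expnSr -!mulnA leq_mul2l; apply/orP; right; nia.
Qed.

Section RegularLocal.
Variables (A : comNzRingType) (p : nat).
Hypothesis charA : p \in [pchar A].
Variables (d : nat) (x : 'I_d -> A).
Local Notation M := (ideal_gen x).
Hypothesis primeM : prime_ideal M.
Hypothesis unitM : forall a, ~ M a -> exists b, b * a = 1.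
Hypothesis growthM : growth p M d.
Implicit Types (a b c : 'I_d -> nat) (i j : 'I_d) (e : nat).

Lemma comp_series_expn e r k : comp_series M (frob_power M (p ^ e)) r ->
  comp_series M (frob_power M (p ^ (e * k))) (r ^ k).
Proof.
move=> cr; elim: k => [|k IH].
  have idM := ideal_gen_ideal x.
  rewrite muln0 frob_power1 //=; exists 1; split; first by move=> z; rewrite mulr1.
  exact: mem_ideal_add.
rewrite mulnSr expnD expnSr -(frob_powerM charA) mulnC.
have := comp_series_frob_power charA (frob_power_ideal _ _) IH cr.
by rewrite mulnC.
Qed.

(* Lengths of [A / I^[q]] are submultiplicative in [q], so a single length smaller
   than [q ^ d] would contradict the growth given by a chain of primes. *)
Lemma comp_series_frob_power_geq e r :
  comp_series M (frob_power M (p ^ e)) r -> (p ^ (e * d) <= r)%N.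
Proof.
have p_pr := pcharf_prime charA; have [idM M1 _] := primeM.
move=> cr; have [e0 gM] := growthM.
case: e cr => [|e] cr.
  by case: r cr => //=; rewrite frob_power1 // => /M1.
rewrite leqNgt; apply/negP => r_lt.
(* The growth lower bound at level p^(e.+1 k) is set against the upper bound r^k, with r + 1 <=
   p^(e.+1 d); the constant p^(e0 d) absorbs the shift by [e0]. *)
have bound k : (e0 <= k)%N -> (r.+1 ^ k <= p ^ (e0 * d) * r ^ k)%N.
  move=> ek; have le : (e0 <= e.+1 * k)%N by rewrite mulSn (leq_trans ek) ?leq_addr.
  have := gM (e.+1 * k - e0)%N; rewrite subnKC // -expnM => /(chain_comp_series primeM unitM).
  move=> /(_ _ (frob_power_ideal _ _) (comp_series_expn k cr)).
  rewrite -(leq_pmul2l (pexp_gt0 charA (e0 * d))) -expnD -mulnDl subnKC // => H.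
  apply: leq_trans H; rewrite mulnAC expnM.
  case: (k) => [//|k']; by rewrite leq_exp2r // -[_.+1]/(r.+1).
(* With this [k], [bound] and Bernoulli give r + k <= p^(e0 d) r, although k > p^(e0 d) r. The
   summand [e0] makes [bound] applicable. *)
have := bernoulli_nat r (p ^ (e0 * d) * r + e0 + 1).
set k := (_ + e0 + 1)%N => Hb.
have /bound Hk : (e0 <= k)%N by rewrite /k; lia.
have r0 : (0 < r)%N.
  rewrite lt0n; apply/eqP => r0; move: Hk; rewrite r0 exp1n exp0n ?muln0 //.
  by rewrite /k; lia.
have : (r ^ k * (r + k) <= r ^ k * (p ^ (e0 * d) * r))%N.
  apply: leq_trans Hb _.
  have -> : (r ^ k * (p ^ (e0 * d) * r) = r * (p ^ (e0 * d) * r ^ k))%N by ring.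
  by rewrite leq_mul2l Hk orbT.
by rewrite leq_pmul2l ?expn_gt0 ?r0 // /k; lia.
Qed.

(** A deficit at [a] persists while the coordinates are raised to p^e, because each added layer
    costs at most the product of the other exponents. It would contradict the bound for M^[p^e]. *)
Lemma comp_series_mon_ideal_geq a r : (forall i, 0 < a i)%N ->
  comp_series M (mon_ideal x a) r -> (\prod_i a i <= r)%N.
Proof.
have p1 := prime_gt1 (pcharf_prime charA).
move=> a0 ca; rewrite leqNgt; apply/negP => r_lt.
pose e := (\sum_i a i)%N.
have ae i : (a i <= p ^ e)%N.
  by apply: leq_trans (ltnW (ltn_expl _ p1)); rewrite /e (bigD1 i) //= leq_addr.
pose T a := exists2 r, (r < \prod_i a i)%N & comp_series M (mon_ideal x a) r.
have [||c j ac cj [s s_lt cs]|s] := @exponent_ind _ T a (fun=> (p ^ e)%N).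
- exact: ae.
- by exists r.
- rewrite /T.
  have c0 i : (0 < c i)%N by apply: leq_trans (ac i).
  have c1 : comp_series M (mon_ideal x (upd c j 1)) (\prod_(i | i != j) c i).
    rewrite -[X in comp_series _ _ X]mul1n -prod_upd; apply: comp_series_mon_ideal.
    by move=> i; rewrite /upd; case: ifP.
  have le : (c j <= p ^ e)%N by rewrite cj.
  have := comp_series_upd (comp_series_updM (p ^ e - c j) c1) (s := s) (l := c j).
  rewrite upd_id => /(_ cs); rewrite subnKC // => ce.
  exists ((p ^ e - c j) * \prod_(i | i != j) c i + s)%N => //.
  rewrite prod_upd -[X in (_ < X * _)%N](subnK le) mulnDl ltn_add2l.
  by rewrite -prod_upd upd_id.
- rewrite prod_nat_const card_ord -expnM mon_ideal_frob // => s_lt /comp_series_frob_power_geq.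
  by rewrite leqNgt s_lt.
Qed.

(** If [z] were outside, adjoining it would lower the length of A / (..., x_j^l) strictly below the
    product of its exponents; adding [k] more layers would then violate
    [comp_series_mon_ideal_geq]. *)
Lemma mon_ideal_colon a j k l z : (forall i, 0 < a i)%N -> (0 < l)%N ->
  mon_ideal x (upd a j (k + l)) (z * x j ^+ k) -> mon_ideal x (upd a j l) z.
Proof.
move=> a0 l0 zI; apply: contrapT => nz.
have c1 : comp_series M (mon_ideal x (upd a j 1)) (\prod_(i | i != j) a i).
  rewrite -[X in comp_series _ _ X]mul1n -prod_upd; apply: comp_series_mon_ideal.
  by move=> i; rewrite /upd; case: ifP.
have [m m_lt cm] := comp_series_lt unitM (mon_ideal_ideal x _) nz (comp_series_updM l c1).
have ck := comp_series_updM k c1.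
have cc : comp_series M (mon_ideal x (upd a j (k + l))) (m + k * \prod_(i | i != j) a i).
  apply: (comp_series_cat (mon_ideal_ideal x _) _ _ cm (h := x j ^+ k)).
  - exact/ideal_add_ideal/mon_ideal_ideal.
  - move=> _ [i [r [Ii ->]]]; rewrite mulrDl -mulrA.
    have [_ ID IM] := mon_ideal_ideal x (upd a j (k + l)).
    by apply: ID; [apply: mon_ideal_mulr | apply: IM].
  - by apply: comp_seriesS ck; apply: mon_ideal_upd_add.
have := comp_series_mon_ideal_geq _ cc; rewrite prod_upd.
have kl0 i : (0 < upd a j (k + l) i)%N by rewrite /upd; case: ifP; rewrite ?addn_gt0 ?l0 ?orbT.
by move=> /(_ kl0); rewrite leqNgt addnC mulnDl ltn_add2l m_lt.
Qed.

End RegularLocal.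

(** * Freeness of the Frobenius pushforward *)

Section Generation.
Variables (A : comNzRingType) (p : nat).
Hypothesis charA : p \in [pchar A].

Definition frob_generating e n (g : 'I_n -> A) :=
  forall z, exists c : 'I_n -> A, z = \sum_i c i ^+ (p ^ e) * g i.

Lemma frob_generating_fin (I : finType) e (g : I -> A) :
  (forall z, exists c : I -> A, z = \sum_i c i ^+ (p ^ e) * g i) ->
  frob_generating e (fun i : 'I_#|I| => g (enum_val i)).
Proof.
move=> gen z; have [c ->] := gen z; exists (fun i => c (enum_val i)).
exact: (reindex _ (onW_bij _ (@enum_val_bij I))).
Qed.

Lemma F_finite_generating e : F_finite charA ->
  exists n (g : 'I_n -> A), frob_generating e g.
Proof.
move=> [n [g gen]]; elim: e => [|e [m [h IH]]].
  exists 1%N, (fun=> 1) => z; exists (fun=> z).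
  by rewrite big_ord1 expn0 expr1 mulr1.
pose gh (ij : 'I_m * 'I_n) := (g ij.2 : A) ^+ (p ^ e) * h ij.1.
exists #|{: 'I_m * 'I_n}|, (fun i => gh (enum_val i)).
apply: frob_generating_fin => z; have [c ->] := IH z.
have /choice[b bE] : forall i, exists b : 'I_n -> A, c i = \sum_j b j ^+ p * g j.
  move=> i; have [b bE] := gen (c i); exists b; rewrite {1}bE; apply: eq_bigr => j _.
  by rewrite [LHS]/(frob_scale _ _) /frob_scale frobE expn1.
exists (fun ij => b ij.1 ij.2).
transitivity (\sum_i \sum_j b i j ^+ (p ^ e.+1) * gh (i, j)).
  2: by rewrite pair_big; apply: eq_bigr => -[].
apply: eq_bigr => i _; rewrite bE pexpr_sum // mulr_suml; apply: eq_bigr => j _.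
by rewrite /gh /= exprMn -exprM -expnS mulrA.
Qed.

End Generation.

Section KrullIntersection.
Variables (A : comNzRingType) (M : set A).
Hypothesis noethA : noetherian A.
Hypothesis idM : ideal M.
Hypothesis M1 : ~ M 1.
Hypothesis unitM : forall a, ~ M a -> exists b, b * a = 1.

(** If a <> 0, an ideal [L] maximal with M a <= L and [a] not in [L] contains a power of every [z]
    in [M]: once the ideals (L : z^k) are stationary, a = i + r z^k and z a in [L] would put [a] in
    [L]. *)
Lemma Krull_intersection (a : A) :
  (forall L, ideal L -> (forall z, M z -> exists k, L (z ^+ k)) -> L a) -> a = 0.
Proof.
move=> aM; apply: contrapT => a0.
have [||L [[idL La Ma] Lmax]] := @noetherian_max _ noethA
  [set L | [/\ ideal L, ~ L a & forall z, M z -> L (z * a)]] [set z * a | z in M].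
- by move=> L [].
- split; last by move=> z Mz; exists z.
    split.
    - by exists 0; rewrite ?mul0r //; case: idM.
    - move=> _ _ [u Mu <-] [v Mv <-]; exists (u + v); last by rewrite mulrDl.
      by case: idM => _ MD _; apply: MD.
    - move=> b _ [u Mu <-]; exists (b * u); last by rewrite mulrA.
      by case: idM => _ _; apply.
  move=> [z Mz zaE]; have [|b bz] := @unitM (1 - z).
    by move=> /(ideal_subr idM Mz) /M1.
  by apply: a0; rewrite -(mul1r a) -bz -mulrA mulrBl mul1r zaE subrr mulr0.
have [L0 LD LM] := idL.
apply: (La); apply: aM => // z Mz.
pose C k := [set r | L (r * z ^+ k)].
have idC k : ideal (C k).
  split=> [|u v Lu Lv|b u Lu] /=; rewrite /C /=.
  - by rewrite mul0r.
  - by rewrite mulrDl; apply: LD.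
  - by rewrite -mulrA; apply: LM.
have [||_ [[k _ <-] Ck]] := @noetherian_max _ noethA (range C) (C 0%N).
- by move=> _ [k _ <-].
- by exists 0%N.
exists k; apply: contrapT => Lzk.
have idLz := ideal_add_ideal (z ^+ k) idL.
have [i [r [Li aE]]] : ideal_add L (z ^+ k) a.
  apply: contrapT => nLa; apply: Lzk; rewrite -(Lmax (ideal_add L (z ^+ k))).
  - exact: mem_ideal_add.
  - by split=> // u Mu; apply: sub_ideal_add; apply: Ma.
  - exact: sub_ideal_add.
have : C k.+1 r.
  rewrite /C /= exprS mulrCA (_ : r * _ = a - i); last by rewrite aE addrC addKr.
  by rewrite mulrBr; apply: idealB; [| apply: Ma | apply: LM].
rewrite (Ck (C k.+1)) /C /=.
- by move=> Lr; apply: La; rewrite aE; apply: LD.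
- by exists k.+1.
- by move=> u /= Lu; rewrite exprS mulrCA; apply: LM.
Qed.

End KrullIntersection.

Section DualBasis.
Variables (A : comNzRingType) (p : nat).
Hypothesis charA : p \in [pchar A].
Hypothesis noethA : noetherian A.
Variables (d : nat) (x : 'I_d -> A).
Local Notation M := (ideal_gen x).
Hypothesis primeM : prime_ideal M.
Hypothesis unitM : forall a, ~ M a -> exists b, b * a = 1.
Hypothesis growthM : growth p M d.
Variable e : nat.
Local Notation q := (p ^ e)%N.

Let idM : ideal M. Proof. exact: ideal_gen_ideal. Qed.
Let M1 : ~ M 1. Proof. by case: primeM. Qed.

Lemma frob_power_inter a : (forall k, frob_power M (p ^ k) a) -> a = 0.
Proof.
move=> aM; apply: (Krull_intersection noethA idM M1 unitM) => L idL LM.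
have [k Lk] : exists k, forall i, L (x i ^+ (p ^ k)).
  have /choice[m Hm] i : exists m, L (x i ^+ m) by apply/LM/ideal_gen_mem.
  exists (\sum_i m i)%N => i.
  have le : (m i <= p ^ (\sum_i m i))%N.
    apply: leq_trans (ltnW (ltn_expl _ _)); last exact/prime_gt1/(pcharf_prime charA).
    by rewrite (bigD1 i) //= leq_addr.
  by rewrite -(subnK le) exprD; case: idL => _ _; apply.
by move: (aM k); rewrite frob_power_gen //; apply: ideal_gen_sub.
Qed.

Section MinimalGenerators.
Variables (n : nat) (g : 'I_n -> A).
Hypothesis gen : frob_generating p e g.
Hypothesis gmin : forall m (h : 'I_m -> A), frob_generating p e h -> (n <= m)%N.

(** A unit coefficient in a relation modulo M^[q] would allow one generator to be eliminated,
    against minimality. *)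
Lemma min_generators_indep c :
  frob_power M q (\sum_j c j ^+ q * g j) -> forall j, M (c j).
Proof.
rewrite frob_power_gen // => -[r rE] j; apply: contrapT => Mcj.
have /choice[b bE] := fun i => gen (r i).
(* Expanding the error term of M^[q] in the generators gives coefficients (mu l)^q with [mu l] in
   [M]; subtracting them makes the relation exact and keeps the [j]-th coefficient a unit. *)
pose mu l := \sum_i b i l * x i.
have Mmu l : M (mu l) by exists (b^~ l).
have rel : \sum_l (c l - mu l) ^+ q * g l = 0.
  apply/eqP; under eq_bigr do rewrite pexprB // mulrBl.
  rewrite sumrB rE subr_eq0; apply/eqP.
  under eq_bigr => i _ do rewrite bE mulr_suml.
  rewrite exchange_big; apply: eq_bigr => l _ /=.
  rewrite /mu pexpr_sum // mulr_suml; apply: eq_bigr => i _.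
  by rewrite exprMn mulrAC.
have [w wE] : exists w, w * (c j - mu j) = 1.
  by apply: unitM => /(ideal_subr idM (Mmu j)).
case: n g gen gmin c j b mu Mmu rel Mcj rE bE w wE => [|m] g' gen' gmin' c' j; first by case: j.
move=> b mu Mmu rel Mcj rE bE w wE.
have : (m.+1 <= m)%N; last by rewrite ltnn.
apply: (gmin' _ (fun l => g' (lift j l))) => z; have [a aE] := gen' z.
exists (fun l => a (lift j l) - a j * w * (c' (lift j l) - mu (lift j l))).
have {rel} gjE : g' j = - \sum_l (w * (c' (lift j l) - mu (lift j l))) ^+ q * g' (lift j l).
  move/(congr1 (fun t => w ^+ q * t)): rel; rewrite mulr0 (bigD1_ord j) //= mulrDr.
  rewrite mulrA -exprMn wE expr1n mul1r => /eqP; rewrite addr_eq0 => /eqP ->.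
  by rewrite mulr_sumr; congr (- _); apply: eq_bigr => l _; rewrite exprMn mulrA.
rewrite {1}aE (bigD1_ord j) //= gjE mulrN mulr_sumr addrC -sumrB.
apply: eq_bigr => l _; rewrite pexprB // !exprMn mulrBl; congr (_ - _).
by ring.
Qed.

(** Induction on the sum of the [a i]: write c_j = u_j + t_j x_i^l with l = a_i - 1 and [u_j] in the
    ideal. The colon property cancels x_i^(l q), leaving a relation among the t_j with exponent 1 at
    [i]. *)
Lemma min_generators_mon_ideal a c : (forall i, 0 < a i)%N ->
  mon_ideal x (fun i => a i * q)%N (\sum_j c j ^+ q * g j) ->
  forall j, mon_ideal x a (c j).
Proof.
have q0 : (0 < q)%N := pexp_gt0 charA e.
have [k] := ubnP (\sum_i a i)%N; elim: k a c => // k IH a c a_le a0 cI.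
have [a1|] := pselect (forall i, a i = 1%N).
  have aE : a = fun=> 1%N by apply/funext.
  rewrite aE mon_ideal1; apply: min_generators_indep.
  rewrite -mon_ideal_frob // (_ : (fun=> q) = fun i => a i * q)%N // aE.
  by apply/funext => i; rewrite mul1n.
move=> /existsNP[i ai]; have {ai} ai : (1 < a i)%N by move: (a0 i) ai; case: (a i) => [|[]].
pose l := (a i).-1; have l0 : (0 < l)%N by rewrite /l; lia.
have alE : upd a i (l + 1) = a by rewrite addn1 prednK ?upd_id.
have sum_upd b : (0 < b < a i)%N -> (\sum_j upd a i b j < k)%N.
  move=> /andP[b0 ba]; rewrite -ltnS; apply: leq_trans a_le.
  rewrite ltnS (bigD1 i) //= [X in (_ <= X)%N](bigD1 i) //=.
  have -> : (\sum_(j | j != i) upd a i b j = \sum_(j | j != i) a j)%N.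
    by apply: eq_bigr => j; apply: upd_neq.
  by rewrite upd_eq ltn_add2r.
have a0l b : (0 < b)%N -> forall j, (0 < upd a i b j)%N.
  by move=> b0 j; rewrite /upd; case: ifP.
have cl : forall j, mon_ideal x (upd a i l) (c j).
  apply: IH => //; [by apply: sum_upd; rewrite /l; lia | exact: a0l |].
  apply: mon_idealS cI => j; rewrite leq_mul2r; apply/orP; right.
  by rewrite /upd; case: eqP => // ->; rewrite /l leq_pred.
have /choice[t tE] j : exists t, exists2 u, mon_ideal x a u & c j = u + t * x i ^+ l.
  have [u [t [Iu ->]]] := mon_ideal_upd_add 1 (cl j).
  by exists t, u => //; rewrite -alE.
have tI : forall j, mon_ideal x (upd a i 1) (t j).
  apply: IH; [by apply: sum_upd; lia | exact: a0l |].
  rewrite (_ : (fun j => _) = upd (fun j => a j * q)%N i q); last first.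
    by apply/funext => j; rewrite /upd; case: ifP; rewrite ?mul1n.
  apply: (mon_ideal_colon charA primeM unitM growthM (k := (l * q)%N)) => //.
    by move=> j; rewrite muln_gt0 a0.
  rewrite (_ : upd _ _ _ = fun j => a j * q)%N; last first.
    apply/funext => j; rewrite /upd; case: eqP => // ->.
    by rewrite -mulSnr /l prednK // ltnW.
  have -> : (\sum_j t j ^+ q * g j) * x i ^+ (l * q) =
      \sum_j c j ^+ q * g j - \sum_j (c j - t j * x i ^+ l) ^+ q * g j.
    rewrite mulr_suml -sumrB; apply: eq_bigr => j _.
    by rewrite pexprB // exprMn -exprM; ring.
  apply: idealB => //; first exact: mon_ideal_ideal.
  apply: ideal_sum => [|j]; first exact: mon_ideal_ideal.
  apply: ideal_mulr; first exact: mon_ideal_ideal.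
  have [u [r rE] ->] := tE j; rewrite addrK rE pexpr_sum //.
  apply: ideal_sum => [|s]; first exact: mon_ideal_ideal.
  rewrite exprMn -exprM; have [_ _ HM] := mon_ideal_ideal x (fun i => a i * q)%N.
  by apply: HM; apply: (mon_ideal_mem x (fun i => a i * q)%N).
move=> j; have [u Iu ->] := tE j; have [_ ID _] := mon_ideal_ideal x a.
by apply: ID => //; rewrite -alE; apply: mon_ideal_mulr.
Qed.

(** The freeness half of Kunz's theorem: the coefficients lie in every M^[p^k], and these ideals
    intersect in 0. *)
Lemma min_generators_free c : \sum_j c j ^+ q * g j = 0 -> forall j, c j = 0.
Proof.
move=> c0 j; apply: frob_power_inter => k; rewrite -mon_ideal_frob //.
apply: min_generators_mon_ideal => [i|]; first exact: (pexp_gt0 charA).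
by rewrite c0; case: (mon_ideal_ideal x (fun i : 'I_d => (p ^ k * q)%N)).
Qed.

End MinimalGenerators.

(** The dual basis form of projectivity of F^e_*A; each [phi j] is an [A]-linear map F^e_*A -> A,
    written as a semilinear map of [A]. *)
Definition dual_basis n (g : 'I_n -> A) (phi : 'I_n -> A -> A) :=
  [/\ forall j, zmod_morphism (phi j), forall j a z, phi j (a ^+ q * z) = a * phi j z &
    forall z, z = \sum_j phi j z ^+ q * g j].

Lemma dual_basis_exists : F_finite charA ->
  exists n (g : 'I_n -> A) (phi : 'I_n -> A -> A), dual_basis g phi.
Proof.
move=> /(F_finite_generating e)[n0 gen0].
have exn : exists n, `[< exists g : 'I_n -> A, frob_generating p e g >].
  by exists n0; apply/asboolP.
have [n /asboolP[g gen] nmin] := ex_minnP exn.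
have gmin m (h : 'I_m -> A) : frob_generating p e h -> (n <= m)%N.
  by move=> genh; apply: nmin; apply/asboolP; exists h.
have free c c' : \sum_j c j ^+ q * g j = \sum_j c' j ^+ q * g j -> c = c'.
  move=> cc'; apply/funext => j; apply/eqP; rewrite -subr_eq0; apply/eqP.
  apply: (@min_generators_free _ g gen gmin (fun j => c j - c' j)).
  under eq_bigr do rewrite pexprB // mulrBl.
  by rewrite sumrB cc' subrr.
have /choice[phi phiE] := gen.
exists n, g, (fun j z => phi z j); split.
- move=> j z z'; suff -> : phi (z - z') = fun j => phi z j - phi z' j by [].
  apply: free; rewrite -phiE; under eq_bigr do rewrite pexprB // mulrBl.
  by rewrite sumrB -!phiE.
- move=> j a z; suff -> : phi (a ^+ q * z) = fun j => a * phi z j by [].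
  apply: free; rewrite -phiE; under eq_bigr do rewrite exprMn -mulrA.
  by rewrite -mulr_sumr -phiE.
- by move=> z; rewrite -phiE.
Qed.

End DualBasis.

(** * Splittings and the F-pure threshold *)

(** This is (q^k - 1) / (q - 1); as a sum it needs no truncated division and satisfies the recursion
    [geomS], on which all later inductions over levels rest. *)
Definition geom q k := (\sum_(i < k) q ^ i)%N.

Lemma geomS q k : geom q k.+1 = (1 + q * geom q k)%N.
Proof.
rewrite /geom big_ord_recl expn0 big_distrr; congr (_ + _)%N.
by apply: eq_bigr => i _; rewrite expnS.
Qed.

Lemma geomD q k l : geom q (k + l) = (geom q k + q ^ k * geom q l)%N.
Proof.
rewrite /geom big_split_ord big_distrr; congr (_ + _)%N.
by apply: eq_bigr => i _; rewrite expnD.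
Qed.

Lemma geom_subn1 q k : (0 < q)%N -> (geom q k * (q - 1) = q ^ k - 1)%N.
Proof.
move=> q0; elim: k => [|k IH]; first by rewrite /geom big_ord0 subnn.
rewrite geomS mulnDl mul1n -mulnA IH expnS.
have : (0 < q ^ k)%N by rewrite expn_gt0 q0.
by nia.
Qed.

Section Splitting.
Variables (A : comNzRingType) (p : nat).
Hypothesis charA : p \in [pchar A].

Definition splits e (a : A) := exists phi : {linear frob_push charA e -> A^o},
  phi @` principal a = [set: A].

Lemma frob_linearM e (phi : {linear frob_push charA e -> A^o}) (a z : A) :
  phi (a ^+ (p ^ e) * z : A) = a * (phi z : A).
Proof.
have := linearZ_LR phi a (z : frob_push charA e).
by rewrite [in LHS]/GRing.scale /= /frob_scale frobE.
Qed.

(** Elements all of whose multiples are sent into [J] form an ideal, and phi (r y^q) = y phi(r) puts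
    the [q]-th powers from [J] in it. *)
Lemma semilinear_frob_power e (phi : A -> A) (J : set A) (z : A) :
  zmod_morphism phi -> (forall a y, phi (a ^+ (p ^ e) * y) = a * phi y) ->
  ideal J -> frob_power J (p ^ e) z -> J (phi z).
Proof.
move=> phiB phiM idJ Jz; have [J0 _ JM] := idJ.
have phi0 : phi 0 = 0 by have := phiB 0 0; rewrite !subrr.
have phiN v : phi (- v) = - phi v by have := phiB 0 v; rewrite phi0 !sub0r.
have phiD u v : phi (u + v) = phi u + phi v.
  by rewrite -{1}(opprK v) phiB phiN opprK.
suff : forall r : A, J (phi (r * z : A)) by move/(_ 1); rewrite mul1r.
apply: (Jz [set z | forall r : A, J (phi (r * z : A))]).
  split=> [r|u v Ju Jv r|b u Ju r] /=.
  - by rewrite mulr0 phi0.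
  - by rewrite mulrDr phiD; case: idJ => _ JD _; apply: JD.
  - by rewrite mulrA; apply: Ju.
by move=> _ [y Jy <-] r /=; rewrite mulrC phiM mulrC; apply: JM.
Qed.

Lemma frob_linear_frob_power e (phi : {linear frob_push charA e -> A^o})
    (J : set A) (z : A) :
  ideal J -> frob_power J (p ^ e) z -> J (phi z).
Proof.
apply: (@semilinear_frob_power e (fun z => phi z)).
  by move=> u v; exact: (raddfB phi).
exact: frob_linearM.
Qed.

(** If phi (b a) = 1, then [phi] sends b a^(geom q (k+1)) to a^(geom q k), because geom q (k+1) = 1
    + q geom q k. Each application lowers the level by one. *)
Lemma splits_iter e a I k : splits e a -> ideal I ->
  frob_power I (p ^ (e * k)) (a ^+ geom (p ^ e) k) -> I 1.
Proof.
move=> [phi phiT] idI; elim: k => [|k IH].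
  by rewrite muln0 frob_power1 // /geom big_ord0.
rewrite mulnSr expnD -frob_powerM // => aI; apply: IH.
have : [set: A] 1 by []; rewrite -phiT => -[_ [b _ <-] phi1].
rewrite -[_ ^+ _]mulr1 -phi1 -frob_linearM.
apply: frob_linear_frob_power; first exact: frob_power_ideal.
have -> : (a ^+ geom (p ^ e) k) ^+ (p ^ e) * (b * a) = b * a ^+ geom (p ^ e) k.+1.
  by rewrite -exprM geomS mulnC exprD expr1; ring.
by have [_ _ IM] := frob_power_ideal (frob_power I (p ^ (e * k))) (p ^ e); apply: IM.
Qed.

Lemma semilinear_splits e (phi : A -> A) a w : zmod_morphism phi ->
  (forall b z, phi (b ^+ (p ^ e) * z) = b * phi z) -> w * phi a = 1 -> splits e a.
Proof.
move=> phiB phiM wE.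
have phiZ : GRing.scalable_for ( *:%R : A -> A^o -> A^o)
    (phi : frob_push charA e -> A^o).
  move=> b z; transitivity (phi (b ^+ (p ^ e) * (z : A))); last exact: phiM.
  by congr (phi _); rewrite -(frobE charA).
pose addphi := GRing.isZmodMorphism.Build (frob_push charA e) A^o phi phiB.
pose scalphi := GRing.isScalable.Build A (frob_push charA e) A^o _ phi phiZ.
pose lphi : {linear frob_push charA e -> A^o} := HB.pack phi addphi scalphi.
exists lphi; apply/seteqP; split=> // y _; exists ((y * w) ^+ (p ^ e) * a).
  by exists ((y * w) ^+ (p ^ e)).
by rewrite /= phiM -mulrA wE mulr1.
Qed.

(** Some coordinate of [a] in the dual basis is a unit; otherwise all lie in [M] and [a] lies in
    M^[q]. *)
Lemma dual_basis_splits e M n (g : 'I_n -> A) phi a :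
  dual_basis p e g phi -> (forall a, ~ M a -> exists b, b * a = 1) ->
  ~ frob_power M (p ^ e) a -> splits e a.
Proof.
move=> [phiB phiM phiE] unitM aM.
have [j Mj] : exists j, ~ M (phi j a).
  apply: contrapT => noj; apply: aM; rewrite (phiE a).
  apply: ideal_sum => [|j]; first exact: frob_power_ideal.
  apply: (ideal_mulr _ (frob_power_ideal _ _)).
  by apply: frob_powerX; apply: contrapT => Mj; apply: noj; exists j.
have [w wE] := unitM _ Mj.
exact: semilinear_splits (phiB j) (phiM j) wE.
Qed.

End Splitting.

Section Exponents.
Variables (R : realType) (A : comNzRingType) (p : nat).
Hypothesis charA : p \in [pchar A].
Variable f : A.
Implicit Types (s t : R) (e k n N : nat).

Local Notation S := (@fpt_exponents R p A charA f).

Lemma pexp_subn1_gt0 e : (0 < e)%N -> (0 < p ^ e - 1)%N.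
Proof.
by move=> e0; rewrite subn_gt0 -(exp1n e) ltn_exp2r // prime_gt1 // (pcharf_prime charA).
Qed.

Lemma fpt_exponents_splits s : S s ->
  exists e N, [/\ (0 < e)%N, s * (p ^ e - 1)%:R <= N%:R & splits charA e (f ^+ N)].
Proof.
move=> [s0 [e [e0 [phi phiT]]]].
exists e, `|Num.ceil (s * (p ^ e - 1)%:R)|%N; split=> //; last by exists phi.
have c0 : 0 <= Num.ceil (s * (p ^ e - 1)%:R).
  by rewrite Num.Theory.ceil_ge0 (lt_le_trans _ (mulr_ge0 s0 (ler0n _ _))) // ltrN10.
by rewrite natr_absz ger0_norm ?Num.Theory.ceil_ge.
Qed.

Lemma splits_fpt_exponents e N : (0 < e)%N -> splits charA e (f ^+ N) ->
  S (N%:R / (p ^ e - 1)%:R).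
Proof.
move=> e0 [phi phiT]; split; first by rewrite divr_ge0 ?ler0n.
exists e; split=> //; exists phi.
have q0 : (p ^ e - 1)%:R != 0 :> R by rewrite pnatr_eq0 -lt0n pexp_subn1_gt0.
rewrite divfK // (_ : Num.ceil N%:R = N%:Z) ?absz_nat //.
by rewrite -[N%:R]/(N%:Z%:~R) intrKceil.
Qed.

(** A splitting of f^N at level e' iterates to the common level e e', where the hypothesis forces N
    geom(p^e', e) <= n geom(p^e, e'), that is N / (p^e' - 1) <= n / (p^e - 1). *)
Lemma fpt_exponents_le (I : set A) e n s : ideal I -> ~ I 1 -> (0 < e)%N ->
  (forall k, frob_power I (p ^ (e * k)) (f ^+ (n * geom (p ^ e) k).+1)) ->
  S s -> s <= n%:R / (p ^ e - 1)%:R.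
Proof.
move=> idI I1 e_gt0 fI /fpt_exponents_splits[e' [N [e'_gt0 sN spl]]].
have q'0 := pexp_subn1_gt0 e'_gt0; have q0 := pexp_subn1_gt0 e_gt0.
have N_le : (N * geom (p ^ e') e <= n * geom (p ^ e) e')%N.
  rewrite leqNgt; apply/negP => lt; apply: I1.
  apply: (splits_iter spl idI (k := e)).
  have := fI e'; rewrite -exprM -(subnK lt) exprD [(e * e')%N]mulnC.
  by have [_ _ IM] := frob_power_ideal I (p ^ (e' * e)); apply: IM.
have {}N_le : (N * (p ^ e - 1) <= n * (p ^ e' - 1))%N.
  have Q0 : (0 < p ^ (e * e') - 1)%N by apply: pexp_subn1_gt0; rewrite muln_gt0 e_gt0.
  have E1 : (geom (p ^ e) e' * (p ^ e - 1) = p ^ (e * e') - 1)%N.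
    by rewrite geom_subn1 ?(pexp_gt0 charA) // expnM.
  have E2 : (geom (p ^ e') e * (p ^ e' - 1) = p ^ (e * e') - 1)%N.
    by rewrite geom_subn1 ?(pexp_gt0 charA) // mulnC expnM.
  rewrite -(leq_pmul2r Q0) -{1}E2 -E1.
  rewrite [X in (X <= _)%N]
    (_ : _ = N * geom (p ^ e') e * ((p ^ e - 1) * (p ^ e' - 1)))%N; last by ring.
  rewrite [X in (_ <= X)%N]
    (_ : _ = n * geom (p ^ e) e' * ((p ^ e - 1) * (p ^ e' - 1)))%N; last by ring.
  by rewrite leq_mul2r N_le orbT.
rewrite ler_pdivlMr ?ltr0n //; rewrite -(ler_pM2r (_ : 0 < (p ^ e' - 1)%:R)) ?ltr0n //.
rewrite mulrAC; apply: le_trans (_ : N%:R * (p ^ e - 1)%:R <= _).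
  by rewrite ler_wpM2r.
by rewrite -!natrM ler_nat.
Qed.

Variable M : set A.
Hypothesis idM : ideal M.
Hypothesis M1 : ~ M 1.
Hypothesis splitsM : forall e a, ~ frob_power M (p ^ e) a -> splits charA e a.
Hypothesis Mf : M f.

Lemma fpt_exponents_has_sup : has_sup S.
Proof.
split.
  exists (0%:R / (p ^ 1 - 1)%:R); apply: splits_fpt_exponents => //.
  by apply: splitsM => /frob_power_subid; rewrite (pexp_gt0 charA) => /(_ idM isT).
(* The bound 1, in a form that fits e = 1 and n = p - 1: then n geom(p, k) + 1 = p^k. *)
exists ((p ^ 1 - 1)%:R / (p ^ 1 - 1)%:R) => s.
apply: fpt_exponents_le idM M1 _ _ => // k.
rewrite [(_ * geom _ _)%N]mulnC geom_subn1 ?(pexp_gt0 charA) //.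
rewrite subn1 prednK -?expnM ?(pexp_gt0 charA) //; exact: frob_powerX.
Qed.

Variables (e n : nat).
Hypothesis e_gt0 : (0 < e)%N.
Hypothesis n_gt0 : (0 < n)%N.
Hypothesis fptE : sup S = n%:R / (p ^ e - 1)%:R.

(** Otherwise f^(n_k + 1) would split at level e k, giving the exponent (n_k + 1) / (q^k - 1), which
    exceeds n_k / (q^k - 1) = n / (q - 1). *)
Lemma fpt_frob_power k : frob_power M (p ^ (e * k)) (f ^+ (n * geom (p ^ e) k).+1).
Proof.
case: k => [|k]; first by rewrite muln0 frob_power1 // /geom big_ord0 muln0.
apply: contrapT => /splitsM /splits_fpt_exponents; rewrite muln_gt0 e_gt0 => /(_ isT).
move=> /(sup_upper_bound fpt_exponents_has_sup); rewrite fptE.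
have q0 := pexp_subn1_gt0 e_gt0.
have Q0 : (0 < p ^ (e * k.+1) - 1)%N by apply: pexp_subn1_gt0; rewrite muln_gt0 e_gt0.
rewrite ler_pdivrMr ?ltr0n // mulrAC ler_pdivlMr ?ltr0n // -!natrM ler_nat.
rewrite expnM -(@geom_subn1 (p ^ e) k.+1) ?(pexp_gt0 charA) // mulnA leq_pmul2r //.
by rewrite ltnn.
Qed.

(** If f^n were in M^[q], no exponent could exceed n/q < n/(q - 1). Indeed, for an exponent s > n/q
    split at level e', comparison at a common power [Q] of p^e and p^e' yields (s - n/q) Q < s,
    false for large [Q]. *)
Lemma fpt_frob_powerN : ~ frob_power M (p ^ e) (f ^+ n).
Proof.
move=> fM; have p_gt1 := prime_gt1 (pcharf_prime charA).
have q0 := pexp_subn1_gt0 e_gt0; have pe0 := pexp_gt0 charA e.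
have lt_sup : n%:R / (p ^ e)%:R < sup S.
  rewrite fptE ltr_pM2l ?ltr0n // ltf_pV2 ?posrE ?ltr0n // ltr_nat.
  by rewrite subn1 prednK.
have [s Ss lt_s] := sup_gt fpt_exponents_has_sup.1 lt_sup.
have [e' [N [e'_gt0 sN spl]]] := fpt_exponents_splits Ss.
have q'0 := pexp_subn1_gt0 e'_gt0.
pose l := Num.bound (s / (s - n%:R / (p ^ e)%:R)).
pose Q := (p ^ (e * (e' * l.+1)))%N.
have lQ : (l < Q)%N.
  apply: leq_trans (ltnW (ltn_expl _ p_gt1)).
  by rewrite mulnA leq_pmull // muln_gt0 e_gt0.
pose m := (p ^ (e * (e' * l.+1).-1))%N.
have QE : Q = (p ^ e * m)%N.
  by rewrite /Q /m -expnD -mulnS prednK // muln_gt0 e'_gt0.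
have fQ : frob_power M Q (f ^+ (n * m)).
  by rewrite QE exprM; apply: frob_power_pexp.
have lt_N : (N * geom (p ^ e') (e * l.+1) < n * m)%N.
  rewrite ltnNge; apply/negP => le; apply: M1.
  apply: (splits_iter spl idM (k := e * l.+1)).
  rewrite (_ : p ^ _ = Q)%N; last by rewrite /Q mulnCA.
  rewrite -exprM -(subnK le) exprD.
  by have [_ _ IM] := frob_power_ideal M Q; apply: IM.
have ltQ : s * (Q - 1)%:R < n%:R * m%:R.
  rewrite -natrM; apply: le_lt_trans (_ : (N * geom (p ^ e') (e * l.+1))%:R < _).
    2: by rewrite ltr_nat.
  rewrite /Q mulnCA expnM -(@geom_subn1 (p ^ e') (e * l.+1)) ?(pexp_gt0 charA) //.
  rewrite natrM mulrCA mulrC natrM.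
  by rewrite ler_wpM2r ?ler0n.
have Q0 : (0 < Q)%N := pexp_gt0 charA _.
have d0 : 0 < s - n%:R / (p ^ e)%:R by rewrite subr_gt0.
have s0 : 0 <= s by case: Ss.
have : (s - n%:R / (p ^ e)%:R) * Q%:R < s.
  have -> : (s - n%:R / (p ^ e)%:R) * Q%:R = s * (Q - 1)%:R + s - n%:R * m%:R.
    rewrite natrB // mulrBr mulr1 subrK mulrBl QE natrM.
    by congr (_ - _); rewrite mulrA -[_ / _ * _]mulrA mulVf ?mulr1 // pnatr_eq0 -lt0n.
  by rewrite addrAC gtrDr subr_lt0.
rewrite mulrC -ltr_pdivlMr // => lt_Q.
have := archi_boundP (divr_ge0 s0 (ltW d0)); rewrite -/l => lt_l.
have := lt_trans lt_Q lt_l; rewrite ltr_nat => /(ltn_trans lQ).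
by rewrite ltnn.
Qed.

End Exponents.

(** * The splitting prime *)

Section SplittingPrime.
Variables (A : comNzRingType) (p : nat).
Hypothesis charA : p \in [pchar A].
Variables (M : set A) (f : A) (e n : nat).
Hypothesis idM : ideal M.
Hypothesis M1 : ~ M 1.
Hypothesis unitM : forall a, ~ M a -> exists b, b * a = 1.
Hypothesis dual_basisA : forall e,
  exists n (g : 'I_n -> A) (phi : 'I_n -> A -> A), dual_basis p e g phi.
Local Notation nu k := (n * geom (p ^ e) k)%N.
Hypothesis fM : forall k, frob_power M (p ^ (e * k)) (f ^+ (nu k).+1).
Hypothesis fMN : ~ frob_power M (p ^ e) (f ^+ n).

(* The largest proper ideal compatible with [f ^+ n]: the center of F-purity
   of the pair (A, f^t), where [t = n / (p ^ e - 1)]. *)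
Definition splitting_prime : set A :=
  [set a | forall k, frob_power M (p ^ (e * k)) (f ^+ nu k * a)].
Local Notation P := splitting_prime.

Lemma splitting_prime_sub : P `<=` M.
Proof.
by move=> a /(_ 0%N); rewrite muln0 frob_power1 // /geom big_ord0 muln0 mul1r.
Qed.

(** If [a] is not in [P], some r f^(n_k) a is sent to 1 by a map [psi]. Applied to a multiple of
    f^(n_(k+l)) a b, the same [psi] gives f^(n_l) b, so a b in [P] forces [b] in [P]. *)
Lemma splitting_prime_prime : prime_ideal P.
Proof.
split; first split=> [k|a b Pa Pb k|a b Pb k].
- by rewrite mulr0; case: (frob_power_ideal M (p ^ (e * k))).
- rewrite mulrDr; have [_ ID _] := frob_power_ideal M (p ^ (e * k)).
  exact: ID.
- rewrite mulrCA; have [_ _ IM] := frob_power_ideal M (p ^ (e * k)).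
  exact: IM.
- by move=> /splitting_prime_sub.
- move=> a b Pab; have [Pa|nPa] := pselect (P a); [by left | right => l].
  have [k /(dual_basis_splits charA _ unitM)] : exists k,
      ~ frob_power M (p ^ (e * k)) (f ^+ nu k * a).
    by apply: contrapT => nok; apply: nPa => k; apply: contrapT => nk; apply: nok; exists k.
  have [m [g [phi db]]] := dual_basisA (e * k).
  move=> /(_ _ _ _ db)[psi psiT].
  have : [set: A] 1 by []; rewrite -psiT => -[_ [r _ <-] psi1].
  rewrite -[_ * b]mulr1 -psi1 -frob_linearM.
  apply: frob_linear_frob_power; first exact: frob_power_ideal.
  rewrite frob_powerM // -expnD -mulnDr [(l + k)%N]addnC.
  have q0 : (0 < p ^ (e * k))%N := pexp_gt0 charA _.
  have -> : (f ^+ nu l * b) ^+ (p ^ (e * k)) * (r * (f ^+ nu k * a)) =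
      (r * b ^+ (p ^ (e * k)).-1) * (f ^+ nu (k + l) * (a * b)).
    have -> : f ^+ nu (k + l) = f ^+ nu k * (f ^+ nu l) ^+ (p ^ (e * k)).
      by rewrite geomD mulnDr exprD -exprM -expnM mulnCA [(p ^ _ * _)%N]mulnC.
    have -> : (f ^+ nu l * b) ^+ (p ^ (e * k)) =
        (f ^+ nu l) ^+ (p ^ (e * k)) * b ^+ (p ^ (e * k)).-1 * b.
      by rewrite exprMn -mulrA -exprSr prednK.
    by ring.
  have [_ _ IM] := frob_power_ideal M (p ^ (e * (k + l))).
  by apply: IM; apply: Pab.
Qed.

Lemma splitting_prime_mem : P f.
Proof. by move=> k; rewrite -exprSr. Qed.

(** The coordinates phi_j (f^n a) lie in [P], since f^(n_k) phi_j (f^n a) = phi_j (f^(n_(k+1))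
    a). *)
Lemma splitting_prime_compatible a : P a -> frob_power P (p ^ e) (f ^+ n * a).
Proof.
move=> Pa; have [m [g [phi [phiB phiM phiE]]]] := dual_basisA e.
have idF := frob_power_ideal P (p ^ e).
rewrite (phiE (f ^+ n * a)); apply: ideal_sum => // j.
apply: (ideal_mulr _ idF); apply: frob_powerX => k; rewrite -phiM.
apply: (@semilinear_frob_power _ p e) => //; first exact: frob_power_ideal.
rewrite frob_powerM // -expnD -mulnSr.
have -> : (f ^+ nu k) ^+ (p ^ e) * (f ^+ n * a) = f ^+ nu k.+1 * a.
  by rewrite geomS mulnDr muln1 exprD -exprM mulnCA [(p ^ e * _)%N]mulnC; ring.
exact: Pa.
Qed.

(** From s f^n in P^[q] follows f^(n_(k+1)) s = s f^n (f^(n_k))^q in M^[q^(k+1)] for all [k], so [s]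
    would be in [P]. At level 0, where this says nothing, [s] is in [M] because f^n is not in
    M^[q]. *)
Lemma splitting_primeN : ~ satur P (frob_power P (p ^ e)) (f ^+ n).
Proof.
move=> [s [Ps sfn]]; apply: Ps => -[|k].
  rewrite muln0 frob_power1 // /geom big_ord0 muln0 mul1r.
  apply: contrapT => /unitM[b bs1]; apply: fMN.
  rewrite -[f ^+ n]mul1r -bs1 -mulrA.
  have [_ _ IM] := frob_power_ideal M (p ^ e); apply: IM.
  exact: frob_powerS splitting_prime_sub _ sfn.
have := @frob_power_mulr _ P (frob_power M (p ^ (e * k))) (p ^ e) (f ^+ nu k) _ _ sfn.
rewrite frob_powerM // -expnD -mulnSr => H.
have -> : f ^+ nu k.+1 * s = s * f ^+ n * (f ^+ nu k) ^+ (p ^ e).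
  by rewrite geomS mulnDr muln1 exprD -exprM mulnCA [(p ^ e * _)%N]mulnC; ring.
by apply: H => z Pz; rewrite mulrC; apply: Pz.
Qed.

End SplittingPrime.

(** * Lech independence at a prime *)

Section LechIndependence.
Variables (A : comNzRingType) (p : nat).
Hypothesis charA : p \in [pchar A].
Hypothesis noethA : noetherian A.
Hypothesis dual_basisA : forall e,
  exists n (g : 'I_n -> A) (phi : 'I_n -> A -> A), dual_basis p e g phi.
Variable P : set A.
Hypothesis primeP : prime_ideal P.

Let idP : ideal P. Proof. by case: primeP. Qed.

Definition local_generators n (y : 'I_n -> A) :=
  (forall i, P (y i)) /\ P `<=` satur P (ideal_gen y).

Lemma local_generators_exists : exists n (y : 'I_n -> A), local_generators y /\
  forall m (z : 'I_m -> A), local_generators z -> (n <= m)%N.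
Proof.
have exn : exists n, `[< exists y : 'I_n -> A, local_generators y >].
  have [n [y yP]] := noethA idP; exists n; apply/asboolP; exists y; split.
    by move=> i; rewrite yP; apply: ideal_gen_mem.
  by rewrite {1}yP; apply: sub_satur.
have [n /asboolP[y yP] nmin] := ex_minnP exn; exists n, y; split=> // m z zP.
by apply: nmin; apply/asboolP; exists z.
Qed.

Variables (n : nat) (y : 'I_n -> A).
Hypothesis geny : local_generators y.
Hypothesis miny : forall m (z : 'I_m -> A), local_generators z -> (n <= m)%N.
Implicit Types (a : 'I_n -> nat) (i j : 'I_n).

Lemma local_generators_indep (b : 'I_n -> A) :
  \sum_i b i * y i = 0 -> forall j, P (b j).
Proof.
move=> b0 j; apply: contrapT => Pbj; have [Py Pgen] := geny.
case: n y miny b b0 j Pbj Py Pgen => [|m] z; first by move=> _ b _ [].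
move=> minz b b0 j Pbj Pz Pgen.
have /minz : local_generators (fun l => z (lift j l)); last by rewrite ltnn.
split=> // u /Pgen [s [Ps [c cE]]].
exists (b j * s); split; first exact: prime_neqM.
exists (fun l => b j * c (lift j l) - c j * b (lift j l)).
under eq_bigr do rewrite mulrBl -!mulrA.
rewrite sumrB -!mulr_sumr -mulrA cE (bigD1_ord j) //= mulrDr addrC.
congr (_ + _); move/eqP: b0; rewrite (bigD1_ord j) //= addr_eq0 => /eqP bE.
by rewrite mulrCA bE mulrN.
Qed.

Definition lech_independent a := forall b : 'I_n -> A,
  \sum_i b i * y i ^+ a i = 0 -> forall i, satur P (mon_ideal y a) (b i).

Lemma frob_power_sub_mon_ideal e :
  frob_power P (p ^ e) `<=` satur P (mon_ideal y (fun=> p ^ e)%N).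
Proof.
apply: frob_power_sub; first exact/satur_ideal/mon_ideal_ideal.
move=> z /(geny.2) /(satur_pexp p e primeP).
by rewrite -mon_ideal_frob.
Qed.

(** The freeness of Frobenius enters here: a dual basis map turns the relation among the y_i^q into
    one among the y_i, whose coefficients lie in [P] by minimality. *)
Lemma lech_independent_frob e : lech_independent (fun=> p ^ e)%N.
Proof.
move=> b b0 i; apply: frob_power_sub_mon_ideal.
have [m [g [phi [phiB phiM phiE]]]] := dual_basisA e.
rewrite (phiE (b i)); apply: ideal_sum => [|j]; first exact: frob_power_ideal.
apply: (ideal_mulr _ (frob_power_ideal _ _)); apply: frob_powerX.
move: i; apply: local_generators_indep.
have phi0 : phi j 0 = 0 by have := phiB j 0 0; rewrite !subrr.
have phiN v : phi j (- v) = - phi j v by have := phiB j 0 v; rewrite phi0 !sub0r.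
have phiD u v : phi j (u + v) = phi j u + phi j v.
  by rewrite -{1}(opprK v) phiB phiN opprK.
have := congr1 (phi j) b0; rewrite phi0 (big_morph _ phiD phi0).
by under eq_bigr do rewrite mulrC phiM mulrC.
Qed.

(* Lech's lemma: independence of [z z', y_2, ...] implies that of [z, y_2, ...]. *)
Lemma lech_independent_pred a j k : (0 < k)%N ->
  lech_independent (upd a j k.+1) -> lech_independent (upd a j k).
Proof.
move=> k0 ind b b0.
have idI := satur_ideal primeP (mon_ideal_ideal y (upd a j k)).
have sub : mon_ideal y (upd a j k.+1) `<=` mon_ideal y (upd a j k).
  by apply: mon_idealS => i; rewrite /upd; case: ifP.
have yE (c : 'I_n -> A) l : \sum_i c i * y i ^+ upd a j l i =
    c j * y j ^+ l + \sum_(i | i != j) c i * y i ^+ a i.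
  rewrite (bigD1 j) //= upd_eq; congr (_ + _).
  by apply: eq_bigr => i ij; rewrite upd_neq.
have bj : satur P (mon_ideal y (upd a j k.+1)) (b j).
  (* The relation multiplied by y_j. *)
  have := ind (fun i => if i == j then b j else y j * b i) _ j.
  rewrite eqxx; apply; rewrite yE eqxx.
  transitivity (y j * \sum_i b i * y i ^+ upd a j k i); last by rewrite b0 mulr0.
  rewrite yE mulrDr mulr_sumr exprS; congr (_ + _); first by ring.
  by apply: eq_bigr => i /negPf->; rewrite mulrA.
have [s [Ps [r rE]]] := bj.
(* The relation multiplied by [s], after substituting s b_j = sum r_i y_i^(...) for its [j]-th
   coefficient. *)
have H := ind (fun i => if i == j then r j * y j ^+ k else s * b i + r i * y j ^+ k).
move=> i; have [->|ij] := eqVneq i j; first exact: saturS sub _ bj.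
apply: (saturP primeP Ps); apply: (ideal_subr idI (y := - (r i * y j ^+ k))).
  have [_ _ IM] := idI; rewrite -mulrN; apply: (IM); rewrite -mulN1r; apply: (IM).
  apply: (sub_satur primeP).
  by have := mon_ideal_mem y (upd a j k) j; rewrite upd_eq.
rewrite opprK; apply: (saturS sub); have := H _ i; rewrite (negPf ij); apply.
rewrite yE eqxx.
transitivity (s * \sum_i b i * y i ^+ upd a j k i); last by rewrite b0 mulr0.
move: rE; rewrite !yE mulrDr [s * (b j * _)]mulrA => ->.
rewrite mulrDl mulr_sumr mulr_suml -addrA -big_split; congr (_ + _); first by ring.
by apply: eq_bigr => l /negPf-> /=; ring.
Qed.

Lemma lech_independent_all a : (forall i, 0 < a i)%N -> lech_independent a.
Proof.
move=> a0; have p1 := prime_gt1 (pcharf_prime charA).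
pose e := (\sum_i a i)%N.
have ae i : (a i <= p ^ e)%N.
  by apply: leq_trans (ltnW (ltn_expl _ p1)); rewrite /e (bigD1 i) //= leq_addr.
apply: contrapT => na; apply: (@exponent_ind _ (fun c => ~ lech_independent c) _ _ ae na).
  move=> c j ac cj nc; apply: contra_not nc.
  rewrite -{2}(upd_id c j) cj -(subnKC (ae j)).
  elim: (p ^ e - a j)%N => [|m IH]; first by rewrite addn0.
  by rewrite addnS => /(lech_independent_pred _)/IH; apply; rewrite addn_gt0 a0.
exact: lech_independent_frob.
Qed.

(** Multiplying the membership by y_j^l turns it into a relation among the powers y_i^(...), in
    which y_j^(k+l) has coefficient s z - r_j y_j^l; independence puts this coefficient in the
    ideal. *)
Lemma local_mon_ideal_colon a j k l z : (forall i, 0 < a i)%N -> (0 < l)%N ->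
  satur P (mon_ideal y (upd a j (k + l))) (z * y j ^+ k) ->
  satur P (mon_ideal y (upd a j l)) z.
Proof.
move=> a0 l0 [s [Ps [r rE]]].
have idI := satur_ideal primeP (mon_ideal_ideal y (upd a j l)).
have akl i : (0 < upd a j (k + l) i)%N.
  by rewrite /upd; case: ifP; rewrite ?addn_gt0 ?l0 ?orbT.
have := lech_independent_all akl (b := fun i => if i == j then s * z - r j * y j ^+ l
  else - (r i * y j ^+ l)) _ j.
rewrite eqxx => H; apply: (saturP primeP Ps).
apply: (ideal_subr idI (y := r j * y j ^+ l)).
  case: idI => _ _; apply; apply: (sub_satur primeP).
  by have := mon_ideal_mem y (upd a j l) j; rewrite upd_eq.
apply: saturS (H _).
  by apply: mon_idealS => i; rewrite /upd; case: ifP => // _; apply: leq_addl.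
rewrite (bigD1 j) //= eqxx upd_eq.
have {}rE : s * z * y j ^+ k * y j ^+ l = r j * y j ^+ (k + l) * y j ^+ l +
    (\sum_(i | i != j) r i * y i ^+ upd a j (k + l) i) * y j ^+ l.
  by rewrite -mulrDl -[s * z * _]mulrA rE (bigD1 j) //= upd_eq.
rewrite mulrBl {1}exprD mulrA rE mulr_suml.
rewrite [r j * y j ^+ (k + l) * _]mulrAC [_ + _ - _]addrAC subrr add0r -big_split.
rewrite big1 // => i /negPf-> /=.
by ring.
Qed.

Lemma chain_mon_ideal a : (forall i, 0 < a i)%N ->
  chain P (mon_ideal y a) (\prod_i a i).
Proof.
move=> a0; have [Py _] := geny.
pose T a := (forall i, 0 < a i)%N /\ chain P (mon_ideal y a) (\prod_i a i).
have [||c j _ /= cj [c0 cc]|//] := @exponent_ind _ T (fun=> 1%N) a.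
- by move=> i; apply: a0.
- split=> //; rewrite big1 //= mon_ideal1; exists 1; split=> //.
  move=> /(saturS (ideal_gen_sub idP Py)).
  by rewrite satur_prime //; case: primeP.
- split; first by move=> i; rewrite /upd; case: ifP.
  rewrite prod_upd.
  have -> : (\prod_(i | i != j) c i = \prod_i c i)%N.
    by rewrite -{2}(upd_id c j) prod_upd cj mul1n.
  have {}cc : chain P (mon_ideal y (upd c j 1)) (\prod_i c i).
    by have := upd_id c j; rewrite cj => ->.
  elim: (a j) => [//|k IH]; rewrite mulSn.
  apply: (chain_cat primeP _ _ _ cc (h := y j ^+ k)); try exact: mon_ideal_ideal.
    by move=> z; rewrite -addn1; apply: local_mon_ideal_colon.
  apply: chainS IH; apply: ideal_add_sub; first exact: mon_ideal_ideal.
    by apply: mon_idealS => i; rewrite /upd; case: ifP.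
  by have := mon_ideal_mem y (upd c j k) j; rewrite upd_eq.
Qed.

Lemma growth_local_generators : growth p P n.
Proof.
exists 0%N => e; rewrite add0n.
apply: chainS (@frob_power_sub_mon_ideal e) _.
apply: chain_satur => //; first exact: mon_ideal_ideal.
have := @chain_mon_ideal (fun=> p ^ e)%N; rewrite prod_nat_const card_ord; apply.
by move=> _; apply: (pexp_gt0 charA).
Qed.

(** Raise all exponents to q - 1, then strip one variable after another with the colon property
    until w lies in the ideal of the y_i, locally at [P]. *)
Lemma local_socle e m w : (forall i, m i < p ^ e)%N ->
  satur P (frob_power P (p ^ e)) (w * \prod_i y i ^+ m i) -> P w.
Proof.
move=> mq; rewrite -(satur_idem primeP) => wI.
have {wI} : satur P (mon_ideal y (fun=> p ^ e)%N) (w * \prod_i y i ^+ (p ^ e).-1).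
  have [_ _ IM] := satur_ideal primeP (mon_ideal_ideal y (fun=> p ^ e)%N).
  have -> : w * \prod_i y i ^+ (p ^ e).-1 =
      (\prod_i y i ^+ ((p ^ e).-1 - m i)) * (w * \prod_i y i ^+ m i).
    rewrite mulrCA -big_split; congr (_ * _); apply: eq_bigr => i _ /=.
    by rewrite -exprD subnK // -ltnS prednK ?(pexp_gt0 charA).
  apply: IM; move: wI; rewrite satur_idem // => /(saturS (@frob_power_sub_mon_ideal e)).
  by rewrite satur_idem.
pose T a := (forall i, 0 < a i)%N /\ forall w,
  satur P (mon_ideal y a) (w * \prod_i y i ^+ (a i).-1) -> P w.
have [Py _] := geny.
have q0 : (0 < p ^ e)%N := pexp_gt0 charA e.
have [||c j _ /= cj [c0 cc]|_] := @exponent_ind _ T (fun=> 1%N) (fun=> p ^ e)%N; last by apply.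
- by [].
- split=> // v; rewrite mon_ideal1 big1 ?mulr1 //.
  by move=> /(saturS (ideal_gen_sub idP Py)); rewrite satur_prime.
- split; first by move=> i; rewrite /upd; case: ifP.
  move=> v; rewrite (bigD1 j) //= upd_eq.
  under eq_bigr => i ij do rewrite upd_neq //.
  rewrite [_ ^+ _ * _]mulrC mulrA -{1}(prednK q0) -addn1 => /local_mon_ideal_colon.
  have cE : upd c j 1 = c by have := upd_id c j; rewrite cj.
  by move=> /(_ c0 isT); rewrite cE => vI; apply: cc; rewrite (bigD1 j) //= cj mul1r.
Qed.

End LechIndependence.

(** * Coefficient rings *)

Section ResidueDomain.
Variables (A : comNzRingType) (P : set A).
Hypothesis primeP : prime_ideal P.

Lemma residue_domain : exists (D : idomainType) (rho : {rmorphism A -> D}),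
  (forall a, P a <-> rho a = 0) /\ forall z, exists a, z = rho a.
Proof.
have [[P0 PD PM] P1 Pprime] := primeP.
pose S : {pred A} := fun a => `[< P a >].
have idS : idealr_closed S.
  split; [exact/asboolP | exact/asboolP |].
  by move=> a u v /asboolP Pu /asboolP Pv; apply/asboolP/PD => //; apply: PM.
have prS : prime_idealr_closed S.
  by move=> u v /asboolP/Pprime[] ?; apply/orP; [left|right]; apply/asboolP.
pose I : prime_idealr A := HB.pack S (isIdealr.Build A S idS)
  (isPrimeIdealrClosed.Build A S prS).
pose Q : comNzRingType := {ideal_quot I}.
pose unit : {pred Q} := fun x => `[< exists y, y * x = 1 >].
pose inv (x : Q) := if pselect (exists y, y * x = 1) is left H then projT1 (cid H) else x.
have mulVx : {in unit, left_inverse 1 inv *%R}.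
  move=> x /asboolP xu; rewrite /inv; case: pselect => // H.
  by case: (cid H).
have unitPl x y : y * x = 1 -> unit x by move=> yx; apply/asboolP; exists y.
have invr_out : {in [predC unit], inv =1 id}.
  by move=> x /asboolPn xu; rewrite /inv; case: pselect.
pose U : comUnitRingType := HB.pack Q
  (GRing.ComNzRing_hasMulInverse.Build Q mulVx unitPl invr_out).
have domU : GRing.integral_domain_axiom U.
  by move=> x y; apply: (@Quotient.rquot_IdomainAxiom A I).
pose D : idomainType := HB.pack U (GRing.ComUnitRing_isIntegral.Build U domU).
pose rho : A -> D := \pi_{ideal_quot I}%qT.
have rhoB : zmod_morphism rho by move=> x y; apply: (rmorphB (\pi_{ideal_quot I}%qT)).
have rhoM : monoid_morphism rho.
  split=> [|x y]; first exact: (rmorph1 (\pi_{ideal_quot I}%qT)).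
  exact: (rmorphM (\pi_{ideal_quot I}%qT)).
pose rhom : {rmorphism A -> D} := HB.pack rho
  (GRing.isZmodMorphism.Build A D rho rhoB) (GRing.isMonoidMorphism.Build A D rho rhoM).
have rho0 : rho 0 = 0 by apply: (rmorph0 (\pi_{ideal_quot I}%qT)).
exists D, rhom; split=> [a|z].
  have aE : `[< P a >] = (rho a == rho 0).
    by have := Quotient.idealrBE I a 0; rewrite subr0.
  split=> [/asboolP|a0]; first by rewrite aE rho0 => /eqP.
  by apply/asboolP; rewrite aE rho0; apply/eqP.
by exists (repr z); rewrite /= /rho reprK.
Qed.

End ResidueDomain.

Section PurelyInseparable.
Variables (D : idomainType) (p : nat).
Hypothesis charD : p \in [pchar D].
Variables (S : subringClosed D) (b : D).
Hypothesis Sbp : b ^+ p \in S.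

(* If the least degree [j] of a relation of [b] over [S], with leading
   coefficient [L], is less than [p], the matrix [N] of the multiplication by
   [L b] on [1, b, ..., b ^ (j - 1)] has its entries in [S], and [N ^ p] is
   scalar.  Hence [det N = (L b) ^ j] lies in [S], as does [(L b) ^ p], and [j]
   is coprime to [p]. *)
Lemma purely_inseparable_degree (g : {poly D}) : g \is a polyOver S ->
  g != 0 -> root g b -> (size g <= p)%N ->
  exists v, [/\ v \in S, v != 0 & v * b \in S].
Proof.
move=> Sg0 g0 gb szg; have p_pr := pcharf_prime charD.
have [->|b0] := eqVneq b 0; first by exists 1; rewrite rpred1 mulr0 rpred0 oner_neq0.
pose rel k := `[< exists g : {poly D},
  [/\ g \is a polyOver S, g != 0, root g b & size g = k] >].
have exrel : exists k, rel k by exists (size g); apply/asboolP; exists g.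
have [_ /asboolP[h [Sh h0 hb <-]] hmin] := ex_minnP exrel.
have {}hmin (k : {poly D}) : k \is a polyOver S -> root k b -> (size k < size h)%N -> k = 0.
  move=> Sk kb; apply: contraTeq => k0; rewrite -leqNgt; apply: hmin.
  by apply/asboolP; exists k.
have szh : (size h <= p)%N.
  by apply: leq_trans szg; rewrite leqNgt; apply/negP => /hmin-/(_ Sg0 gb) /eqP; rewrite (negPf g0).
have [j jE] : exists j, size h = j.+2.
  case E : (size h) => [|[|j]]; last by exists j.
    by move/eqP: E; rewrite size_poly_eq0 (negPf h0).
  move: hb h0; have /eqP/size_poly1P[c c0 ->] := E.
  by rewrite rootC (negPf c0).
pose L := lead_coef h; have L0 : L != 0 by rewrite lead_coef_eq0.
have SL : L \in S by rewrite /L lead_coefE; apply: (polyOverP _).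
pose N : 'M[D]_j.+1 := \matrix_(i, k)
  if (i.+1 == j.+1)%N then - h`_k else L *+ (k == i.+1 :> nat).
pose v : 'cV[D]_j.+1 := \col_i b ^+ i.
have SN : N \is a mxOver S.
  apply/mxOverP => i k; rewrite mxE; case: ifP => _; first by rewrite rpredN (polyOverP _).
  by rewrite rpredMn.
have Nv : N *m v = (L * b) *: v.
  apply/colP => i; rewrite !mxE; under eq_bigr do rewrite !mxE.
  have [ij|ij] := eqVneq (i : nat) j.
    rewrite ij eqxx; under eq_bigr do rewrite mulNr.
    move: hb; rewrite /root horner_coef jE big_ord_recr /= addrC addr_eq0 => /eqP hE.
    by rewrite sumrN -hE /L lead_coefE jE exprS mulrA.
  rewrite eqSS (negPf ij).
  have ltij : (i.+1 < j.+1)%N by rewrite ltnS ltn_neqAle ij -ltnS ltn_ord.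
  rewrite (bigD1 (Ordinal ltij)) //= eqxx mulr1n big1 ?addr0 ?exprS ?mulrA //.
  by move=> k; rewrite -val_eqE /= => /negPf->; rewrite mulr0n mul0r.
have NXv m : N ^+ m *m v = (L * b) ^+ m *: v.
  elim: m => [|m IH]; first by rewrite expr0 mul1mx scale1r.
  by rewrite exprSr -mulmxE -mulmxA Nv -scalemxAr IH scalerA -exprS.
have SLbp : (L * b) ^+ p \in S by rewrite exprMn rpredM //; apply: rpredX.
(* Each row of the difference is a relation of [b] over [S] of degree below that of [h], hence zero
   by minimality. *)
have NpE : N ^+ p = ((L * b) ^+ p)%:M.
  apply/eqP; rewrite -subr_eq0; apply/eqP/row_matrixP => i; rewrite row0.
  set B := _ - _; have SB : B \is a mxOver S.
    rewrite rpredB //; first by apply: rpredX.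
    apply/mxOverP => k l; rewrite mxE; apply: rpredMn.
    exact: SLbp.
  have Bv : B *m v = 0 by rewrite mulmxBl NXv mul_scalar_mx subrr.
  apply: (can_inj rVpolyK); rewrite linear0; apply: hmin.
  - apply/polyOverP => k; rewrite coef_rVpoly; case: insub => [l|]; last exact: rpred0.
    by rewrite mxE (mxOverP SB).
  - rewrite /root (horner_coef_wide _ (size_poly _ _)).
    move/colP/(_ i): Bv; rewrite [RHS]mxE => Bvi; apply/eqP.
    rewrite -[RHS]Bvi mxE; apply: eq_bigr => k _.
    by rewrite coef_rVpoly_ord !mxE.
  - by rewrite jE ltnS size_poly.
have detN : \det N = (L * b) ^+ j.+1.
  have detX m : \det (N ^+ m) = (\det N) ^+ m.
    by elim: m => [|m IH]; rewrite ?expr0 ?det1 // !exprS -mulmxE det_mulmx IH.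
  have := congr1 (fun B => \det B) NpE; rewrite detX det_scalar exprAC => dE.
  have := pexprB charD 1 (\det N) ((L * b) ^+ j.+1); rewrite expn1 dE subrr => /eqP.
  by rewrite expf_eq0 subr_eq0 => /andP[_ /eqP].
have SLbj : (L * b) ^+ j.+1 \in S.
  rewrite -detN /determinant; apply: rpred_sum => s _; rewrite rpredM ?rpred_sign //.
  by apply: rpred_prod => i _; apply: (mxOverP SN).
have cop : gcdn j.+1 p = 1%N.
  apply/eqP; rewrite -/(coprime _ _) coprime_sym prime_coprime //.
  by apply: contraL szh => /dvdn_leq; rewrite jE -ltnNge => /(_ isT).
(* Bezout: k (j + 1) = l p + 1, where j + 1 is the degree of [h]. So v = L (L b)^(l p) gives v b =
   (L b)^(k (j + 1)), a power of the determinant. *)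
case: (@egcdnP j.+1 p isT) => k l; rewrite cop addn1 => kl _.
exists (L * (L * b) ^+ (l * p)); split.
- by rewrite rpredM // mulnC exprM; apply: rpredX.
- by rewrite mulf_neq0 ?expf_neq0 ?mulf_neq0.
- rewrite (_ : _ * b = (L * b) ^+ (k * j.+1)).
    by rewrite mulnC exprM; apply: rpredX.
  by rewrite kl exprS; ring.
Qed.

End PurelyInseparable.

Section CoefficientRing.
Variables (A : comNzRingType) (p : nat).
Hypothesis charA : p \in [pchar A].
Variable P : set A.
Hypothesis primeP : prime_ideal P.

Let idP : ideal P. Proof. by case: primeP. Qed.

(* Modulo P^[n], [W] embeds into the residue field of [P]; if it is moreover full,
   it is a coefficient field of the localization at [P] of [A / P^[n]]. *)
Record coef_ring (W : set A) n : Prop := CoefRing {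
  coef_ring1 : W 1;
  coef_ringB : forall x y, W x -> W y -> W (x - y);
  coef_ringM : forall x y, W x -> W y -> W (x * y);
  coef_ring_expr : forall a, W (a ^+ n);
  coef_ring_prime : forall w, W w -> P w -> satur P (frob_power P n) w }.

(** Fullness up to denominators taken from [W]: the fractions of elements of [W] fill the residue
    field of [P]. *)
Definition full_coef_ring (W : set A) := forall a,
  exists s u, [/\ W s, ~ P s, W u & P (s * a - u)].

Lemma coef_ring0 W n : coef_ring W n -> W 0.
Proof. by case=> W1 WB _ _ _; rewrite -(subrr 1); apply: WB. Qed.

Lemma coef_ringN W n x : coef_ring W n -> W x -> W (- x).
Proof. by move=> cW Wx; rewrite -sub0r; apply: (coef_ringB cW) => //; apply: coef_ring0 cW. Qed.

Lemma coef_ringD W n x y : coef_ring W n -> W x -> W y -> W (x + y).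
Proof.
by move=> cW Wx Wy; rewrite -[y]opprK; apply: (coef_ringB cW) => //; apply: coef_ringN cW _.
Qed.

Lemma coef_ringX W n x k : coef_ring W n -> W x -> W (x ^+ k).
Proof.
move=> cW Wx; elim: k => [|k IH]; first by rewrite expr0; apply: coef_ring1 cW.
by rewrite exprS; apply: (coef_ringM cW).
Qed.

Lemma coef_ring_sum W n (I : Type) (r : seq I) (Q : pred I) (F : I -> A) :
  coef_ring W n -> (forall i, Q i -> W (F i)) -> W (\sum_(i <- r | Q i) F i).
Proof.
move=> cW WF; elim/big_ind: _ => //; first exact: coef_ring0 cW.
by move=> x y; apply: coef_ringD cW.
Qed.

Lemma coef_ring_frob W e : coef_ring W (p ^ e) ->
  coef_ring [set w ^+ p | w in W] (p ^ e.+1).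
Proof.
move=> cW; have pB (x y : A) : x ^+ p - y ^+ p = (x - y) ^+ p.
  by have := pexprB charA 1 x y; rewrite expn1.
split.
- by exists 1; [apply: coef_ring1 cW | rewrite expr1n].
- by move=> _ _ [x Wx <-] [y Wy <-]; exists (x - y); [apply: (coef_ringB cW) | rewrite pB].
- by move=> _ _ [x Wx <-] [y Wy <-]; exists (x * y); [apply: (coef_ringM cW) | rewrite exprMn].
- by move=> a; exists (a ^+ (p ^ e)); [apply: coef_ring_expr cW _ | rewrite -exprM expnSr].
- move=> _ [w Ww <-] /(prime_expr primeP) Pw.
  have := satur_pexp p 1 primeP (coef_ring_prime cW Ww Pw).
  by rewrite frob_powerM // -expnD addn1 expn1.
Qed.

Definition adjoin (W : set A) b : set A :=
  [set x | exists2 g : {poly A}, (forall i, W g`_i) & x = g.[b]].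

(** As b^p lies in [W], X^p can be replaced by the constant b^p without changing the value at
    [b]. *)
Lemma adjoin_reduce W n b (g : {poly A}) : coef_ring W n -> (0 < p)%N ->
  W (b ^+ p) -> (forall i, W g`_i) ->
  exists r : {poly A}, [/\ forall i, W r`_i, r.[b] = g.[b] & (size r <= p)%N].
Proof.
move=> cW p0 Wbp; have [m] := ubnP (size g); elim: m g => // m IH g szg Wg.
have [le|lt] := leqP (size g) p; first by exists g.
pose g' := take_poly p g + drop_poly p g * (b ^+ p)%:P.
have [||r [Wr rE szr]] := IH g'.
- apply: leq_trans (_ : size g <= m)%N; last by rewrite -ltnS.
  apply: leq_ltn_trans (size_polyD _ _) _; rewrite gtn_max.
  apply/andP; split; first exact: leq_ltn_trans (size_take_poly _ _) lt.
  apply: leq_ltn_trans (size_polyMleq _ _) _.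
  apply: leq_ltn_trans (_ : size (drop_poly p g) < size g)%N.
    by move: (size_polyC_leq1 (b ^+ p)); lia.
  by rewrite size_drop_poly ltn_subrL p0 (leq_trans _ lt).
- move=> i; rewrite coefD coef_take_poly coefMC coef_drop_poly.
  apply: (coef_ringD cW); last exact: (coef_ringM cW).
  by case: ifP => // _; apply: coef_ring0 cW.
exists r; split=> //; rewrite rE -[in RHS](poly_take_drop p g).
by rewrite !hornerE.
Qed.

Lemma adjoin_coef_ring W n b : coef_ring W n -> (0 < p)%N -> W (b ^+ p) ->
  (forall g : {poly A}, (forall i, W g`_i) -> (size g <= p)%N -> P g.[b] ->
    forall i, P g`_i) ->
  coef_ring (adjoin W b) n.
Proof.
move=> cW p0 Wbp Pind; split.
- exists 1; last by rewrite hornerC.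
  by move=> i; rewrite coef1; case: eqP => _; [apply: coef_ring1 cW | apply: coef_ring0 cW].
- move=> _ _ [g Wg ->] [h Wh ->]; exists (g - h); last by rewrite !hornerE.
  by move=> i; rewrite coefB; apply: (coef_ringB cW).
- move=> _ _ [g Wg ->] [h Wh ->]; exists (g * h); last by rewrite hornerM.
  by move=> i; rewrite coefM; apply: (coef_ring_sum _ cW) => j _; apply: (coef_ringM cW).
- move=> a; exists (a ^+ n)%:P; last by rewrite hornerC.
  by move=> i; rewrite coefC; case: eqP => _; [apply: coef_ring_expr cW _ | apply: coef_ring0 cW].
- move=> _ [g Wg ->]; have [r [Wr <- szr]] := adjoin_reduce cW p0 Wbp Wg.
  move=> Pr; rewrite horner_coef; apply: ideal_sum => [|i].
    exact/satur_ideal/frob_power_ideal.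
  apply: (ideal_mulr _ (satur_ideal primeP (frob_power_ideal P n))).
  by apply: (coef_ring_prime cW) => //; apply: Pind.
Qed.

(** Adjoining [b] can fail only through a nontrivial relation of degree below [p] modulo [P]; as b^p
    is already in [W], [b] is then a fraction over [W] modulo [P]. *)
Lemma full_adjoin W n b : coef_ring W n -> (0 < p)%N -> W (b ^+ p) ->
  ~ coef_ring (adjoin W b) n ->
  exists s u, [/\ W s, ~ P s, W u & P (s * b - u)].
Proof.
move=> cW p0 Wbp nadj.
have [g [Wg szg Pg [i Pgi]]] : exists g : {poly A}, [/\ forall i, W g`_i,
    (size g <= p)%N, P g.[b] & exists i, ~ P g`_i].
  apply: contrapT => nog; apply: nadj; apply: adjoin_coef_ring => // g Wg szg Pg i.
  by apply: contrapT => Pgi; apply: nog; exists g; split=> //; exists i.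
have [D [rho [Prho _]]] := residue_domain primeP.
have charD : p \in [pchar D] by apply: (rmorph_pchar rho charA).
pose Sd : {pred D} := fun x => `[< exists2 w, W w & x = rho w >].
have SdP : subring_closed Sd.
  split.
  - by apply/asboolP; exists 1; rewrite ?rmorph1 //; apply: coef_ring1 cW.
  - move=> _ _ /asboolP[x Wx ->] /asboolP[y Wy ->]; apply/asboolP.
    by exists (x - y); rewrite ?rmorphB //; apply: (coef_ringB cW).
  - move=> _ _ /asboolP[x Wx ->] /asboolP[y Wy ->]; apply/asboolP.
    by exists (x * y); rewrite ?rmorphM //; apply: (coef_ringM cW).
pose S : subringClosed D := HB.pack Sd (GRing.isSubringClosed.Build D Sd SdP).
have [||||| v [/asboolP[s Ws vE] v0 /asboolP[u Wu vbE]]] :=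
    @purely_inseparable_degree D p charD S (rho b) _ (map_poly rho g).
- by apply/asboolP; exists (b ^+ p); rewrite // rmorphXn.
- by apply/polyOverP => k; rewrite coef_map; apply/asboolP; exists g`_k.
- by apply/eqP => /(congr1 (fun h : {poly D} => h`_i)); rewrite coef_map coef0 => /Prho.
- by rewrite /root horner_map; apply/eqP/Prho.
- exact: leq_trans (size_poly _ _) szg.
exists s, u; split=> //.
- by move=> /Prho sE; rewrite vE sE eqxx in v0.
- by apply/Prho; rewrite rmorphB rmorphM -vE vbE subrr.
Qed.

(** From level [e] to e + 1, the p-th powers of [W] suit the new exponent but may cover only p-th
    powers of residues. A maximal coefficient ring [V] above them is full by the dichotomy of
    [full_adjoin]. *)
Lemma coef_ring_exists e : exists2 W, coef_ring W (p ^ e) & full_coef_ring W.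
Proof.
have p0 : (0 < p)%N by rewrite prime_gt0 // (pcharf_prime charA).
elim: e => [|e [W cW fW]].
  exists [set: A]; first by split=> // w _ Pw; apply: sub_satur; rewrite // frob_power1.
  by move=> a; exists 1, a; split=> //; [case: primeP | rewrite mul1r subrr; case: idP].
pose good X := coef_ring X (p ^ e.+1) /\ [set w ^+ p | w in W] `<=` X.
have [|V [VP Vmax]] := @Zorn_bigcup A [set X | X = set0 \/ good X].
  move=> C CF Ctot; have [C0|] := pselect (C `<=` [set set0]).
    by left; apply/seteqP; split=> // x [X /C0 -> //].
  move=> /existsNP[X0 /not_implyP[CX0 X00]].
  have Cgood X x : C X -> X x -> good X.
    by move=> CX Xx; case: (CF X CX) => // X_0; rewrite X_0 in Xx.
  have [x0 Xx0] : X0 !=set0 by apply/set0P/eqP.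
  have [cX0 WX0] := Cgood _ _ CX0 Xx0.
  right; split; last by apply: subset_trans WX0 _ => x X0x; exists X0.
  have join x y : (\bigcup_(X in C) X) x -> (\bigcup_(X in C) X) y ->
      exists X, [/\ C X, coef_ring X (p ^ e.+1), X x & X y].
    move=> [X CX Xx] [Y CY Yy].
    have [cX _] := Cgood _ _ CX Xx; have [cY _] := Cgood _ _ CY Yy.
    by case: (Ctot X Y CX CY) => XY; [exists Y | exists X]; split=> //; apply: XY.
  split.
  - by exists X0 => //; apply: coef_ring1 cX0.
  - move=> x y Ux Uy; have [X [CX cX Xx Xy]] := join x y Ux Uy.
    by exists X => //; apply: (coef_ringB cX).
  - move=> x y Ux Uy; have [X [CX cX Xx Xy]] := join x y Ux Uy.
    by exists X => //; apply: (coef_ringM cX).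
  - by move=> a; exists X0 => //; apply: coef_ring_expr cX0 _.
  - by move=> w [X CX Xw]; have [cX _] := Cgood _ _ CX Xw; apply: coef_ring_prime cX _ Xw.
have {VP}[cV WV] : good V.
  case: VP => // V0; exfalso.
  have gW : good [set w ^+ p | w in W] by split=> //; apply: coef_ring_frob.
  apply: (Vmax [set w ^+ p | w in W]); last by right.
  rewrite V0; split=> // W0; have [cWp _] := gW.
  exact: (W0 _ (coef_ring1 cWp)).
exists V => // a; have [s [u [Ws Ps Wu Psa]]] := fW a.
(* The residue u / s is rewritten as b / s^p, whose denominator lies in [V]. *)
pose b := s ^+ p.-1 * u.
have Wb : W b by apply: (coef_ringM cW) => //; apply: (coef_ringX _ cW).
have Vbp : V (b ^+ p) by apply: WV; exists b.
have Vsp : V (s ^+ p) by apply: WV; exists s.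
have Psp : ~ P (s ^+ p) by apply: prime_neqX.
have Pspa : P (s ^+ p * a - b).
  have -> : s ^+ p * a - b = s ^+ p.-1 * (s * a - u).
    by rewrite /b -{1}(prednK p0) exprS; ring.
  by case: idP => _ _; apply.
have [cVb|/(full_adjoin cV p0 Vbp)[v [w [Vv Pv Vw Pvw]]]] :=
    pselect (coef_ring (adjoin V b) (p ^ e.+1)).
  exists (s ^+ p), b; split=> //; apply: contrapT => Vb.
  have subV : V `<=` adjoin V b.
    move=> x Vx; exists x%:P; last by rewrite hornerC.
    by move=> i; rewrite coefC; case: eqP => // _; apply: coef_ring0 cV.
  apply: (Vmax (adjoin V b)); last by right; split=> //; apply: subset_trans subV.
  split=> // adjV; apply/Vb/adjV; exists 'X; last by rewrite hornerX.
  by move=> i; rewrite coefX; case: eqP => _; [apply: coef_ring1 cV | apply: coef_ring0 cV].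
exists (v * s ^+ p), w; split=> //; [exact: (coef_ringM cV) | exact: prime_neqM |].
have -> : v * s ^+ p * a - w = v * (s ^+ p * a - b) + (v * b - w) by ring.
by case: idP => _ PD PM; apply: PD => //; apply: PM.
Qed.

End CoefficientRing.

(** * Expansion in local parameters *)

Lemma growth_leq_dim (A : comNzRingType) (p : nat) (charA : p \in [pchar A])
    (d c : nat) (x : 'I_d -> A) (P : set A) :
  noetherian A -> prime_ideal (ideal_gen x) ->
  (forall a, ~ ideal_gen x a -> exists b, b * a = 1) ->
  prime_ideal P -> P `<=` ideal_gen x -> growth p P c -> (c <= d)%N.
Proof.
move=> noethA primeM unitM primeP PM gP; have p1 := prime_gt1 (pcharf_prime charA).
have [e0 gM] : growth p (ideal_gen x) c.
  have [MP|MP] := pselect (ideal_gen x `<=` P).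
    by have <- : P = ideal_gen x by apply/seteqP.
  apply: (growth_leq charA (leqnSn c)); apply: growth_lt gP => //.
have cM e : comp_series (ideal_gen x) (frob_power (ideal_gen x) (p ^ e)) ((p ^ e) ^ d).
  rewrite -mon_ideal_frob //.
  have := @comp_series_mon_ideal _ _ x (fun=> p ^ e)%N; rewrite prod_nat_const card_ord.
  by apply=> _; apply: (pexp_gt0 charA).
(* At e = e0 d + 1, c > d would give e (d + 1) <= (e0 + e) d, that is e <= e0 d. *)
have := chain_comp_series primeM unitM (frob_power_ideal _ _) (gM (e0 * d + 1)%N) (cM _).
rewrite -!expnM leq_exp2l // leqNgt => H; rewrite leqNgt; apply: contra H.
by nia.
Qed.

Lemma mnm_neq0 n (m : 'X_{1..n}) : m != 0%MM -> exists i, m i != 0%N.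
Proof.
move=> m0; apply/existsP; apply: contraR m0; rewrite negb_exists => /forallP m0.
by apply/eqP/mnmP => i; rewrite mnm0E; apply/eqP; rewrite -[_ == _]negbK.
Qed.

Section Expansion.
Variables (A : comNzRingType) (p : nat).
Hypothesis charA : p \in [pchar A].
Variables (P W : set A) (e c : nat) (y : 'I_c -> A).
Hypothesis primeP : prime_ideal P.
Hypothesis geny : local_generators P y.
Local Notation q := (p ^ e)%N.
Hypothesis cW : coef_ring P W q.
Hypothesis fW : full_coef_ring P W.
Local Notation F := (satur P (frob_power P q)).
Hypothesis socleP : forall m w, (forall i : 'I_c, m i < q)%N ->
  F (w * \prod_i y i ^+ m i) -> P w.
Implicit Types (m : 'X_{1..c}) (G : {mpoly A[c]}).

Let idP : ideal P. Proof. by case: primeP. Qed.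
Let idF : ideal F. Proof. exact/satur_ideal/frob_power_ideal. Qed.
Let q0 : (0 < q)%N. Proof. exact: (pexp_gt0 charA). Qed.

Lemma frob_power_monomial m i : (q <= m i)%N -> F (\prod_j y j ^+ m j).
Proof.
move=> qm; apply: (sub_satur primeP); rewrite (bigD1 i) //=.
apply: (ideal_mulr _ (frob_power_ideal P q)); rewrite -(subnK qm) exprD.
have [_ _ FM] := frob_power_ideal P q; apply: FM; apply: frob_powerX.
exact: geny.1.
Qed.

Definition expandable a := exists s G,
  [/\ W s, ~ P s, forall m, W G@_m & F (s * a - G.@[y])].

Lemma expandable_frob a : F a -> expandable a.
Proof.
move=> Fa; exists 1, 0; split=> //.
- exact: coef_ring1 cW.
- by case: primeP.
- by move=> m; rewrite mcoeff0; apply: coef_ring0 cW.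
- by rewrite mul1r meval0 subr0.
Qed.

Lemma expandableD a b : expandable a -> expandable b -> expandable (a + b).
Proof.
move=> [s [G [Ws Ps WG FG]]] [t [H [Wt Pt WH FH]]]; exists (s * t), (t *: G + s *: H).
split.
- exact: (coef_ringM cW).
- exact: prime_neqM.
- move=> m; rewrite mcoeffD !mcoeffZ.
  by apply: (coef_ringD cW); apply: (coef_ringM cW).
- rewrite mevalD !mevalZ.
  have -> : s * t * (a + b) - (t * G.@[y] + s * H.@[y]) =
    t * (s * a - G.@[y]) + s * (t * b - H.@[y]) by ring.
  by have [_ FD FM] := idF; apply: FD; apply: FM.
Qed.

Lemma expandable_cancel s a : W s -> ~ P s -> expandable (s * a) -> expandable a.
Proof.
move=> Ws Ps [t [G [Wt Pt WG FG]]]; exists (t * s), G; split=> //.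
- exact: (coef_ringM cW).
- exact: prime_neqM.
- by rewrite -mulrA.
Qed.

Lemma expandable_coef w m : W w -> expandable (w * \prod_i y i ^+ m i).
Proof.
move=> Ww; exists 1, (w *: 'X_[m]); split.
- exact: coef_ring1 cW.
- by case: primeP.
- move=> m'; rewrite mcoeffZ mcoeffX; case: eqP => _; rewrite ?mulr1 ?mulr0 //.
  exact: coef_ring0 cW.
- by rewrite mul1r mevalZ mevalX subrr; case: idF.
Qed.

(** Replacing [a] by its residue in [W] leaves an error in [P], hence monomials of degree one
    higher. Beyond degree c q some exponent reaches [q] and the monomial vanishes modulo P^[q]. *)
Lemma expandable_monomial k m a : (c * q < mdeg m + k)%N ->
  expandable (a * \prod_i y i ^+ m i).
Proof.
elim: k m a => [|k IH] m a.
  rewrite addn0 => lt_m; have [i qi] : exists i, (q <= m i)%N.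
    apply/existsP; apply: contraLR lt_m; rewrite negb_exists -leqNgt => /forallP m_lt.
    rewrite mdegE -[in X in (_ <= X)%N](card_ord c) -sum_nat_const leq_sum // => i _.
    by have := m_lt i; rewrite -ltnNge => /ltnW.
  by apply: expandable_frob; have [_ _ FM] := idF; apply: FM; apply: frob_power_monomial qi.
rewrite addnS ltnS => le_m.
have [s [u [Ws Ps Wu Psau]]] := fW a.
have [t [Pt [b bE]]] := geny.2 _ Psau.
(* The denominator [t] need not lie in [W], but its [q]-th power does. *)
apply: (@expandable_cancel (t ^+ q * s)).
- by apply: (coef_ringM cW) => //; apply: coef_ring_expr cW _.
- by apply: prime_neqM => //; apply: prime_neqX.
have -> : t ^+ q * s * (a * \prod_i y i ^+ m i) = t ^+ q * u * \prod_i y i ^+ m i +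
    \sum_j (t ^+ q.-1 * b j) * \prod_i y i ^+ (m + U_(j))%MM i.
  have -> : t ^+ q * s * (a * \prod_i y i ^+ m i) = t ^+ q * u * \prod_i y i ^+ m i +
    t ^+ q.-1 * (t * (s * a - u)) * \prod_i y i ^+ m i.
    by rewrite -{1 2}(prednK q0) exprS; ring.
  congr (_ + _); rewrite bE mulr_sumr mulr_suml; apply: eq_bigr => j _.
  have -> : \prod_i y i ^+ (m + U_(j))%MM i = y j * \prod_i y i ^+ m i.
    rewrite (bigD1 j) //= [in RHS](bigD1 j) //= mulrA mnmDE mnm1E eqxx addn1 exprS.
    congr (_ * _); apply: eq_bigr => i /negPf ij.
    by rewrite mnmDE mnm1E eq_sym ij addn0.
  by ring.
apply: expandableD.
  by apply: expandable_coef; apply: (coef_ringM cW) => //; apply: coef_ring_expr cW _.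
elim/big_ind: _ => [||j _].
- by apply: expandable_frob; case: idF.
- exact: expandableD.
- by apply: IH; rewrite mdegD mdeg1 addn1 addSn ltnS.
Qed.

Lemma expandable_all a : expandable a.
Proof.
have := @expandable_monomial (c * q).+1 0%MM a.
rewrite mdeg0 add0n leqnn => /(_ isT); rewrite big1 ?mulr1 // => i _.
by rewrite mnm0E.
Qed.

(** Induction on the degree of [m]: multiply by y^(q - 1 - m). Terms of lower degree have
    coefficients in [P]; any other term has an exponent above that of [m], which is pushed to [q] or
    beyond. Only G_m y^(q - 1) remains, and [socleP] applies. *)
Lemma mcoeff_prime G : (forall m, W G@_m) -> F G.@[y] ->
  forall m, (forall i, m i < q)%N -> P G@_m.
Proof.
move=> WG FG m; have [k] := ubnP (mdeg m); elim: k m => // k IH m mk m_lt.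
have [mG|] := boolP (m \in msupp G); last by rewrite mcoeff_msupp negbK => /eqP->; case: idP.
pose Y m' := \prod_i y i ^+ (m' i + (q.-1 - m i)).
have YE m' : Y m' = (\prod_i y i ^+ m' i) * \prod_i y i ^+ (q.-1 - m i).
  by rewrite -big_split; apply: eq_bigr => i _; rewrite exprD.
have [F0 FD FM] := idF.
suff FY : F (G@_m * Y m).
  apply: (@socleP (fun=> q.-1)) => [_|]; first by rewrite prednK.
  move: FY; rewrite /Y; congr (F (_ * _)); apply: eq_bigr => i _.
  by rewrite subnKC // -ltnS prednK.
have : F (G.@[y] * \prod_i y i ^+ (q.-1 - m i)) by rewrite mulrC; apply: FM.
rewrite mevalE mulr_suml (bigD1_seq m) ?msupp_uniq //= -mulrA -YE => FS.
rewrite -(addrK (\sum_(m' <- msupp G | m' != m)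
  G@_m' * (\prod_i y i ^+ m' i) * \prod_i y i ^+ (q.-1 - m i)) (G@_m * Y m)).
apply: idealB => //; apply: ideal_bigsum => // m' m'm.
have [/existsP[i qi]|] := boolP [exists i, (q <= m' i)%N].
  by rewrite mulrAC; apply/FM/(frob_power_monomial qi).
rewrite negb_exists => /forallP m'_lt; have {}m'_lt i : (m' i < q)%N by rewrite ltnNge.
have [lt|le] := ltnP (mdeg m') (mdeg m).
  have Pm' : P G@_m' by apply: IH => //; apply: leq_trans lt _; rewrite -ltnS.
  by rewrite -mulrA mulrC; apply/FM/(coef_ring_prime cW).
have [i lt_i] : exists i, (m i < m' i)%N.
  apply/existsP; apply: contraR m'm; rewrite negb_exists => /forallP le_m.
  have {}le_m i : (m' i <= m i)%N by rewrite leqNgt.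
  apply/eqP/mnmP => i; apply/eqP; rewrite eqn_leq le_m /= leqNgt; apply/negP => lt_i.
  move: le; rewrite leqNgt !mdegE (bigD1 i) //= [X in (_ < X)%N](bigD1 i) //=.
  rewrite -addSn leq_add //.
  exact: leq_sum.
rewrite -mulrA; apply: FM; rewrite -YE.
have -> : Y m' = \prod_i y i ^+ [multinom (m' i + (q.-1 - m i))%N | i < c] i.
  by apply: eq_bigr => j _; rewrite mnmE.
apply: (@frob_power_monomial _ i); rewrite mnmE.
by have := m_lt i; lia.
Qed.

Lemma meval_sub_constant G : P (G.@[y] - G@_0%MM).
Proof.
elim/mpolyind: G => [|a m G _ _ IH]; first by rewrite meval0 mcoeff0 subrr; case: idP.
rewrite mevalD mevalZ mevalX mcoeffD mcoeffZ mcoeffX opprD addrACA.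
case: idP => _ PD PM; apply: PD => //; rewrite -mulrBr; apply: PM.
have [->|/mnm_neq0[i mi]] := eqVneq m 0%MM.
  by rewrite big1 ?subrr => [|i _]; [case: idP | rewrite mnm0E].
rewrite subr0 (bigD1 i) //=; apply: (ideal_mulr _ idP).
by rewrite -(prednK (_ : 0 < m i)%N) ?lt0n // exprS; apply: (ideal_mulr _ idP); apply: geny.1.
Qed.

(* If [f ^+ n] multiplies [P] into its Frobenius power, so does the power [G ^+ n]
   of its expansion, so that [G ^+ n] is congruent modulo the q-th powers of
   the variables to a multiple of their product to the power [q - 1]. *)
Lemma socle_expansion f n : P f -> (forall a, P a -> frob_power P q (f ^+ n * a)) ->
  ~ F (f ^+ n) ->
  exists G, [/\ P G@_0%MM,
    forall m, (forall i, m i < q)%N -> (exists i, m i != q.-1) -> P (G ^+ n)@_m &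
    ~ P (G ^+ n)@_[multinom q.-1 | i < c]].
Proof.
move=> Pf fP fF; have [s [G [Ws Ps WG FG]]] := expandable_all f.
have [F0 FD FM] := idF.
have FP : F `<=` P.
  by move=> a /(saturS (frob_power_subid idP q0)); rewrite satur_prime.
exists G.
have WM (G1 G2 : {mpoly A[c]}) : (forall m, W G1@_m) -> (forall m, W G2@_m) ->
    forall m, W (G1 * G2)@_m.
  move=> W1 W2 m; rewrite (mcoeff_poly_mul _ _ (leqnn _)).
  by apply: (coef_ring_sum _ cW) => k _; apply: (coef_ringM cW).
have WX m' m : W ('X_[m'] : {mpoly A[c]})@_m.
  by rewrite mcoeffX; case: eqP => _; [apply: coef_ring1 cW | apply: coef_ring0 cW].
have WGn k m : W (G ^+ k)@_m.
  elim: k m => [|k IH] m; first by rewrite expr0 -mpolyX0.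
  by rewrite exprS; apply: WM.
have FGn k : F ((s * f) ^+ k - (G ^+ k).@[y]).
  rewrite rmorphXn; elim: k => [|k IH]; first by rewrite !expr0 subrr.
  rewrite !exprS.
  have -> : s * f * (s * f) ^+ k - G.@[y] * G.@[y] ^+ k =
    s * f * ((s * f) ^+ k - G.@[y] ^+ k) + G.@[y] ^+ k * (s * f - G.@[y]) by ring.
  by apply: FD; apply: FM.
have Pcoef m : (forall i, m i < q)%N -> (exists i, m i != q.-1) -> P (G ^+ n)@_m.
  move=> m_lt [i mi].
  (* As m_i < q - 1, the exponent m + U_i stays below [q], and G^n X_i evaluates into P^[q] locally
     since f^n y_i does. *)
  have := @mcoeff_prime (G ^+ n * 'X_i) (WM _ _ (WGn n) (WX _)) _ (U_(i) + m)%MM.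
  rewrite mcoeffMX; apply.
    rewrite mevalM mevalXU.
    rewrite -[X in F X](subrK ((s * f) ^+ n * y i)) -mulrBl; apply: FD.
      by rewrite -opprB mulNr -mulrN; apply: ideal_mulr.
    rewrite exprMn -mulrA; apply: FM; apply: (sub_satur primeP); apply: fP.
    exact: geny.1.
  move=> j; rewrite mnmDE mnm1E; case: eqP => [<-|_]; last by rewrite add0n.
  by move: mi (m_lt i); lia.
split=> //.
- have Gy0 := meval_sub_constant G.
  have -> : G@_0%MM = s * f - (s * f - G.@[y]) - (G.@[y] - G@_0%MM) by ring.
  apply: idealB => //; apply: idealB => //; last exact: FP.
  by case: idP => _ _; apply.
- move=> Pmu; apply: fF; have Psn := prime_neqX (n := n) primeP Ps.
  apply: (saturP primeP Psn); rewrite -exprMn.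
  rewrite -[X in F X](subrK (G ^+ n).@[y]); apply: FD => //.
  rewrite mevalE; apply: ideal_bigsum => // m _.
  have [/existsP[i qi]|] := boolP [exists i, (q <= m i)%N].
    by apply/FM/(frob_power_monomial qi).
  rewrite negb_exists => /forallP m_lt; have {}m_lt i : (m i < q)%N by rewrite ltnNge.
  rewrite mulrC; apply/FM/(coef_ring_prime cW) => //.
  have [/existsP[i mi]|] := boolP [exists i, m i != q.-1]; first by apply: Pcoef => //; exists i.
  rewrite negb_exists => /forallP m_eq.
  rewrite (_ : m = [multinom q.-1 | i < c]) //; apply/mnmP => i.
  by rewrite mnmE; apply/eqP; rewrite -[_ == _]negbK.
Qed.

End Expansion.

(** * Specialization to an algebraically closed field *)

Section PrimePoly.
Variables (D : idomainType) (q : set {poly D}).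
Hypothesis primeq : prime_ideal q.
Hypothesis qC : forall c, q c%:P -> c = 0.

(** Over the fraction field of [D] a nonzero [q] is generated by an element [g0] of least degree,
    which is irreducible there; so [h] outside [q] is coprime to it, and clearing denominators
    leaves the constant [w]. *)
Lemma prime_poly_bezout h : ~ q h -> (forall g, q g -> g = 0) \/
  exists g0 u v w, [/\ q g0, (1 < size g0)%N, w != 0, u * h + v * g0 = w%:P &
    forall g, q g -> exists k r, lead_coef g0 ^+ k *: g = r * g0].
Proof.
move=> qh; have [[q_0 qD qM] q1 qprime] := primeq.
have [qtriv|/existsNP[g1 /not_implyP[qg1 /eqP g1_0]]] := pselect (forall g, q g -> g = 0).
  by left.
right.
pose sz k := `[< exists2 g, q g & g != 0 /\ size g = k >].
have exsz : exists k, sz k by exists (size g1); apply/asboolP; exists g1.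
have [_ /asboolP[g0 qg0 [g0_0 <-]] gmin] := ex_minnP exsz.
have {}gmin g : q g -> g != 0 -> (size g0 <= size g)%N.
  by move=> qg g_0; apply: gmin; apply/asboolP; exists g.
have qZ c g : q g -> q (c *: g) by rewrite -mul_polyC; apply: qM.
have divg g : q g -> exists k r, lead_coef g0 ^+ k *: g = r * g0.
  move=> qg; exists (Pdiv.Idomain.scalp g g0), (g %/ g0).
  have gE := Pdiv.Idomain.divp_eq g g0.
  have qmod : q (g %% g0).
    have -> : g %% g0 = lead_coef g0 ^+ Pdiv.Idomain.scalp g g0 *: g + (- (g %/ g0)) * g0.
      by rewrite gE mulNr addrAC subrr add0r.
    by apply: qD; [apply: qZ | apply: qM].
  rewrite gE [g %% g0](_ : _ = 0) ?addr0 //; apply: contrapT => /eqP mod0.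
  by have := gmin _ qmod mod0; rewrite leqNgt Pdiv.Idomain.ltn_modp g0_0.
have dvdq d g : q d -> d %| g -> q g.
  move=> qd /Pdiv.Idomain.dvdpP[[c r] /= c0 cE].
  have : q (c%:P * g) by rewrite mul_polyC cE; apply: qM.
  by case/qprime => // /qC /eqP; rewrite (negPf c0).
have cop : coprimep h g0.
  rewrite Pdiv.Idomain.coprimep_def; set d := gcdp h g0.
  have /Pdiv.Idomain.dvdpP[[c r] /= c0 cE] : d %| g0 := Pdiv.Idomain.dvdp_gcdr h g0.
  have nqd : ~ q d by move=> qd; apply: qh; apply: dvdq qd (Pdiv.Idomain.dvdp_gcdl h g0).
  have qr : q r.
    have : q (r * d) by rewrite -cE; apply: qZ.
    by case/qprime => // /nqd.
  have r0 : r != 0.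
    apply: contraNneq g0_0 => r0.
    by rewrite -size_poly_eq0 -(size_scale _ c0) cE r0 mul0r size_poly0.
  have d0 : d != 0 by apply: contraTneq isT => d0; exfalso; apply: nqd; rewrite d0.
  have := congr1 (fun g : {poly D} => size g) cE; rewrite size_scale // size_mul //.
  have := gmin _ qr r0; have := d0; rewrite -size_poly_gt0.
  by move: (size g0) (size r) (size d) => a b k; lia.
have /Pdiv.Idomain.Bezout_coprimepP[[u v] /=] := cop.
rewrite -size_poly_eq1 => /size_poly1P[w w0 wE].
exists g0, u, v, w; split=> //.
rewrite ltnNge; apply/negP => sz1; have g0E := size1_polyC sz1.
by move: qg0; rewrite g0E => /qC c0; rewrite g0E c0 eqxx in g0_0.
Qed.

End PrimePoly.

Section Specialization.
Variables (K : closedFieldType) (B : comNzRingType) (q : set {poly B}).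
Hypothesis primeq : prime_ideal q.

Lemma prime_polyC : prime_ideal [set a : B | q a%:P].
Proof.
have [[q0 qD qM] q1 qprime] := primeq; split; first split=> [|x y|a x] //=.
- by rewrite polyCD; apply: qD.
- by rewrite polyCM; apply: qM.
- exact: q1.
- by move=> x y /=; rewrite polyCM; apply: qprime.
Qed.

(* One step of the extension theorem for homomorphisms to an algebraically
   closed field: a specialization of the coefficients extends to the variable
   as soon as it does not kill [w]. *)
Lemma specialize_var h : ~ q h -> exists2 w, ~ q w%:P &
  forall sigma : {rmorphism B -> K}, (forall a, q a%:P -> sigma a = 0) -> sigma w != 0 ->
    exists b, (forall g, q g -> (map_poly sigma g).[b] = 0) /\ (map_poly sigma h).[b] != 0.
Proof.
move=> qh; have [[q_0 qD qM] q1 qprime] := primeq.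
have [D [rho [qrho /choice[lam lamK]]]] := residue_domain prime_polyC.
have qrhop g : map_poly rho g = 0 -> q g.
  move=> g0; rewrite -(coefK g) poly_def; apply: ideal_bigsum => [|i _]; first by split.
  rewrite -mul_polyC mulrC; apply: qM; apply/qrho.
  by have := congr1 (fun u : {poly D} => u`_i) g0; rewrite coef_map coef0.
pose lift (g : {poly D}) : {poly B} := \poly_(i < size g) lam g`_i.
have liftK g : map_poly rho (lift g) = g.
  apply/polyP => i; rewrite coef_map coef_poly; case: ltnP => [_|le]; first exact/esym/lamK.
  by rewrite raddf0 nth_default.
pose qd : set {poly D} := [set map_poly rho g | g in q].
have qDE g : q g <-> qd (map_poly rho g).
  split=> [qg|[g' qg' /eqP]]; first by exists g.
  rewrite -subr_eq0 -rmorphB => /eqP/qrhop qB.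
  by rewrite -(subKr g' g) -[g' - g]opprK opprB; apply: qD => //; rewrite -mulN1r opprB; apply: qM.
have pqD : prime_ideal qd.
  split; first split=> [|_ _ [u qu <-] [v qv <-]|a _ [u qu <-]].
  - by exists 0; rewrite ?rmorph0.
  - by exists (u + v); [apply: qD | rewrite rmorphD].
  - by exists (lift a * u); [apply: qM | rewrite rmorphM /= liftK].
  - by rewrite -(rmorph1 (map_poly rho)) -qDE.
  - by move=> u v; rewrite -(liftK u) -(liftK v) -rmorphM -!qDE => /qprime.
have qD0 c : qd c%:P -> c = 0.
  by rewrite {1}(lamK c) -map_polyC -qDE => /qrho; rewrite -lamK.
have sigE (sigma : {rmorphism B -> K}) : (forall a, q a%:P -> sigma a = 0) ->
    forall g g', map_poly rho g = map_poly rho g' -> map_poly sigma g = map_poly sigma g'.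
  move=> sig0 g g' gg'; apply/polyP => i; rewrite !coef_map; apply/eqP.
  rewrite -subr_eq0 -rmorphB; apply/eqP/sig0/qrho; rewrite rmorphB.
  by have := congr1 (fun u : {poly D} => u`_i) gg'; rewrite !coef_map => ->; rewrite subrr.
have := @prime_poly_bezout D qd pqD qD0 (map_poly rho h).
rewrite -qDE => /(_ qh)[q0|[g0 [u [v [w [qg0 szg0 w0 hE divg]]]]]].
  have [i qi] : exists i, ~ q (h`_i)%:P.
    apply: contrapT => noi; apply: qh; apply: qrhop; apply/polyP => i.
    by rewrite coef_map coef0; apply/qrho; apply: contrapT => qi; apply: noi; exists i.
  (* Here [q] consists of the polynomials with all coefficients in its contraction, so the variable
     may take any value; a nonroot of the image of [h] is chosen. *)
  exists h`_i => // sigma sig0 sigw.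
  have h0 : map_poly sigma h != 0.
    by apply/eqP => /(congr1 (fun u : {poly K} => u`_i)) /eqP; rewrite coef_map coef0 (negPf sigw).
  have /closed_nonrootP[b hb] := h0; exists b; split=> // g /qDE/q0 g0.
  by rewrite (sigE sigma sig0 g 0) ?rmorph0 ?horner0.
have ll : rho (lam (lead_coef g0)) = lead_coef g0 := esym (lamK _).
have lw : rho (lam w) = w := esym (lamK _).
(* The first factor preserves the degree of [g0], so that a root exists; the second keeps [h]
   nonzero at that root, by Bezout. *)
exists (lam (lead_coef g0) * lam w).
  rewrite polyCM => /qprime[] /qrho; rewrite ?ll ?lw; apply/eqP => //.
  by rewrite lead_coef_eq0 -size_poly_gt0 ltnW.
move=> sigma sig0; rewrite rmorphM mulf_eq0 negb_or => /andP[sl sw].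
have szs : (size (map_poly sigma (lift g0)) > 1)%N.
  rewrite (leq_trans szg0) // leqNgt; apply/negP => lt.
  have := @nth_default _ 0 (map_poly sigma (lift g0)) (size g0).-1.
  rewrite -ltnS prednK; last by rewrite ltnW.
  move=> /(_ lt); rewrite coef_map coef_poly prednK ?leqnn; last by rewrite ltnW.
  by rewrite -lead_coefE => /eqP; rewrite (negPf sl).
have /closed_rootP[b /rootP g0b] : size (map_poly sigma (lift g0)) != 1%N.
  by rewrite gtn_eqF.
exists b; split=> [g /qDE/divg[k [r gE]]|].
  have /(congr1 (fun u : {poly K} => u.[b])) : map_poly sigma ((lam (lead_coef g0) ^+ k)%:P * g) =
      map_poly sigma (lift r * lift g0).
    apply: sigE => //; rewrite [LHS]rmorphM [RHS]rmorphM /= !liftK -gE -mul_polyC.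
    congr (_ * _); rewrite map_polyC; congr _%:P.
    exact: etrans (rmorphXn rho _ _) (congr1 (fun z => z ^+ k) ll).
  rewrite !rmorphM /= !hornerM g0b mulr0 map_polyC /= hornerC rmorphXn => /eqP.
  by rewrite mulf_eq0 expf_eq0 (negPf sl) andbF => /eqP.
have /(congr1 (fun u : {poly K} => u.[b])) : map_poly sigma (lift u * h + lift v * lift g0) =
    map_poly sigma (lam w)%:P.
  apply: sigE => //; rewrite rmorphD [X in X + _]rmorphM [X in _ + X]rmorphM /= !liftK hE.
  by rewrite map_polyC; congr _%:P; exact: esym lw.
rewrite rmorphD !rmorphM /= hornerD !hornerM g0b mulr0 addr0 map_polyC /= hornerC => E.
by apply/eqP => hb; move: sw; rewrite -E hb mulr0 eqxx.
Qed.

End Specialization.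

(* A polynomial ring over the integers in [N] variables, built one variable at
   a time and known only by its universal property and the Nullstellensatz. *)
Lemma nullstellensatz (K : closedFieldType) p (charK : p \in [pchar K]) N :
  exists (T : comNzRingType) (x : nat -> T),
    (forall (A : comNzRingType) (a : nat -> A), exists ev : {rmorphism T -> A},
      forall i, (i < N)%N -> ev (x i) = a i) /\
    (forall (q : set T) h, prime_ideal q -> q p%:R -> ~ q h ->
      exists sigma : {rmorphism T -> K}, (forall g, q g -> sigma g = 0) /\ sigma h != 0).
Proof.
elim: N => [|N [T [x [xev xnull]]]].
  exists int, (fun=> 0); split=> [A a|q h pq qp qh].
    by exists (intr : {rmorphism int -> A}).
  exists (intr : {rmorphism int -> K}); have [[q0 qD qM] q1 _] := pq.
  have p_pr := pcharf_prime charK.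
  have coprime_q z : q z -> ~~ coprimez z p.
    move=> qz; apply/negP => /coprimezP[[u v] /= uvE]; apply: q1; rewrite -uvE.
    by apply: qD; apply: qM => //; rewrite -natz.
  have intrE z : (z%:~R == 0 :> K) = (p %| z)%Z.
    by rewrite (dvdz_pcharf charK).
  split=> [g /coprime_q|].
    move=> cop; apply/eqP; rewrite intrE; move: cop.
    by rewrite coprimezE /= coprime_sym prime_coprime // negbK.
  rewrite intrE; apply/negP => /dvdzP[k hE]; apply: qh; rewrite hE.
  by apply: qM; rewrite -natz.
exists {poly T}, (fun i => if (i < N)%N then (x i)%:P else 'X); split=> [A a|q h pq qp qh].
  have [ev evE] := xev A a.
  have cf : commr_rmorph ev (a N) by move=> z; apply: mulrC.
  exists (horner_morph cf : {rmorphism {poly T} -> A}) => i; rewrite ltnS leq_eqVlt.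
  case: ltnP => [iN _|Ni]; first by rewrite /= horner_morphC evE.
  by rewrite orbF => /eqP->; rewrite /= horner_morphX.
have [w qw spec] := specialize_var K pq qh.
have [|sigma [sig0 sigw]] := xnull _ w (prime_polyC pq) _ qw.
  by rewrite /= rmorph_nat.
have [b [gb hb]] := spec sigma sig0 sigw.
have cf : commr_rmorph sigma b by move=> z; apply: mulrC.
exists (horner_morph cf : {rmorphism {poly T} -> K}); split=> //.
Qed.

(** The coefficients of [G] become indeterminates over the integers. The generic polynomial [U]
    evaluates to [G], and the Nullstellensatz applies to the preimage of [P], which handles all
    coefficients of all powers at once. *)
Lemma specialize_mpoly (K : closedFieldType) (A : comNzRingType) p
    (charK : p \in [pchar K]) (charA : p \in [pchar A]) (P : set A) c
    (G : {mpoly A[c]}) n m0 : prime_ideal P -> ~ P (G ^+ n)@_m0 ->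
  exists H : {mpoly K[c]}, [/\ forall k m, P (G ^+ k)@_m -> (H ^+ k)@_m = 0 &
    (H ^+ n)@_m0 != 0].
Proof.
move=> primeP PG; have [[P0 PD PM] P1 Pprime] := primeP.
pose s := msupp G.
have [T [x [xev xnull]]] := nullstellensatz charK (size s).
have [ev evE] := xev A (fun i => G@_(nth 0%MM s i)).
pose U : {mpoly T[c]} := \sum_(i < size s) x i *: 'X_[nth 0%MM s i].
have evU : map_mpoly ev U = G.
  rewrite [RHS]mpolyE -/s (big_nth 0%MM) big_mkord /U rmorph_sum.
  by apply: eq_bigr => i _; rewrite /= map_mpolyZ map_mpolyX evE.
have evX k m : ev (U ^+ k)@_m = (G ^+ k)@_m.
  by rewrite -evU -rmorphXn /= mcoeff_map_mpoly.
have pq : prime_ideal [set z | P (ev z)].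
  split; first split=> [|u v Pu Pv|u v Pv] /=.
  - by rewrite rmorph0.
  - by rewrite rmorphD; apply: PD.
  - by rewrite rmorphM; apply: PM.
  - by move=> /=; rewrite rmorph1 => /P1.
  - by move=> u v; rewrite /= rmorphM => /Pprime.
have [||sigma [sig0 sigh]] := xnull _ (U ^+ n)@_m0 pq.
- by rewrite /= rmorph_nat (pcharf0 charA).
- by rewrite /= evX.
exists (map_mpoly sigma U); split=> [k m Pm|].
  by rewrite -rmorphXn /= mcoeff_map_mpoly; apply: sig0; rewrite /= evX.
by rewrite -rmorphXn /= mcoeff_map_mpoly.
Qed.

(** * Semilinear maps on a localization *)

Section LocalizationTrace.
Variables (D : idomainType) (P : set D) (primeP : prime_ideal P).
Local Notation L := (localization primeP).

Fact loc_subproof (a : D) : in_localization primeP (tofrac a).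
Proof.
by apply/asboolP; exists a, 1; rewrite tofrac1 divr1; split=> //; case: primeP.
Qed.

Definition loc (a : D) : L := Sub (tofrac a) (loc_subproof a).

Fact loc_is_zmod_morphism : zmod_morphism loc.
Proof. by move=> a b; apply: val_inj; apply: (rmorphB (@tofrac D)). Qed.

Fact loc_is_monoid_morphism : monoid_morphism loc.
Proof.
by split=> [|a b]; apply: val_inj; [apply: (rmorph1 (@tofrac D)) | apply: (rmorphM (@tofrac D))].
Qed.

HB.instance Definition _ := GRing.isZmodMorphism.Build D L loc loc_is_zmod_morphism.
HB.instance Definition _ := GRing.isMonoidMorphism.Build D L loc loc_is_monoid_morphism.

Lemma localizationP (r : L) : exists a b, ~ P b /\ r * loc b = loc a.
Proof.
have /asboolP[a [b [Pb rE]]] := valP r; exists a, b; split=> //.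
apply: val_inj; transitivity (\val r * tofrac b) => //.
by rewrite rE divfK // (not_prime_neq0 primeP Pb).
Qed.

Lemma loc_unit b : ~ P b -> exists u, u * loc b = 1.
Proof.
move=> Pb; have inP : in_localization primeP (tofrac b)^-1.
  by apply/asboolP; exists 1, b; rewrite tofrac1 mul1r.
exists (Sub _ inP); apply: val_inj; transitivity ((tofrac b)^-1 * tofrac b) => //.
by rewrite mulVf // (not_prime_neq0 primeP Pb).
Qed.

Lemma loc_inj : injective loc.
Proof.
move=> a b /(congr1 \val) ab; apply/eqP.
by rewrite -subr_eq0 -tofrac_eq0 tofracB subr_eq0; apply/eqP.
Qed.

Variables (q : nat) (phi : D -> D).
Hypothesis q_gt0 : (0 < q)%N.
Hypothesis phiB : zmod_morphism phi.
Hypothesis phiM : forall a x, phi (a ^+ q * x) = a * phi x.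

(** The extension is Phi (a / b) = phi (a b^(q-1)) / b, since a / b = a b^(q-1) / b^q. *)
Lemma localize_semilinear : exists Phi : L -> L,
  [/\ zmod_morphism Phi, forall a x, Phi (a ^+ q * x) = a * Phi x &
    forall a, Phi (loc a) = loc (phi a)].
Proof.
have cancel b (u v : L) : ~ P b -> u * loc b = v * loc b -> u = v.
  by move=> /loc_unit[w wb] uv; rewrite -(mulr1 u) -wb mulrCA uv mulrCA wb mulr1.
have exprq (z : D) : z ^+ q = z * z ^+ q.-1 by rewrite -exprS prednK.
have exprqL (z : L) : z ^+ q = z * z ^+ q.-1 by rewrite -exprS prednK.
have /choice[Phi PhiE] (r : L) : exists s, forall a b, ~ P b -> r * loc b = loc a ->
    s * loc b = loc (phi (a * b ^+ q.-1)).
  have [a [b [Pb rE]]] := localizationP r; have [w wb] := loc_unit Pb.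
  exists (w * loc (phi (a * b ^+ q.-1))) => a' b' Pb' rE'.
  have ab : a * b' = a' * b.
    by apply: loc_inj; rewrite !rmorphM /= -rE -rE'; ring.
  apply: (cancel b) => //.
  transitivity (w * loc b * (loc (phi (a * b ^+ q.-1)) * loc b')); first by ring.
  rewrite wb mul1r -!rmorphM; congr loc; rewrite mulrC [in RHS]mulrC -!phiM; congr phi.
  rewrite !exprq; transitivity (a * b' * (b * b') ^+ q.-1); first by rewrite exprMn; ring.
  by rewrite ab exprMn; ring.
have PhiP r s a b : ~ P b -> r * loc b = loc a -> s * loc b = loc (phi (a * b ^+ q.-1)) ->
    Phi r = s.
  by move=> Pb rE sE; apply: (cancel b) => //; rewrite sE; apply: PhiE.
exists Phi; split.
- move=> r s; have [a [b [Pb rE]]] := localizationP r.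
  have [a' [b' [Pb' sE]]] := localizationP s.
  have Pbb : ~ P (b * b') by apply: prime_neqM.
  have rE' : r * loc (b * b') = loc (a * b') by rewrite !rmorphM /= -rE mulrA.
  have sE' : s * loc (b * b') = loc (a' * b) by rewrite !rmorphM /= -sE; ring.
  apply: (PhiP _ _ (a * b' - a' * b) _ Pbb).
    by rewrite mulrBl rE' sE' -rmorphB.
  by rewrite mulrBl (PhiE r _ _ Pbb rE') (PhiE s _ _ Pbb sE') -rmorphB -phiB mulrBl.
- move=> z r; have [a [b [Pb zE]]] := localizationP z.
  have [u [v [Pv rE]]] := localizationP r.
  have Pbv : ~ P (b ^+ q * v) by apply: prime_neqM => //; apply: prime_neqX.
  apply: (PhiP _ _ (a ^+ q * u) _ Pbv).
    by rewrite !rmorphM !rmorphXn /= -rE -zE exprMn; ring.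
  have -> : a ^+ q * u * (b ^+ q * v) ^+ q.-1 = (a * b ^+ q.-1) ^+ q * (u * v ^+ q.-1).
    by rewrite !exprMn exprAC; ring.
  rewrite phiM !rmorphM /= -(PhiE r _ _ Pv rE) -zE !rmorphXn /= -[in LHS](prednK q_gt0) exprS.
  by ring.
- move=> a; have P1 : ~ P 1 by case: primeP.
  by apply: (PhiP _ _ a _ P1); rewrite rmorph1 ?mulr1 // expr1n mulr1.
Qed.

End LocalizationTrace.

(** * The threshold at the origin *)

Section MonomialTrace.
Variables (K : closedFieldType) (p d e : nat).
Hypothesis charK : p \in [pchar K].
Variable M : 'X_{1..d}.
Local Notation q := (p ^ e)%N.
Hypothesis M_lt : forall i, (M i < q)%N.
Implicit Types (m k : 'X_{1..d}) (f g : {mpoly K[d]}).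

Let q_gt0 : (0 < q)%N. Proof. exact: (pexp_gt0 charK). Qed.

Lemma pexp_root_exists : exists rt : K -> K,
  [/\ zmod_morphism rt, forall a b, rt (a ^+ q * b) = a * rt b & forall a, rt (a ^+ q) = a].
Proof.
have /choice[rt rtK] (a : K) : exists r, r ^+ q = a.
  have [|r] := closed_rootP ('X^q - a%:P) _.
    by rewrite size_XnsubC // eqSS -lt0n.
  by rewrite rootE !hornerE subr_eq0 => /eqP; exists r.
have inj (r s : K) : r ^+ q = s ^+ q -> r = s.
  move=> /eqP; rewrite -subr_eq0 -(pexprB charK) expf_eq0 subr_eq0 => /andP[_].
  by move/eqP.
exists rt; split=> [a b|a b|a]; apply: inj; rewrite ?pexprB ?exprMn ?rtK //.
Qed.

(** [M] is left general because, of the [d] variables, only the first [c] will carry q - 1. As M <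
    q, the quotient of [m] by [q] is the only possible preimage under [mono_mul]. *)
Definition mono_mul m : 'X_{1..d} := [multinom (q * m i + M i)%N | i < d].
Definition mono_div m : 'X_{1..d} := [multinom (m i %/ q)%N | i < d].
Definition mono_trace m : {mpoly K[d]} :=
  if m == mono_mul (mono_div m) then 'X_[mono_div m] else 0.

Lemma mono_mulK m : mono_div (mono_mul m) = m.
Proof.
by apply/mnmP => i; rewrite !mnmE mulnC divnMDl // divn_small ?addn0.
Qed.

Lemma mcoeff_mono_trace m k : (mono_trace m)@_k = (m == mono_mul k)%:R.
Proof.
rewrite /mono_trace; have [->|mk] := eqVneq m (mono_mul k).
  by rewrite mono_mulK eqxx mcoeffX eqxx.
case: eqP => [mE|_]; last by rewrite mcoeff0.
rewrite mcoeffX; case: eqP => // dk; case/eqP: mk; by rewrite mE dk.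
Qed.

Lemma mono_traceD m k : mono_trace (k *+ q + m)%MM = 'X_[k] * mono_trace m.
Proof.
have dE : mono_div (k *+ q + m) = (k + mono_div m)%MM.
  by apply/mnmP => i; rewrite !(mnmE, mnmDE, mulmnE) divnMDl.
rewrite /mono_trace dE; have -> : mono_mul (k + mono_div m) = (k *+ q + mono_mul (mono_div m))%MM.
  by apply/mnmP => i; rewrite !(mnmE, mnmDE, mulmnE) mulnDr addnA [(q * k i)%N]mulnC.
have -> : ((k *+ q + m)%MM == (k *+ q + mono_mul (mono_div m))%MM) = (m == mono_mul (mono_div m)).
  by apply/eqP/eqP => [/mnmP kk|<-] //; apply/mnmP => i; move: (kk i); rewrite !mnmDE => /addnI.
by case: ifP; rewrite ?mulr0 // mpolyXD.
Qed.

(* The trace-like map [sum c_m X^m |-> sum (c_(q m + M))^(1/q) X^m]. *)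
Lemma monomial_trace_exists : exists phi : {mpoly K[d]} -> {mpoly K[d]},
  [/\ zmod_morphism phi, forall a f, phi (a ^+ q * f) = a * phi f & phi 'X_[M] = 1].
Proof.
have [rt [rtB rtM rtK]] := pexp_root_exists.
have charD : p \in [pchar {mpoly K[d]}] := rmorph_pchar (@mpolyC d K) charK.
have rt0 : rt 0 = 0 by have := rtB 0 0; rewrite !subrr.
have rt1 : rt 1 = 1 by have := rtK 1; rewrite expr1n.
pose phi f := \sum_(m <- msupp f) rt f@_m *: mono_trace m.
have phiE f k : (phi f)@_k = rt f@_(mono_mul k).
  rewrite raddf_sum /=; under eq_bigr do rewrite mcoeffZ mcoeff_mono_trace.
  have [kf|kf] := boolP (mono_mul k \in msupp f).
    rewrite (bigD1_seq (mono_mul k)) ?msupp_uniq //= eqxx mulr1 big1 ?addr0 //.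
    by move=> m /negPf->; rewrite mulr0.
  move: (kf); rewrite mcoeff_msupp negbK => /eqP->; rewrite rt0 big1_seq // => m /= mf.
  case: eqP => [mE|_]; last by rewrite mulr0.
  by rewrite -mE mf in kf.
have phiB : zmod_morphism phi.
  by move=> f g; apply/mpolyP => k; rewrite mcoeffB !phiE mcoeffB rtB.
have phi0 : phi 0 = 0 by have := phiB 0 0; rewrite !subrr.
have phiD f g : phi (f + g) = phi f + phi g.
  have phiN h : phi (- h) = - phi h by have := phiB 0 h; rewrite phi0 !sub0r.
  by rewrite -{1}(opprK g) phiB phiN opprK.
have phiX c m : phi (c *: 'X_[m]) = rt c *: mono_trace m.
  apply/mpolyP => k; rewrite phiE !mcoeffZ mcoeffX mcoeff_mono_trace.
  by case: eqP => _; rewrite ?mulr1 ?mulr0 ?rt0.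
exists phi; split=> // [a f|].
- elim/mpolyind: a => [|c k a _ _ IHa].
    by rewrite expr0n gtn_eqF // !mul0r phi0.
  rewrite (pexprD charD) !mulrDl phiD IHa; congr (_ + _).
  elim/mpolyind: f {IHa} => [|c' m f _ _ IHf]; first by rewrite mulr0 phi0 mulr0.
  rewrite mulrDr !phiD mulrDr IHf; congr (_ + _).
  rewrite exprZn mpolyXn -scalerAl -scalerAr scalerA -mpolyXD !phiX mono_traceD rtM.
  by rewrite -scalerAl -scalerAr scalerA.
- rewrite -[X in phi X]scale1r phiX rt1 scale1r /mono_trace.
  have dM : mono_div M = 0%MM by apply/mnmP => i; rewrite mnmE mnm0E divn_small.
  rewrite dM mpolyX0; case: eqP => // ME; case: ME; apply/mnmP => i.
  by rewrite mnmE mnm0E muln0.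
Qed.

End MonomialTrace.

Section OriginThreshold.
Variables (R : realType) (K : closedFieldType) (p d c e n : nat).
Hypothesis charK : p \in [pchar K].
Hypothesis le_cd : (c <= d)%N.
Hypothesis e_gt0 : (0 < e)%N.
Hypothesis n_gt0 : (0 < n)%N.
Local Notation q := (p ^ e)%N.
Local Notation mu := [multinom q.-1 | i < c].
Variable H : {mpoly K[c]}.
Hypothesis H0 : H@_0%MM = 0.
Hypothesis Hn0 : forall m : 'X_{1..c},
  (forall i, m i < q)%N -> (exists i, m i != q.-1) -> (H ^+ n)@_m = 0.
Hypothesis Hn : (H ^+ n)@_mu != 0.

Local Notation O := (origin_local_ring K d).
Local Notation P := (@origin_ideal K d).
Let charO : p \in [pchar O] := pchar_origin_local_ring d charK.
Local Notation loc := (loc (origin_ideal_prime K d)).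

Let y (i : 'I_c) : O := loc 'X_(widen_ord le_cd i).
Let cst (a : K) : O := loc a%:MP.
Let J := ideal_gen y.
Let q_gt0 : (0 < q)%N. Proof. exact: (pexp_gt0 charK). Qed.
Let idJ : ideal J. Proof. exact: ideal_gen_ideal. Qed.
Let idF : ideal (frob_power J q). Proof. exact: frob_power_ideal. Qed.

Lemma cst_add_unit a r : a != 0 -> J r -> cst a + r <> 0 /\ exists u, u * (cst a + r) = 1.
Proof.
move=> a0 Jr.
have [u [v [Pv [Pu rE]]]] : exists u v, ~ P v /\ P u /\ r * loc v = loc u.
  have [P0 PD PM] : ideal P by case: (origin_ideal_prime K d).
  have [_ P1 _] := origin_ideal_prime K d.
  have idJ0 : ideal [set r : O | exists u v, ~ P v /\ P u /\ r * loc v = loc u].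
    split=> [|r1 r2 [u1 [v1 [Pv1 [Pu1 E1]]]] [u2 [v2 [Pv2 [Pu2 E2]]]]|
      s r1 [u1 [v1 [Pv1 [Pu1 E1]]]]].
    - by exists 0, 1; rewrite mul0r rmorph0.
    - exists (u1 * v2 + u2 * v1), (v1 * v2); split.
        exact: (prime_neqM (origin_ideal_prime K d)).
      split; first by apply: PD; rewrite mulrC; apply: PM.
      by rewrite rmorphD !rmorphM /= -E1 -E2; ring.
    - have [a' [b' [Pb' sE]]] := localizationP s.
      exists (a' * u1), (b' * v1); split; first exact: (prime_neqM (origin_ideal_prime K d)).
      by split; [apply: PM | rewrite !rmorphM /= -E1 -sE; ring].
  apply: (ideal_gen_sub idJ0 _ Jr) => i; exists 'X_(widen_ord le_cd i), 1.
  split=> //; split; last by rewrite rmorph1 mulr1.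
  by apply/origin_idealE; rewrite mcoeffX mnm1_eq0.
have Pav : ~ P (a%:MP * v + u).
  move=> /origin_idealE; move/origin_idealE: Pu => u0.
  rewrite mcoeffD rmorphM /= u0 addr0 mcoeffC eqxx mulr1 => /eqP.
  rewrite mulf_eq0 (negPf a0) /= => /eqP v0.
  by apply: Pv; apply/origin_idealE.
have [w wE] := loc_unit (origin_ideal_prime K d) Pav.
have E : w * loc v * (cst a + r) = 1.
  by rewrite -wE rmorphD rmorphM /= -rE /cst; ring.
split; last by exists (w * loc v).
by move=> cr0; move/eqP: E; rewrite cr0 mulr0 eq_sym oner_eq0.
Qed.

Lemma vars_ideal_proper : ~ J 1.
Proof.
move=> J1; have JN1 : J (- cst 1).
  by case: idJ => _ _ JM; rewrite -[- cst 1]mulr1; apply: JM.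
by have [] := cst_add_unit (oner_neq0 K) JN1; rewrite subrr.
Qed.

Let psi (G : {mpoly K[c]}) : O := mmap cst y G.

Lemma psi_monomials G : psi G = \sum_(m <- msupp G) cst G@_m * \prod_i y i ^+ m i.
Proof. by []. Qed.

Lemma psi_exp G k : psi (G ^+ k) = psi G ^+ k.
Proof.
pose cstm : {rmorphism K -> O} := (loc \o (@mpolyC d K))%FUN.
exact: (rmorphXn (mmap cstm y : {rmorphism {mpoly K[c]} -> O})).
Qed.

Let h := psi H.

Lemma vars_ideal_mem : J h.
Proof.
rewrite /h psi_monomials big_seq; apply: ideal_bigsum => // m mH.
have m0 : m != 0%MM by apply: contraTneq mH => ->; rewrite mcoeff_msupp H0 eqxx.
have [i mi] := mnm_neq0 m0.
have [_ _ JM] := idJ; apply: JM; rewrite (bigD1 i) //=; apply: (ideal_mulr _ idJ).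
rewrite -(prednK (_ : 0 < m i)%N) ?lt0n // exprS; apply: (ideal_mulr _ idJ).
exact: ideal_gen_mem.
Qed.

Lemma prod_y_frob (m : 'X_{1..c}) i : (q <= m i)%N -> frob_power J q (\prod_j y j ^+ m j).
Proof.
move=> qm; rewrite (bigD1 i) //=; apply: (ideal_mulr _ idF).
rewrite -(subnK qm) exprD; case: idF => _ _; apply; apply: frob_powerX.
exact: ideal_gen_mem.
Qed.

Lemma expr_socle : frob_power J q (h ^+ n - cst (H ^+ n)@_mu * \prod_i y i ^+ q.-1).
Proof.
rewrite -psi_exp psi_monomials (bigD1_seq mu) ?msupp_uniq //=; last by rewrite mcoeff_msupp.
have -> : \prod_i y i ^+ mu i = \prod_i y i ^+ q.-1 by apply: eq_bigr => i _; rewrite mnmE.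
rewrite addrAC subrr add0r; apply: ideal_bigsum => // m m_mu.
have [/existsP[i qi]|] := boolP [exists i, (q <= m i)%N].
  by case: idF => _ _; apply; apply: prod_y_frob qi.
rewrite negb_exists => /forallP m_lt; have {}m_lt i : (m i < q)%N by rewrite ltnNge.
rewrite Hn0 // ?/cst ?rmorph0 ?mul0r; first by case: idF.
apply/existsP; apply: contraR m_mu; rewrite negb_exists => /forallP m_eq.
by apply/eqP/mnmP => i; rewrite mnmE; apply/eqP; rewrite -[_ == _]negbK.
Qed.

Lemma expr_vars_ideal_frob z : J z -> frob_power J q (h ^+ n * z).
Proof.
have [_ FD FM] := idF; move=> [a ->]; rewrite mulr_sumr; apply: ideal_sum => // i.
rewrite mulrCA; apply: (FM).
rewrite -(subrK (cst (H ^+ n)@_mu * \prod_i y i ^+ q.-1) (h ^+ n)) mulrDl; apply: FD.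
  by apply: (ideal_mulr _ idF); apply: expr_socle.
rewrite -mulrA; apply: FM; rewrite (bigD1 i) //= mulrAC -exprSr prednK //.
by apply: (ideal_mulr _ idF); apply: frob_powerX; apply: ideal_gen_mem.
Qed.

(** The induction runs on the stronger h^(n_k) J <= J^[q^k]; the additional factor [h] lies in
    [J]. *)
Lemma expr_geom_frob k : frob_power J (p ^ (e * k)) (h ^+ (n * geom q k).+1).
Proof.
suff hJ z : J z -> frob_power J (p ^ (e * k)) (h ^+ (n * geom q k) * z).
  by rewrite exprSr; apply: hJ; apply: vars_ideal_mem.
elim: k z => [|k IH] z Jz.
  by rewrite muln0 frob_power1 // /geom big_ord0 muln0 mul1r.
have -> : h ^+ (n * geom q k.+1) * z = h ^+ n * z * (h ^+ (n * geom q k)) ^+ q.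
  by rewrite geomS mulnDr muln1 exprD -exprM mulnCA [(q * _)%N]mulnC; ring.
rewrite mulnSr expnD -(frob_powerM charO).
by apply: frob_power_mulr (expr_vars_ideal_frob Jz) => u Ju; rewrite mulrC; apply: IH.
Qed.

(** The trace dual to y^(q - 1) sends h^n to a [q]-th root of the corner coefficient plus an element
    of [J], which is a unit. *)
Lemma expr_splits : splits charO e (h ^+ n).
Proof.
pose M : 'X_{1..d} := [multinom if (i < c)%N then q.-1 else 0%N | i < d].
have M_lt i : (M i < q)%N by rewrite mnmE; case: ifP; rewrite ?prednK.
have [phi [phiB phiM phi1]] := monomial_trace_exists charK M_lt.
have [Phi [PhiB PhiM PhiL]] := localize_semilinear (origin_ideal_prime K d) q_gt0 phiB phiM.
have prodE : \prod_i y i ^+ q.-1 = loc 'X_[M].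
  rewrite mpolyXE_id rmorph_prod /= (bigID (fun i : 'I_d => (i < c)%N)) /=.
  rewrite [X in _ * X]big1 ?mulr1 => [|i /negPf ic]; last by rewrite mnmE ic expr0 rmorph1.
  rewrite (big_ord_narrow le_cd); apply: eq_bigr => i _.
  by rewrite mnmE /= ltn_ord rmorphXn.
have [r rE] : exists r : K, r ^+ q = (H ^+ n)@_mu.
  have [|r] := closed_rootP ('X^q - ((H ^+ n)@_mu)%:P) _.
    by rewrite size_XnsubC // eqSS -lt0n.
  by rewrite rootE !hornerE subr_eq0 => /eqP; exists r.
have r0 : r != 0 by apply: contraNneq Hn => r0; rewrite -rE r0 expr0n gtn_eqF.
have JPhi := semilinear_frob_power PhiB PhiM idJ expr_socle.
have PhiE : Phi (h ^+ n) = cst r + Phi (h ^+ n - cst (H ^+ n)@_mu * \prod_i y i ^+ q.-1).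
  have -> : cst (H ^+ n)@_mu = cst r ^+ q by rewrite -rE /cst -rmorphXn /= -rmorphXn.
  by rewrite PhiB PhiM prodE PhiL phi1 rmorph1 mulr1 addrC subrK.
have [_ [u uE]] := cst_add_unit r0 JPhi.
by apply: (@semilinear_splits _ _ charO e Phi (h ^+ n) u PhiB PhiM); rewrite PhiE.
Qed.

Lemma fpt_values_origin :
  fpt_set_origin R d charK (n%:R / (q - 1)%:R).
Proof.
exists h.
  split=> // hT; have [a _ ahE] : principal h 1 by apply: hT.
  by apply: vars_ideal_proper; rewrite -ahE; case: idJ => _ _; apply; apply: vars_ideal_mem.
have h0 : h != 0.
  apply/eqP => h0; have [phi phiT] := expr_splits.
  have : [set: O] 1 by []; rewrite -phiT => -[_ [b _ <-]].
  rewrite h0 expr0n gtn_eqF // mulr0 linear0 => /eqP.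
  by rewrite eq_sym oner_eq0.
rewrite /fpt (negPf h0).
have St := splits_fpt_exponents R e_gt0 expr_splits.
have ubS s : fpt_exponents charO h s -> s <= n%:R / (q - 1)%:R.
  exact: fpt_exponents_le idJ vars_ideal_proper e_gt0 expr_geom_frob.
apply/eqP; rewrite eq_le; apply/andP; split.
  by apply: ge_sup; [exists (n%:R / (q - 1)%:R) | exact: ubS].
by apply: ub_le_sup => //; exists (n%:R / (q - 1)%:R) => s; apply: ubS.
Qed.

End OriginThreshold.

(** * From the regular local ring to the inclusion of threshold sets *)

Section RegularLocalRing.
Variables (A : comNzRingType) (p d : nat).
Hypothesis charA : p \in [pchar A].
Hypothesis regA : regular_local_ring A d.

(** A chain of primes of length [d] yields growth [d] at its top, and this passes up to [M].
    Elements outside [M] are units because every proper ideal lies in a maximal one. *)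
Lemma regular_local_ringP : exists x : 'I_d -> A,
  [/\ prime_ideal (ideal_gen x), forall a, ~ ideal_gen x a -> exists b, b * a = 1 &
    growth p (ideal_gen x) d].
Proof.
have [noethA [[Q [pQ ltQ]] _] [M [maxM uniqM [x ME]]]] := regA.
have [idM [_ MT] _] := maxM.
have M1 : ~ M 1 by move=> /(idealT idM) MTE; apply: MT; rewrite MTE.
have unitM a : ~ M a -> exists b, b * a = 1.
  move=> Ma; apply: contrapT => nob; apply: Ma.
  have idPa : ideal (principal a).
    split=> [|_ _ [u _ <-] [v _ <-]|u _ [v _ <-]].
    - by exists 0; rewrite ?mul0r.
    - by exists (u + v); rewrite ?mulrDl.
    - by exists (u * v); rewrite ?mulrA.
  have [||N [[idN N1 aN] Nmax]] := @noetherian_max _ noethA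
    [set N | [/\ ideal N, ~ N 1 & principal a `<=` N]] (principal a).
  - by move=> N [].
  - by split=> // -[b _ ba]; apply: nob; exists b.
  suff <- : N = M by apply: aN; exists 1; rewrite ?mul1r.
  apply: uniqM; split=> //.
    by split=> // NT; apply: N1; apply: NT.
  move=> I idI NI [_ IT]; apply: Nmax => //; split=> //.
    by move=> /(idealT idI) ITE; apply: IT; rewrite ITE.
  exact: subset_trans NI.
have primeM : prime_ideal M.
  split=> // a b Mab; apply: contrapT => /not_orP[/unitM[u ua] /unitM[v vb]].
  apply: M1; have -> : 1 = u * v * (a * b) by rewrite mulrACA ua vb mulr1.
  by case: idM => _ _; apply.
exists x; rewrite -ME; split=> //.
have gQ := growth_prime_chain charA noethA ord_max pQ ltQ.
have [idQ Q1 _] := pQ ord_max.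
have QM : Q ord_max `<=` M.
  move=> a Qa; apply: contrapT => /unitM[b ba]; apply: Q1; rewrite -ba.
  by case: idQ => _ _; apply.
have [MQ|MQ] := pselect (M `<=` Q ord_max).
  by have <- : Q ord_max = M by apply/seteqP.
exact: growth_leq (leqnSn d) (growth_lt charA noethA (pQ ord_max) primeM (conj QM MQ) gQ).
Qed.

End RegularLocalRing.

(** By Euler's theorem the denominator divides p^e - 1 with [e] its totient; the cofactor [k] is
    moved into the numerator. *)
Lemma localized_int_expn (R : realType) p (t : R) : prime p -> localized_int R p t -> 0 < t ->
  exists e n, [/\ (0 < e)%N, (0 < n)%N & t = n%:R / (p ^ e - 1)%:R].
Proof.
move=> p_pr [r pr <-] r0; have D0 := denq_gt0 r.
have cop : coprime p `|denq r|%N by rewrite prime_coprime.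
have D0' : (0 < `|denq r|)%N by rewrite absz_gt0 denq_neq0.
have e0 : (0 < totient `|denq r|)%N by rewrite totient_gt0.
set e := totient _ in e0; have q1 : (1 < p ^ e)%N by rewrite -(exp1n e) ltn_exp2r // prime_gt1.
have /dvdnP[k kE] : (`|denq r| %| p ^ e - 1)%N.
  by rewrite -eqn_mod_dvd ?(ltnW q1) //; apply/eqP; apply: Euler_exp_totient.
have k0 : (0 < k)%N by case: k kE => // /eqP; rewrite mul0n subn_eq0 leqNgt q1.
have num0 : 0 < numq r by rewrite numq_gt0 -(ltr0q R).
exists e, (`|numq r| * k)%N; split=> //.
  by rewrite muln_gt0 k0 absz_gt0 gt_eqF.
rewrite kE mulnC !natrM -mulf_div divff ?mul1r ?pnatr_eq0 -?lt0n //.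
by rewrite !natr_absz !gtr0_norm // /ratr.
Qed.

Lemma fpt_set_localized_int (R : realType) p (p_pr : prime p) d (K : closedFieldType)
    (charK : p \in [pchar K]) :
  fpt_set R d p `&` localized_int R p `<=` fpt_set_origin R d charK.
Proof.
move=> t [[A [charA [FfinA regA [f [fA fT] ft]]]] tZ].
have [t0|t0] := eqVneq t 0.
  (* The value 0 is attained by the zero ideal, by convention. *)
  exists 0; last by rewrite /fpt eqxx.
  split=> // /(_ 1 I)[a _]; rewrite mulr0 => /eqP.
  by rewrite eq_sym oner_eq0.
have [x [primeM unitM growthM]] := regular_local_ringP charA regA.
have [noethA _ _] := regA; have [idM M1 _] := primeM.
set M := ideal_gen x in primeM unitM growthM idM M1.
have dbA e := dual_basis_exists noethA primeM unitM growthM e FfinA.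
have splitsM e a : ~ frob_power M (p ^ e) a -> splits charA e a.
  have [n [g [phi db]]] := dbA e.
  exact: (dual_basis_splits charA db unitM).
have Mf : M f.
  apply: contrapT => /unitM[b bf]; apply: fT => a _.
  by exists (a * b); rewrite -?mulrA ?bf ?mulr1.
have f0 : f != 0 by apply: contra_neq t0 => f0; rewrite -ft /fpt f0 eqxx.
move: ft; rewrite /fpt (negPf f0) => supE.
have supS := fpt_exponents_has_sup R idM M1 splitsM Mf.
have t_gt0 : 0 < t.
  rewrite lt_neqAle eq_sym t0 -supE /=.
  have [[s Ss] _] := supS; have s0 : 0 <= s by case: Ss.
  by apply: le_trans s0 _; apply: sup_upper_bound.
have [e [n [e_gt0 n_gt0 tE]]] := localized_int_expn p_pr tZ t_gt0.
rewrite tE in supE *.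
have fM := fpt_frob_power idM M1 splitsM Mf e_gt0 supE.
have fMN := fpt_frob_powerN idM M1 splitsM Mf e_gt0 n_gt0 supE.
have primeP := splitting_prime_prime charA f e n idM M1 unitM dbA.
pose P := splitting_prime p M f e n.
have PM : P `<=` M := splitting_prime_sub idM.
have [c [y [geny miny]]] := local_generators_exists noethA primeP.
have le_cd : (c <= d)%N.
  apply: (growth_leq_dim charA noethA primeM unitM primeP PM).
  exact: (growth_local_generators charA dbA primeP geny miny).
have [W cW fW] := coef_ring_exists charA primeP e.
have socleP := local_socle charA dbA primeP geny miny.
have [G [G0 Gn Gmu]] := socle_expansion charA primeP geny cW fW
  (fun m w => @socleP e m w) (splitting_prime_mem fM)
  (fun a => splitting_prime_compatible charA dbA (a := a))
  (splitting_primeN charA idM unitM fMN).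
have [H [HG Hmu]] := specialize_mpoly charK charA primeP Gmu.
apply: (@fpt_values_origin R K p d c e n charK le_cd e_gt0 n_gt0 H) => //.
  by have := HG 1%N 0%MM; rewrite !expr1; apply.
by move=> m m_lt mq; apply: HG; apply: Gn.
Qed.


Unset Implicit Arguments.

Theorem corollary1p6 (R : realType) (p : nat) (p_pr : prime p)
    (d : nat) (d_gt0 : (0 < d)%N)
    (K : closedFieldType) (iota : {rmorphism 'F_p -> K})
    (K_closure : algebraic_closure_Fp iota) :
  fpt_set R d p `&` localized_int R p
    `<=` fpt_set_origin R d (pchar_over_Fp p_pr iota).
Proof. exact: fpt_set_localized_int. Qed.
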